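(* Let $\bar X$, $\bar Y$, $\bar Z$ be stationary time-homogeneous Markov chains with time indexed by $\mathbb Z$, countable state spaces $A,B,C$, time-$0$ (stationary) distributions $\pi_X,\pi_Y,\pi_Z$ with supports all of $A$, $B$ and $C$ respectively, and transition matrices $P_X,P_Y,P_Z$. Let $P_X^{\mathrm{rev}},P_Y^{\mathrm{rev}},P_Z^{\mathrm{rev}}$ be the transition matrices of their time-reversals. Let $f:A\to C$, $g:B\to C$ be maps with $(f(\bar X_t))_{t\in\mathbb Z}\overset{d}{=}\bar Z\overset{d}{=}(g(\bar Y_t))_{t\in\mathbb Z}$. Let $\Delta=\{(a,b)\in A\times B:f(a)=g(b)\}$, and let $R$ be the matrix indexed by $\Delta$ with $$R\bigl((a,b),(a',b')\bigr)=\begin{cases}\dfrac{P_X(a,a')P_Y(b,b')}{P_Z(f(a),f(a'))}&\text{if }P_Z(f(a),f(a'))>0,\\0&\text{otherwise,}\end{cases}$$ and let $R^{\mathrm{rev}}$ be defined by the same formula with $P_X^{\mathrm{rev}},P_Y^{\mathrm{rev}},P_Z^{\mathrm{rev}}$ in place of $P_X,P_Y,P_Z$. Let $\mathbf 1_\Delta$ be the column vector of $1$s indexed by $\Delta$. Then the coordinatewise limits $\varphi=\lim_{m\to\infty}R^m\mathbf 1_\Delta$ and $\varphi^{\mathrm{rev}}=\lim_{m\to\infty}(R^{\mathrm{rev}})^m\mathbf 1_\Delta$ exist. Moreover, let $$\Delta''=\{(a,b)\in\Delta:\varphi(a,b)>0\text{ and }\varphi^{\mathrm{rev}}(a,b)>0\},$$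 for $(a,b)\in\Delta''$ with $c=f(a)=g(b)$ let $$\pi(a,b)=\frac{\pi_X(a)\pi_Y(b)}{\pi_Z(c)}\,\varphi(a,b)\,\varphi^{\mathrm{rev}}(a,b),$$ and for $(a,b),(a',b')\in\Delta''$ let $$P((a,b),(a',b'))=\frac{1}{\varphi(a,b)}R\bigl((a,b),(a',b')\bigr)\varphi(a',b').$$ Then $\pi$ is a probability distribution on $\Delta''$, $P$ is a stochastic matrix on $\Delta''$, $\pi P=\pi$, and the stationary Markov chain $(X_t,Y_t)_{t\in\mathbb Z}$ on $\Delta''$ with stationary distribution $\pi$ and transition matrix $P$ satisfies $(X_t)_{t\in\mathbb Z}\overset{d}{=}\bar X$, $(Y_t)_{t\in\mathbb Z}\overset{d}{=}\bar Y$, $f(X_t)=g(Y_t)$ for all $t\in\mathbb Z$, and $(X_t)_{t\in\mathbb Z}$ and $(Y_t)_{t\in\mathbb Z}$ are conditionally independent given $(f(X_t))_{t\in\mathbb Z}$.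
   Context: A process $(X_t)_{t\in\mathbb Z}$ is stationary if it is equal in distribution to $(X_{t+1})_{t\in\mathbb Z}$. The transition matrix of the time-reversal of a stationary chain with full-support stationary distribution $\pi$ and transition matrix $Q$ is $Q^{\mathrm{rev}}(x,y)=\pi(y)Q(y,x)/\pi(x)$. $\overset{d}{=}$ denotes equality in law of processes. *)

(* Defs.v *)
From HB Require Import structures.
From mathcomp Require Import all_boot all_order all_algebra.
From mathcomp Require Import all_classical all_reals all_analysis.

Set Implicit Arguments.
Unset Strict Implicit.
Unset Printing Implicit Defensive.

Import Order.TTheory GRing.Theory Num.Theory.
Import numFieldNormedType.Exports.

Local Open Scope classical_set_scope.
Local Open Scope ring_scope.

(** Sums over a countable index type are [\esum]s, which are meaningful for
    nonnegative terms; every family summed below is nonnegative. *)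
Section CountableMatrices.
Context {R : realType} {T : countType}.

Definition is_distribution (p : T -> R) : Prop :=
  (forall x, 0 <= p x) /\ \esum_(x in [set: T]) (p x)%:E = 1%E.

Definition stochastic (M : T -> T -> R) : Prop :=
  forall x, is_distribution (M x).

Definition invariant_distribution (p : T -> R) (M : T -> T -> R) : Prop :=
  forall y, \esum_(x in [set: T]) (p x * M x y)%:E = (p y)%:E.

(** Matrix powers of a nonnegative matrix are computed in [\bar R], so that no
    finiteness has to be assumed to form them. *)
Fixpoint mpow (M : T -> T -> R) (m : nat) : T -> T -> \bar R :=
  match m with
  | 0 => fun x y => ((x == y)%:R)%:E
  | m'.+1 => fun x z => \esum_(y in [set: T]) ((M x y)%:E * mpow M m' y z)%E
  end.

Definition mapply (M : T -> T -> \bar R) (v : T -> R) : T -> \bar R :=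
  fun x => \esum_(y in [set: T]) (M x y * (v y)%:E)%E.

Definition rev_mx (p : T -> R) (M : T -> T -> R) : T -> T -> R :=
  fun x y => p y * M y x / p x.

End CountableMatrices.

(** Countable state spaces carry the discrete sigma-algebra. *)
Section Processes.
Context {R : realType}.

Definition is_process {d} {Om : measurableType d} {T : Type}
    (X : int -> Om -> T) : Prop :=
  forall t (S : set T), measurable (X t @^-1` S).

(** Generators of the product sigma-algebra on the path space [int -> T]. *)
Definition cylinders (T : Type) : set (set (int -> T)) :=
  [set E | exists t (S : set T), E = [set x | S (x t)]].
Arguments cylinders T : clear implicits.

Definition eq_law {d d'} {Om : measurableType d} {Om' : measurableType d'}
    {T : Type} (Pr : probability Om R) (X : int -> Om -> T)
    (Pr' : probability Om' R) (X' : int -> Om' -> T) : Prop :=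
  forall E, <<s cylinders T >> E ->
    Pr [set w | E (X ^~ w)] = Pr' [set w | E (X' ^~ w)].

Definition stationary {d} {Om : measurableType d} {T : Type}
    (Pr : probability Om R) (X : int -> Om -> T) : Prop :=
  eq_law Pr X Pr (fun t => X (t + 1)).

(** [Pr (X_{t+n+1} = y | X_t = x_0, .., X_{t+n} = x_n) = P x_n y], multiplied
    by the probability of the conditioning event so that null events impose
    nothing. *)
Definition markov_property {d} {Om : measurableType d} {T : Type}
    (Pr : probability Om R) (X : int -> Om -> T) (P : T -> T -> R) : Prop :=
  forall (t : int) (n : nat) (x : nat -> T),
    Pr [set w | forall i, (i <= n.+1)%N -> X (t + i%:Z)%R w = x i] =
    (Pr [set w | forall i, (i <= n)%N -> X (t + i%:Z)%R w = x i]
       * (P (x n) (x n.+1))%:E)%E.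

Record stationary_markov_chain {d} {Om : measurableType d} {T : countType}
    (Pr : probability Om R) (X : int -> Om -> T)
    (p : T -> R) (P : T -> T -> R) : Prop := StationaryMarkovChain {
  smc_process : is_process X ;
  smc_stationary : stationary Pr X ;
  smc_distribution : forall x, Pr (X 0 @^-1` [set x]) = (p x)%:E ;
  smc_stochastic : stochastic P ;
  smc_markov : markov_property Pr X P }.

(** Generators of the sigma-algebra on [Om] generated by a process. *)
Definition process_events {Om T : Type} (X : int -> Om -> T) : set (set Om) :=
  [set E | exists t (S : set T), E = X t @^-1` S].

(** [q] is a version of the conditional probability of [E] given the
    sigma-algebra [<<s G >>]. *)
Definition is_cond_prob {d} {Om : measurableType d} (Pr : probability Om R)
    (G : set (set Om)) (E : set Om) (q : Om -> R) : Prop :=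
  [/\ measurable_fun [set: g_sigma_algebraType G]
        (q : g_sigma_algebraType G -> R),
      Pr.-integrable [set: Om] (EFin \o q) &
      forall H, <<s G >> H -> (\int[Pr]_(w in H) (q w)%:E = Pr (E `&` H))%E].

(** Conditional independence of [X] and [Y] given [Z]:
    [Pr (E `&` F | Z) = Pr (E | Z) * Pr (F | Z)] almost surely for all events
    [E] of [X] and [F] of [Y].  Versions of a conditional probability are almost
    surely unique, so the choice of the versions is immaterial. *)
Definition cond_independent {d} {Om : measurableType d} {S T U : Type}
    (Pr : probability Om R) (X : int -> Om -> S) (Y : int -> Om -> T)
    (Z : int -> Om -> U) : Prop :=
  forall E F, <<s process_events X >> E -> <<s process_events Y >> F ->
    exists q r : Om -> R,
      [/\ is_cond_prob Pr (process_events Z) E q,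
          is_cond_prob Pr (process_events Z) F r &
          is_cond_prob Pr (process_events Z) (E `&` F) (q \* r)].

End Processes.

Section FiberProduct.
Context {R : realType} {A B C : countType} (f : A -> C) (g : B -> C).

Definition Delta : countType := {ab : A * B | f ab.1 == g ab.2}.

Definition Delta_fst (x : Delta) : A := (sval x).1.
Definition Delta_snd (x : Delta) : B := (sval x).2.

Definition fiber_mx (PX : A -> A -> R) (PY : B -> B -> R) (PZ : C -> C -> R) :
    Delta -> Delta -> R :=
  fun x y =>
    let: (a, b) := (Delta_fst x, Delta_snd x) in
    let: (a', b') := (Delta_fst y, Delta_snd y) in
    if 0 < PZ (f a) (f a') then PX a a' * PY b b' / PZ (f a) (f a') else 0.

Definition Delta2 (phi phirev : Delta -> R) : countType :=
  {x : Delta | (0 < phi x) && (0 < phirev x)}.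

Context (phi phirev : Delta -> R).

Definition Delta2_fst (x : Delta2 phi phirev) : A := Delta_fst (sval x).
Definition Delta2_snd (x : Delta2 phi phirev) : B := Delta_snd (sval x).

Definition joint_distribution (piX : A -> R) (piY : B -> R) (piZ : C -> R) :
    Delta2 phi phirev -> R :=
  fun x => piX (Delta2_fst x) * piY (Delta2_snd x) / piZ (f (Delta2_fst x))
             * phi (sval x) * phirev (sval x).

Definition joint_transition (M : Delta -> Delta -> R) :
    Delta2 phi phirev -> Delta2 phi phirev -> R :=
  fun x y => (phi (sval x))^-1 * M (sval x) (sval y) * phi (sval y).

End FiberProduct.

Arguments fiber_mx {R A B C} f g PX PY PZ _ _.
Arguments joint_distribution {R A B C f g} phi phirev piX piY piZ _.
Arguments joint_transition {R A B C f g} phi phirev M _ _.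

(* Main.v *)
From HB Require Import structures.
Require Import Defs.
From mathcomp Require Import all_boot all_order all_algebra.
From mathcomp Require Import all_classical all_reals all_analysis.
From mathcomp Require Import measurable_realfun.
From mathcomp Require Import ring lra zify.

Set Implicit Arguments.
Unset Strict Implicit.
Unset Printing Implicit Defensive.

Import Order.TTheory GRing.Theory Num.Theory.
Import numFieldNormedType.Exports.

Local Open Scope classical_set_scope.
Local Open Scope ring_scope.
Local Open Scope ereal_scope.

(** Write [W_X(x s)] for the mass [piX x * PX x s_1 * ..] of a word [x s] of [X],
    and similarly for [Y] and [Z].  Let [x s] and [y v] be words of [X] and [Y] over
    the same word of [Z].  In the
    coupling of [X] and [Y] that is conditionally independent given the labels in
    the window enlarged by [k] letters on each side, this pair of words has mass

      [W_X(x s) * W_Y(y v) / W_Z(f(x s)) * (R^rev)^k 1 (x, y) * R^k 1 (last s, last v)]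

    ([coupling_split]).  Indeed [R^k 1 (a, b)] is a sum over label words [r] of
    length [k] of [alpha r * beta r / gamma r], where [alpha], [beta], [gamma] are
    the probabilities of reading [r] next from [a], [b] and their common label
    ([mapply_mpow]).  So [phi] and [phirev] are the limits of the factors that stand
    for the future and the past.

    The limits exist by polarization ([fiber_limit]): [alpha], [beta] and
    [alpha + beta] are laws on label sequences with a bounded density with respect
    to [gamma], and the squared norm of the density on words of length [k] is
    nondecreasing and bounded.  The bound on the densities is where the identity in
    law of [f X] and [Z] enters ([label_prob_dominated]).

    Dominated convergence gives [R phi = phi] ([fiber_harmonic]), and likewise for
    [R^rev]; by detailed balance between [R] and [R^rev] ([fiber_mx_rev]) this says
    that [P] is stochastic and that [pi] is invariant.  The couplings above have
    marginals [W_X] and [W_Y] for every [k], and they are dominated by these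
    marginals, so their limit [joint_mass] has the same marginals
    ([esum_joint_mass]).  The products along a word of the chain [P] telescope to
    [joint_mass] ([joint_word_mass]), so the coordinates of that chain have the laws
    of [X] and [Y].

    For conditional independence, let [E] and [F] be events that fix the words of
    the two coordinates in a window, and let [q] be the conditional probability of
    [F] given the labels.  The integral of [q] over [E] is the limit of the same
    integral computed with the labels in a window enlarged by [k] letters
    ([partition_cvg]); that is the mass of the above coupling, whose limit is the
    probability of the intersection ([joint_windows]).  A lambda-system argument
    in each variable extends this to all events ([decoupled_windows]), which is
    conditional independence ([decoupled_cond_independent]). *)

(** * Sums over countable types *)

Section CountableSums.
Context {R : realType}.

(** Enumerating the type by [pickle] turns sums into series, hence into integrals
    for the counting measure, to which the convergence theorems apply. *)
Lemma esum_nat {T : countType} (F : T -> \bar R) :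
  \esum_(x in [set: T]) F x =
  \esum_(n in [set: nat]) oapp F 0 (pickle_inv n).
Proof.
have inj : set_inj [set: T] (@pickle T) by move=> x y _ _ /(congr1 (@unpickle T)); rewrite !pickleK => -[].
transitivity (\esum_(n in (@pickle T) @` setT) oapp F 0 (pickle_inv n)).
  by rewrite esum_image//; apply: eq_esum => x _; rewrite pickleK_inv.
rewrite esum_mkcond; apply: eq_esum => n _; case: ifPn => // /negP nP.
case E : (pickle_inv n) => [x|//]; exfalso; apply: nP.
rewrite inE; exists x => //; have := @pickle_invK T n; by rewrite /ocancel E.
Qed.

Lemma esum_integral {T : countType} (F : T -> \bar R) : (forall x, 0 <= F x) ->
  \esum_(x in [set: T]) F x =
  \int[counting]_n oapp F 0 (pickle_inv n).
Proof.
move=> F0; have a0 n : 0 <= oapp F 0 (pickle_inv n) by case: (pickle_inv n).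
by rewrite esum_nat ge0_integral_count// nneseries_esumT.
Qed.

Lemma esum_term_le {T : choiceType} (F : T -> \bar R) x : (forall y, 0 <= F y) ->
  F x <= \esum_(y in [set: T]) F y.
Proof.
move=> F0; rewrite -(@esum_set1 _ _ x F)// [leLHS]esum_mkcond.
by apply: le_esum => i _; case: ifP.
Qed.

Lemma esum_single {T : choiceType} (F : T -> \bar R) x : 0 <= F x ->
  (forall y, y != x -> F y = 0) -> \esum_(y in [set: T]) F y = F x.
Proof.
move=> F0 Fx; rewrite -(@esum_set1 _ _ x F)// [RHS]esum_mkcond.
apply: eq_esum => i _; case: ifPn => //; rewrite in_set1.
exact: Fx.
Qed.

Lemma esumZl {T : countType} (c : \bar R) (F : T -> \bar R) :
  0 <= c -> (forall x, 0 <= F x) ->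
  \esum_(x in [set: T]) (c * F x) = c * \esum_(x in [set: T]) F x.
Proof.
move=> c0 F0; rewrite !esum_integral//; last by move=> x; exact: mule_ge0.
rewrite -ge0_integralZl//.
  by apply: eq_integral => n _; case: (pickle_inv n) => //=; rewrite mule0.
by move=> n _; case: (pickle_inv n).
Qed.

Lemma esumZr {T : countType} (c : \bar R) (F : T -> \bar R) :
  0 <= c -> (forall x, 0 <= F x) ->
  \esum_(x in [set: T]) (F x * c) = (\esum_(x in [set: T]) F x) * c.
Proof.
by move=> c0 F0; under eq_esum do rewrite muleC; rewrite esumZl// muleC.
Qed.

Lemma esum_pair {T U : choiceType} (F : T -> U -> \bar R) :
  (forall x y, 0 <= F x y) ->
  \esum_(x in [set: T]) \esum_(y in [set: U]) F x y =
  \esum_(p in [set: T * U]) F p.1 p.2.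
Proof.
move=> F0; rewrite (esum_esum (J := fun=> setT))//.
by congr (esum _ _); apply/seteqP; split => // -[x y].
Qed.

Lemma esum_exchange {T U : choiceType} (F : T -> U -> \bar R) :
  (forall x y, 0 <= F x y) ->
  \esum_(x in [set: T]) \esum_(y in [set: U]) F x y =
  \esum_(y in [set: U]) \esum_(x in [set: T]) F x y.
Proof.
move=> F0; rewrite !esum_pair//.
rewrite (@reindex_esum _ _ _ setT setT (fun p : U * T => (p.2, p.1)))//.
split=> //.
- by move=> [a b] [c d] _ _ /= [-> ->].
- by move=> [a b] _; exists (b, a).
Qed.

Lemma esum_subtype {T : choiceType} (P : pred T) (F : T -> \bar R) :
  \esum_(x in [set: {x | P x}]) F (val x) =
  \esum_(x in [set: T]) (if P x then F x else 0).
Proof.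
transitivity (\esum_(x in (val : {x | P x} -> T) @` setT) F x).
  by rewrite esum_image// => x y _ _; exact: val_inj.
rewrite esum_mkcond; apply: eq_esum => x _.
case: ifPn => [|/negP xP].
  by rewrite inE => -[[y Py] _ /= <-]; rewrite Py.
case: ifPn => // Px; exfalso; apply: xP; rewrite inE.
by exists (exist _ x Px).
Qed.

Lemma esum_bij {T U : choiceType} (h : T -> U) (F : U -> \bar R) :
  bijective h -> \esum_(y in [set: U]) F y = \esum_(x in [set: T]) F (h x).
Proof.
move=> [h' hK h'K]; apply: reindex_esum; split=> //.
- by move=> x y _ _; move=> /(congr1 h'); rewrite !hK.
- by move=> y _; exists (h' y).
Qed.

Lemma esum_inj {T U : choiceType} (h : T -> U) (F : U -> \bar R) :
  injective h -> (forall y, (forall x, y <> h x) -> F y = 0) ->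
  \esum_(y in [set: U]) F y = \esum_(x in [set: T]) F (h x).
Proof.
move=> hI F0; rewrite -(@esum_image _ _ _ setT h) ; last by move=> x y _ _; exact: hI.
rewrite [RHS]esum_mkcond; apply: eq_esum => y _; case: ifPn => // /negP hy.
by apply: F0 => x yx; apply: hy; rewrite inE; exists x.
Qed.

Lemma esum_option {T : choiceType} (F : option T -> \bar R) :
  (forall x, 0 <= F x) ->
  \esum_(o in [set: option T]) F o = F None + \esum_(x in [set: T]) F (Some x).
Proof.
move=> F0.
have -> : \esum_(o in [set: option T]) F o =
    \esum_(o in [set: option T]) ((if o is None then F None else 0) +
       (if o is Some _ then F o else 0)).
  by apply: eq_esum => -[x|] _; rewrite ?adde0 ?add0e.
rewrite esumD; [|by case|by case].
congr (_ + _); first by rewrite (@esum_single _ _ None)// => -[].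
rewrite (@esum_inj _ _ Some)//.
by case=> // x /(_ x).
Qed.

Lemma esum_seq {T : countType} (F : seq T -> \bar R) : (forall s, 0 <= F s) ->
  \esum_(s in [set: seq T]) F s =
  F [::] + \esum_(x in [set: T]) \esum_(s in [set: seq T]) F (x :: s).
Proof.
move=> F0; rewrite esum_pair//.
have := @esum_option _ (fun o : option (T * seq T) =>
  F (if o is Some p then p.1 :: p.2 else [::])) => /= <- //.
rewrite (@esum_bij _ _ (fun o : option (T * seq T) =>
  if o is Some p then p.1 :: p.2 else [::]))//.
exists (fun s => if s is x :: s' then Some (x, s') else None); last by case.
by case=> [[]|].
Qed.

Lemma esum_seq_rcons {T : countType} (F : seq T -> \bar R) : (forall s, 0 <= F s) ->
  \esum_(s in [set: seq T]) F s =
  F [::] + \esum_(s in [set: seq T]) \esum_(x in [set: T]) F (rcons s x).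
Proof.
move=> F0; rewrite esum_exchange// (@esum_bij _ _ (@rev T)); last first.
  by exists rev; exact: revK.
rewrite esum_seq//; congr (_ + _); apply: eq_esum => x _.
rewrite [RHS](@esum_bij _ _ (@rev T)); last by exists rev; exact: revK.
by apply: eq_esum => s _; rewrite rev_cons.
Qed.

Lemma esum_dominated {T : countType} (F : nat -> T -> \bar R)
    (f g : T -> \bar R) :
  (forall k x, 0 <= F k x) -> (forall k x, F k x <= g x) ->
  (forall x, F k x @[k --> \oo] --> f x) ->
  \esum_(x in [set: T]) g x < +oo ->
  \esum_(x in [set: T]) F k x @[k --> \oo] --> \esum_(x in [set: T]) f x.
Proof.
move=> F0 Fg Ff goo.
have f0 x : 0 <= f x.
  rewrite -(cvg_lim _ (Ff x))//; apply: lime_ge; first by apply/cvg_ex; exists (f x).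
  by apply: nearW => k.
have g0 x : 0 <= g x := le_trans (F0 0%N x) (Fg 0%N x).
rewrite esum_integral//.
under eq_fun do rewrite esum_integral//.
pose h (u : T -> \bar R) := fun n : nat => oapp u 0 (pickle_inv n).
have ig : counting.-integrable [set: nat] (h g).
  apply/integrableP; split => //.
  rewrite (eq_integral (h g)) -?esum_integral// => n _.
  by rewrite gee0_abs// /h; case: (pickle_inv n).
case: (@dominated_convergence _ _ R counting [set: nat] measurableT
  (fun k => h (F k)) (h f) (h g)) => //.
- apply: aeW => n _; rewrite /h; case: (pickle_inv n) => [x|] //=.
  exact: cvg_cst.
- by apply: aeW => n k _; rewrite gee0_abs /h; case: (pickle_inv n) => //=.
Qed.

End CountableSums.

(** * Refining flows on words and polarization *)

Section Flows.
Context {R : realType} {C : countType}.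
Local Open Scope ring_scope.
Implicit Types u v w g : nat -> seq C -> R.

(** The laws [w k] of the first [k] letters under a finite measure on sequences
    of letters.  With [flow_rcons], [flow_nil] leaves no mass on words shorter than
    [k]. *)
Record flow w : Prop := Flow {
  flow_ge0 : forall k r, 0 <= w k r ;
  flow_nil : forall k, w k.+1 [::] = 0 ;
  flow_rcons : forall k r,
    \esum_(c in [set: C]) (w k.+1 (rcons r c))%:E = (w k r)%:E }.

Lemma flowD u v : flow u -> flow v -> flow (fun k r => u k r + v k r).
Proof.
move=> fu fv; split=> [k r|k|k r].
- by rewrite addr_ge0 ?flow_ge0.
- by rewrite !flow_nil ?addr0.
- under eq_esum do rewrite EFinD.
  by rewrite esumD ?flow_rcons// => i _; rewrite lee_fin flow_ge0.
Qed.

(** Squared norm in [L^2 g] of the density of [w] on words of length [k]. *)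
Definition energy g w k : \bar R :=
  \esum_(r in [set: seq C]) (w k r ^+ 2 / g k r)%:E.

Section Bounded.
Variables (g : nat -> seq C -> R) (fg : flow g).

(** The density on a word is the average of the densities on its extensions, so
    its square is at most the average of their squares.  The domination makes [w]
    vanish where the density has denominator zero. *)
Lemma energy_nondecreasing K w : flow w ->
  (forall k r, w k r <= K * g k r) -> forall k, (energy g w k <= energy g w k.+1)%E.
Proof.
move=> fw wK k.
have sq0 j r : 0 <= w j r ^+ 2 / g j r by rewrite divr_ge0 ?sqr_ge0// flow_ge0.
rewrite /energy [leRHS]esum_seq_rcons; last by move=> s; rewrite lee_fin.
rewrite flow_nil// expr0n mul0r add0e; apply: le_esum => r _.
set A := \esum_(_ in _) _.
have A0 : (0 <= A)%E by apply: esum_ge0 => x _; rewrite lee_fin.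
have [g0|g0] := eqVneq (g k r) 0; first by rewrite g0 invr0 mulr0.
(* Cauchy-Schwarz: with [t] the density on the block [r], sum over its
   subblocks the inequality [2 t x <= x ^+ 2 / y + t ^+ 2 * y] *)
pose t := w k r / g k r.
have t0 : 0 <= t by rewrite divr_ge0// flow_ge0.
have key : ((2 * t * w k r)%:E <= A + (t ^+ 2 * g k r)%:E)%E.
  rewrite (EFinM (2 * t)) (EFinM (t ^+ 2)) -!flow_rcons//.
  have nn2t : (0 <= (2 * t)%:E)%E by rewrite lee_fin mulr_ge0.
  have nnt2 : (0 <= (t ^+ 2)%:E)%E by rewrite lee_fin sqr_ge0.
  rewrite -(esumZl nn2t); last by move=> c; rewrite lee_fin flow_ge0.
  rewrite -(esumZl nnt2); last by move=> c; rewrite lee_fin flow_ge0.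
  rewrite -esumD; last 2 first.
  - by move=> c _; rewrite lee_fin.
  - by move=> c _; rewrite -EFinM lee_fin mulr_ge0 ?sqr_ge0 ?flow_ge0.
  apply: le_esum => c _; rewrite -!EFinM -EFinD lee_fin.
  set x := w _ _; set y := g _ _.
  have y0 : 0 <= y by apply: flow_ge0.
  have [y00|yn0] := eqVneq y 0.
    have : x <= 0 by rewrite (le_trans (wK _ _))// -/y y00 mulr0.
    have : 0 <= x by apply: flow_ge0.
    move=> x0 x0'; have -> : x = 0 by apply/eqP; rewrite eq_le x0 x0'.
    by rewrite y00 expr0n mul0r !mulr0 addr0.
  have ypos : 0 < y by rewrite lt_def yn0.
  rewrite -subr_ge0.
  have -> : x ^+ 2 / y + t ^+ 2 * y - 2 * t * x = (x - t * y) ^+ 2 / y.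
    by field.
  by rewrite divr_ge0 ?sqr_ge0.
have e1 : 2 * t * w k r = 2 * (w k r ^+ 2 / g k r) by rewrite /t; ring.
have e2 : t ^+ 2 * g k r = w k r ^+ 2 / g k r by rewrite /t; field.
rewrite e1 e2 in key; move: A0 key; case: A => [a| |] //= _; rewrite ?leey//.
by rewrite -EFinD !lee_fin; lra.
Qed.

(** A density bounded by [K] has squared norm at most [K] times its integral. *)
Lemma energy_le K w M : 0 <= K -> flow w -> (forall k r, w k r <= K * g k r) ->
  (forall k, \esum_(r in [set: seq C]) (w k r)%:E <= M%:E)%E ->
  forall k, (energy g w k <= (K * M)%:E)%E.
Proof.
move=> K0 fw wK wM k.
apply: (@le_trans _ _ (K%:E * \esum_(r in [set: seq C]) (w k r)%:E)%E).
  rewrite -esumZl ?lee_fin//; last by move=> r; rewrite lee_fin flow_ge0.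
  apply: le_esum => r _; rewrite -EFinM lee_fin.
  have [g0|gn0] := eqVneq (g k r) 0.
    by rewrite g0 invr0 mulr0 mulr_ge0// flow_ge0.
  have gp : 0 < g k r by rewrite lt_def gn0 flow_ge0.
  rewrite ler_pdivrMr// expr2 mulrAC ler_wpM2r ?flow_ge0//.
by rewrite EFinM lee_wpmul2l// lee_fin.
Qed.

Lemma energy_cvg K w M : 0 <= K -> flow w -> (forall k r, w k r <= K * g k r) ->
  (forall k, \esum_(r in [set: seq C]) (w k r)%:E <= M%:E)%E ->
  exists2 j : nat -> R, energy g w = EFin \o j & cvgn j.
Proof.
move=> K0 fw wK wM.
have e0 k : (0 <= energy g w k)%E.
  by apply: esum_ge0 => r _; rewrite lee_fin divr_ge0 ?sqr_ge0// flow_ge0.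
have eM := energy_le K0 fw wK wM.
have fin k : energy g w k \is a fin_num.
  by rewrite ge0_fin_numE// (le_lt_trans (eM k))// ltry.
exists (fine \o energy g w).
  by apply/funext => k /=; rewrite fineK.
apply: nondecreasing_is_cvgn.
  by apply/nondecreasing_seqP => k; rewrite fine_le// (@energy_nondecreasing K).
exists (K * M) => _ [k _ <-] /=.
by rewrite -lee_fin fineK.
Qed.

(** The pairing of two flows is, by polarization, a combination of three
    energies, each of which is a bounded nondecreasing sequence. *)
Lemma pairing_cvg K u v : 0 <= K -> flow u -> flow v ->
  (forall k r, u k r <= K * g k r) -> (forall k r, v k r <= K * g k r) ->
  (forall k, \esum_(r in [set: seq C]) (u k r)%:E <= 1)%E ->
  (forall k, \esum_(r in [set: seq C]) (v k r)%:E <= 1)%E ->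
  exists l : R,
    \esum_(r in [set: seq C]) (u k r * v k r / g k r)%:E @[k --> \oo] --> l%:E.
Proof.
move=> K0 fu fv uK vK u1 v1.
have [ju Eu cu] := energy_cvg K0 fu uK u1.
have [jv Ev cv] := energy_cvg K0 fv vK v1.
have fuv := flowD fu fv.
have K20 : 0 <= K *+ 2 by rewrite mulrn_wge0.
have uvg k r : u k r + v k r <= K *+ 2 * g k r.
  by rewrite mulr2n mulrDl lerD.
have uv2 k : (\esum_(r in [set: seq C]) (u k r + v k r)%:E <= 2%:E)%E.
  under eq_esum do rewrite EFinD.
  rewrite esumD; try by move=> i _; rewrite lee_fin flow_ge0.
  by rewrite (_ : 2%:E = 1 + 1)%E ?leeD.
have [juv Euv cuv] := energy_cvg K20 fuv uvg uv2.
exists ((limn juv - limn ju - limn jv) / 2).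
have -> : (fun k => \esum_(r in [set: seq C]) (u k r * v k r / g k r)%:E) =
    (fun k => ((juv k - ju k - jv k) / 2)%:E).
  apply/funext => k; set P := \esum_(r in _) _.
  have P0 : (0 <= P)%E.
    by apply: esum_ge0 => r _; rewrite lee_fin divr_ge0 ?mulr_ge0// flow_ge0.
  have : (juv k)%:E = ((ju k)%:E + (2%:E * P + (jv k)%:E))%E.
    have EE w (j : nat -> R) : energy g w = EFin \o j -> (j k)%:E = energy g w k.
      by move=> ->.
    have uvg0 r : 0 <= u k r * v k r / g k r.
      by rewrite divr_ge0 ?mulr_ge0// flow_ge0.
    have sq0 w r : 0 <= w k r ^+ 2 / g k r by rewrite divr_ge0 ?sqr_ge0// flow_ge0.
    rewrite (EE _ _ Euv) (EE _ _ Eu) (EE _ _ Ev) /energy /P.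
    rewrite -esumZl ?lee_fin//.
    rewrite -!esumD.
    - by apply: eq_esum => r _; rewrite -!EFinD; congr EFin; ring.
    - by move=> r _; rewrite lee_fin.
    - by move=> r _; rewrite adde_ge0// lee_fin// mulr_ge0.
    - by move=> r _; rewrite lee_fin mulr_ge0.
    - by move=> r _; rewrite lee_fin.
  move: P0; case: P => [p| |] //= _.
    by rewrite -EFinM -!EFinD => -[E]; congr EFin; rewrite E; field.
  by rewrite mulry gtr0_sg// mul1e.
apply: cvg_EFin; first by apply: nearW.
by apply: cvgMl; apply: cvgB => //; apply: cvgB.
Qed.

End Bounded.
End Flows.

(** * Label probabilities of a Markov chain *)

Section LabelProb.
Context {R : realType}.
Local Open Scope ring_scope.

Section OneKernel.
Context {T C : countType} (P : T -> T -> R) (lab : T -> C).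

(** The probability that a chain started at [x] shows the labels [r] at its next
    [k] steps; it is zero on words of another length. *)
Fixpoint label_prob (k : nat) (r : seq C) (x : T) : R :=
  match k, r with
  | 0, [::] => 1
  | k'.+1, c :: r' => fine (\esum_(y in [set: T])
      (if lab y == c then P x y * label_prob k' r' y else 0)%:E)
  | _, _ => 0
  end.

Hypothesis Pst : stochastic P.

Let P0 x y : 0 <= P x y. Proof. by have [+ _] := Pst x; apply. Qed.

Lemma label_prob_bound k r x : 0 <= label_prob k r x <= 1.
Proof.
elim: k r x => [|k IHk] [|c r] x //=; rewrite ?lexx ?ler01//.
have ge0 y : (0 <= (if lab y == c then P x y * label_prob k r y else 0)%:E :> \bar R)%E.
  by rewrite lee_fin; case: ifP => // _; rewrite mulr_ge0//; case/andP: (IHk r y).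
have S0 := esum_ge0 (fun y (_ : [set: T] y) => ge0 y).
have S1 : (\esum_(y in [set: T])
    (if lab y == c then P x y * label_prob k r y else 0)%:E <= 1)%E.
  have [_ <-] := Pst x; apply: le_esum => y _; rewrite lee_fin.
  by case: ifP => // _; rewrite ler_piMr//; case/andP: (IHk r y).
rewrite fine_ge0//=; move: S0 S1; case: esum => // a; by rewrite !lee_fin.
Qed.

Lemma label_prob_ge0 k r x : 0 <= label_prob k r x.
Proof. by case/andP: (label_prob_bound k r x). Qed.

Lemma label_prob_le1 k r x : label_prob k r x <= 1.
Proof. by case/andP: (label_prob_bound k r x). Qed.

Lemma label_prob_cons k c r x :
  (label_prob k.+1 (c :: r) x)%:E =
  \esum_(y in [set: T]) (if lab y == c then P x y * label_prob k r y else 0)%:E.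
Proof.
rewrite /= fineK// ge0_fin_numE; last first.
  apply: esum_ge0 => y _; rewrite lee_fin; case: ifP => // _.
  by rewrite mulr_ge0// label_prob_ge0.
apply: (@le_lt_trans _ _ 1%E); last exact: ltry.
have [_ <-] := Pst x; apply: le_esum => y _; rewrite lee_fin.
by case: ifP => // _; rewrite ler_piMr// label_prob_le1.
Qed.

(** Which label comes next is a partition of the successors of [x]. *)
Lemma esum_label_prob_cons k r x :
  \esum_(c in [set: C]) (label_prob k.+1 (c :: r) x)%:E =
  \esum_(y in [set: T]) (P x y * label_prob k r y)%:E.
Proof.
under eq_esum do rewrite label_prob_cons.
rewrite esum_exchange; last first.
  move=> c y; rewrite lee_fin; case: ifP => // _.
  by rewrite mulr_ge0// label_prob_ge0.
apply: eq_esum => y _.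
rewrite (@esum_single _ _ _ (lab y)) ?eqxx// ?lee_fin ?mulr_ge0 ?label_prob_ge0//.
by move=> c; rewrite eq_sym => /negbTE ->.
Qed.

Lemma label_prob_flow x : flow (fun k r => label_prob k r x).
Proof.
split=> [k r|//|k r]; first exact: label_prob_ge0.
elim: k r x => [|k IHk] [|c r] x.
- rewrite esum_label_prob_cons/=; have [_ <-] := Pst x.
  by apply: eq_esum => y _; rewrite mulr1.
- rewrite esum1// => c' _; rewrite rcons_cons label_prob_cons esum1// => y _.
  by case: (r) => [|? ?] /=; rewrite mulr0 if_same.
- rewrite esum1//= => c _; rewrite esum1//= => y _; by rewrite mulr0 if_same.
- rewrite label_prob_cons.
  under eq_esum do rewrite rcons_cons label_prob_cons.
  rewrite esum_exchange; last first.
    move=> ? y; rewrite lee_fin; case: ifP => // _.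
    by rewrite mulr_ge0// label_prob_ge0.
  apply: eq_esum => y _; case: ifP => [_|_]; last by rewrite esum1.
  under eq_esum do rewrite EFinM.
  by rewrite esumZl ?lee_fin// ?IHk// => c'; rewrite lee_fin label_prob_ge0.
Qed.

Lemma esum_label_prob k x : \esum_(r in [set: seq C]) (label_prob k r x)%:E = 1%E.
Proof.
have l0 := label_prob_ge0.
elim: k x => [|k IHk] x.
  by rewrite (@esum_single _ _ _ [::]) ?lee_fin// => -[].
rewrite esum_seq; last by move=> s; rewrite lee_fin.
rewrite [label_prob k.+1 [::] x]/= add0e esum_exchange; last first.
  by move=> c r; rewrite lee_fin.
under eq_esum do rewrite esum_label_prob_cons.
rewrite esum_exchange; last by move=> r y; rewrite lee_fin mulr_ge0.
have [_ <-] := Pst x; apply: eq_esum => y _.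
under eq_esum do rewrite EFinM.
by rewrite esumZl ?lee_fin// ?IHk ?mule1// => c; rewrite lee_fin.
Qed.

End OneKernel.
End LabelProb.

(** * The fibre product of kernels: limits of [R^m 1] *)

Section FiberKernel.
Context {R : realType} {A B C : countType} (f : A -> C) (g : B -> C).
Local Open Scope ring_scope.
Context (PX : A -> A -> R) (PY : B -> B -> R) (PZ : C -> C -> R).
Context (piX : A -> R) (piY : B -> R) (piZ : C -> R).
Hypotheses (stX : stochastic PX) (stY : stochastic PY) (stZ : stochastic PZ).
Hypotheses (suppX : forall a, 0 < piX a) (suppY : forall b, 0 < piY b)
  (suppZ : forall c, 0 < piZ c).

Let alpha := label_prob PX f.
Let beta := label_prob PY g.
Let gamma := label_prob PZ id.

(* The label words seen ahead from [a] have a bounded density with respect to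
   those of the label chain started at [f a]. *)
Hypothesis domX : forall k r a,
  piX a * alpha k r a <= piZ (f a) * gamma k r (f a).
Hypothesis domY : forall k r b,
  piY b * beta k r b <= piZ (g b) * gamma k r (g b).

Let M := fiber_mx f g PX PY PZ.
Let PX0 x y : 0 <= PX x y. Proof. by have [+ _] := stX x; apply. Qed.
Let PY0 x y : 0 <= PY x y. Proof. by have [+ _] := stY x; apply. Qed.
Let PZ0 x y : 0 <= PZ x y. Proof. by have [+ _] := stZ x; apply. Qed.

Let alpha0 k r a : 0 <= alpha k r a. Proof. exact: label_prob_ge0. Qed.
Let beta0 k r b : 0 <= beta k r b. Proof. exact: label_prob_ge0. Qed.
Let gamma0 k r c : 0 <= gamma k r c. Proof. exact: label_prob_ge0. Qed.

Let alphaS k c r a : (alpha k.+1 (c :: r) a)%:E =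
  \esum_(a' in [set: A]) (if f a' == c then PX a a' * alpha k r a' else 0)%:E.
Proof. exact: label_prob_cons. Qed.

Let betaS k c r b : (beta k.+1 (c :: r) b)%:E =
  \esum_(b' in [set: B]) (if g b' == c then PY b b' * beta k r b' else 0)%:E.
Proof. exact: label_prob_cons. Qed.

Lemma fiber_mx_ge0 x y : 0 <= M x y.
Proof. by rewrite /M /fiber_mx; case: ifP => // _; rewrite divr_ge0 ?mulr_ge0. Qed.

(** This is [R^k 1] at [(a, b)], and the scalar product of the densities of the
    label words seen from [a] and from [b]. *)
Definition pairing k a b : \bar R :=
  \esum_(r in [set: seq C]) (alpha k r a * beta k r b / gamma k r (f a))%:E.

Lemma pairing_ge0 k a b : (0 <= pairing k a b)%E.
Proof. by apply: esum_ge0 => r _; rewrite lee_fin divr_ge0 ?mulr_ge0. Qed.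

Lemma fiber_labels (x : Delta f g) : g (Delta_snd x) = f (Delta_fst x).
Proof. by have /eqP := valP x. Qed.

Lemma esum_Delta (F : A -> B -> \bar R) : (forall a b, (0 <= F a b)%E) ->
  \esum_(x in [set: Delta f g]) F (Delta_fst x) (Delta_snd x) =
  \esum_(a in [set: A]) \esum_(b in [set: B]) (if f a == g b then F a b else 0%E).
Proof.
move=> F0; rewrite esum_pair; last by move=> a b; case: ifP.
by rewrite -(esum_subtype (fun p : A * B => f p.1 == g p.2) (fun p => F p.1 p.2)).
Qed.

Lemma gammaS k c r c0 : gamma k.+1 (c :: r) c0 = PZ c0 c * gamma k r c.
Proof.
apply: EFin_inj; rewrite /gamma label_prob_cons// (@esum_single _ _ _ c) ?eqxx//.
  by rewrite lee_fin mulr_ge0.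
by move=> y /negbTE; rewrite eq_sym => ->.
Qed.

(** The label word is read off one letter at a time: summing over the next
    states of the two coordinates separately produces the next label. *)
Lemma pairingS k (x : Delta f g) :
  pairing k.+1 (Delta_fst x) (Delta_snd x) =
  \esum_(y in [set: Delta f g])
     ((M x y)%:E * pairing k (Delta_fst y) (Delta_snd y))%E.
Proof.
set a := Delta_fst x; set b := Delta_snd x.
pose D a' b' r := PX a a' * PY b b' / PZ (f a) (f a') *
  (alpha k r a' * beta k r b' / gamma k r (f a')).
have D0 a' b' r : 0 <= D a' b' r.
  by rewrite /D mulr_ge0 ?divr_ge0 ?mulr_ge0.
transitivity (\esum_(y in [set: Delta f g]) \esum_(r in [set: seq C])
    (D (Delta_fst y) (Delta_snd y) r)%:E); last first.
  apply: eq_esum => y _; rewrite -esumZl ?lee_fin ?fiber_mx_ge0//; last first.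
    by move=> r; rewrite lee_fin divr_ge0 ?mulr_ge0.
  apply: eq_esum => r _; rewrite -EFinM /D /M /fiber_mx; congr EFin.
  case: ltP => // PZ_le0.
  have -> : PZ (f a) (f (Delta_fst y)) = 0 by apply/eqP; rewrite eq_le PZ_le0 PZ0.
  by rewrite invr0 mulr0.
rewrite (esum_Delta (F := fun a' b' => \esum_(r in [set: seq C]) (D a' b' r)%:E));
  last by move=> *; apply: esum_ge0 => r _; rewrite lee_fin.
rewrite /pairing esum_seq; last by move=> r; rewrite lee_fin divr_ge0 ?mulr_ge0.
rewrite [alpha k.+1 [::] a]/= !mul0r add0e.
transitivity (\esum_(c in [set: C]) \esum_(r in [set: seq C])
   \esum_(a' in [set: A]) \esum_(b' in [set: B])
   (if (f a' == c) && (g b' == c) then D a' b' r else 0)%:E).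
  apply: eq_esum => c _; apply: eq_esum => r _.
  set G := gamma k.+1 _ _.
  have G0 : 0 <= G^-1 by rewrite invr_ge0 gamma0.
  rewrite -mulrA EFinM alphaS -esumZr; last 2 first.
  - by rewrite lee_fin mulr_ge0// beta0.
  - by move=> a'; rewrite lee_fin; case: ifP => // _; rewrite mulr_ge0// alpha0.
  apply: eq_esum => a' _; rewrite EFinM betaS -esumZr; last 2 first.
  - by rewrite lee_fin.
  - by move=> b'; rewrite lee_fin; case: ifP => // _; rewrite mulr_ge0// beta0.
  rewrite -esumZl; last 2 first.
  - by rewrite lee_fin; case: ifP => // _; rewrite mulr_ge0// alpha0.
  - move=> b'; rewrite -EFinM lee_fin mulr_ge0//; case: ifP => // _.
    by rewrite mulr_ge0// beta0.
  apply: eq_esum => b' _; rewrite -!EFinM; congr EFin.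
  case: eqP => [fa'|]; last by rewrite mul0r.
  case: eqP => _ /=; last by rewrite mul0r mulr0.
  rewrite /D /G gammaS fa' invfM; rewrite -/(alpha _ _ _) -/(beta _ _ _).
  ring.
rewrite esum_pair; last first.
  by move=> *; do 2![apply: esum_ge0 => ? _]; rewrite lee_fin; case: ifP.
rewrite esum_exchange; last first.
  by move=> *; apply: esum_ge0 => ? _; rewrite lee_fin; case: ifP.
apply: eq_esum => a' _; rewrite esum_exchange; last first.
  by move=> *; rewrite lee_fin; case: ifP.
apply: eq_esum => b' _.
rewrite -(@esum_pair _ _ _ (fun c r => (if (f a' == c) && (g b' == c) then D a' b' r else 0)%:E));
  last by move=> *; rewrite lee_fin; case: ifP.
rewrite (@esum_single _ _ _ (f a')).
- rewrite eqxx/= eq_sym; case: ifP => // _; by rewrite esum1.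
- by apply: esum_ge0 => ? _; rewrite lee_fin; case: ifP.
- move=> c; rewrite eq_sym => /negbTE ->/=; by rewrite esum1.
Qed.

(** Both sides satisfy the same recursion in [k]. *)
Lemma mapply_mpow k x :
  mapply (mpow M k) (fun=> 1) x = pairing k (Delta_fst x) (Delta_snd x).
Proof.
elim: k x => [|k IHk] x; rewrite /mapply.
  rewrite (@esum_single _ _ _ x)/=.
  - rewrite eqxx mule1 /pairing (@esum_single _ _ _ [::])/= ?mulr1 ?invr1 ?mul1r//.
    by case=> // *; rewrite !mul0r.
  - by rewrite mule_ge0// lee_fin.
  - by move=> y; rewrite eq_sym => /negbTE ->; rewrite mul0e.
have mp0 j y z : (0 <= mpow M j y z)%E.
  elim: j y z => [|j IH] y z /=; first by rewrite lee_fin.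
  by apply: esum_ge0 => u _; rewrite mule_ge0// lee_fin fiber_mx_ge0.
rewrite pairingS /=.
under eq_esum do rewrite mule1.
rewrite esum_exchange; last by move=> *; rewrite mule_ge0// lee_fin fiber_mx_ge0.
apply: eq_esum => y _; rewrite esumZl// ?lee_fin ?fiber_mx_ge0//.
rewrite -IHk /mapply; congr (_ * _)%E; by apply: eq_esum => z _; rewrite mule1.
Qed.

Lemma pairing_le_l k a b : (pairing k a b <= (piZ (f a) / piX a)%:E)%E.
Proof.
have K0 : (0 <= (piZ (f a) / piX a)%:E)%E by rewrite lee_fin divr_ge0 ?ltW.
apply: (@le_trans _ _
  ((piZ (f a) / piX a)%:E * \esum_(r in [set: seq C]) (beta k r b)%:E)%E).
  rewrite -(esumZl K0); last by move=> r; rewrite lee_fin.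
  apply: le_esum => r _; rewrite -EFinM lee_fin.
  have [->|gn0] := eqVneq (gamma k r (f a)) 0.
    by rewrite invr0 mulr0 mulr_ge0// divr_ge0 ?ltW.
  have gp : 0 < gamma k r (f a) by rewrite lt_def gn0 gamma0.
  rewrite ler_pdivrMr// mulrAC ler_wpM2r// mulrAC ler_pdivlMr// mulrC.
  exact: domX.
by rewrite esum_label_prob// mule1.
Qed.

(** The label laws seen from [a] and from [b] are flows whose densities with
    respect to the label chain have a common bound. *)
Lemma pairing_is_cvg a b : f a = g b ->
  exists2 l : R, 0 <= l & pairing k a b @[k --> \oo] --> l%:E.
Proof.
move=> ab; pose K := piZ (f a) / piX a + piZ (g b) / piY b.
have KX : 0 <= piZ (f a) / piX a by rewrite divr_ge0 ?ltW.
have KY : 0 <= piZ (g b) / piY b by rewrite divr_ge0 ?ltW.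
have [||||||||l hl] := @pairing_cvg _ _ (fun k r => gamma k r (f a)) _ K
  (fun k r => alpha k r a) (fun k r => beta k r b).
- exact: label_prob_flow.
- exact: addr_ge0.
- exact: label_prob_flow.
- exact: label_prob_flow.
- move=> k r; rewrite mulrDl -[leLHS]addr0 lerD ?(mulr_ge0 KY (gamma0 _ _ _))//.
  by rewrite mulrAC ler_pdivlMr// mulrC domX.
- move=> k r; rewrite mulrDl -[leLHS]add0r lerD ?(mulr_ge0 KX (gamma0 _ _ _))//.
  by rewrite ab mulrAC ler_pdivlMr// mulrC domY.
- by move=> k; rewrite esum_label_prob.
- by move=> k; rewrite esum_label_prob.
exists l => //; rewrite -lee_fin -(cvg_lim _ hl)//; apply: lime_ge.
  by apply/cvg_ex; exists l%:E.
by apply: nearW => k; exact: pairing_ge0.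
Qed.

Lemma fiber_limit : exists phi : Delta f g -> R,
  [/\ forall x, 0 <= phi x &
      forall x, pairing k (Delta_fst x) (Delta_snd x) @[k --> \oo] --> (phi x)%:E].
Proof.
have H (x : Delta f g) : exists l : R, 0 <= l /\
    pairing k (Delta_fst x) (Delta_snd x) @[k --> \oo] --> l%:E.
  have [l l0 hl] := pairing_is_cvg (esym (fiber_labels x)).
  by exists l.
have [phi hphi] := choice H.
by exists phi; split=> x; have [] := hphi x.
Qed.

Let mid a b a' b' := if 0 < PZ (f a) (f a')
  then PX a a' * PY b b' / PZ (f a) (f a') else 0.

Let mid0 a b a' b' : 0 <= mid a b a' b'.
Proof. by rewrite /mid; case: ifP => // _; rewrite divr_ge0 ?mulr_ge0. Qed.

(** Forgetting the second coordinate of the next state leaves at most a multiple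
    of [PX a a'], uniformly in [k]: this is what makes the sum over next states
    commute with the limit. *)
Lemma esum_mid_pairing_le k a b a' : f a = g b ->
  (\esum_(b' in [set: B]) (if f a' == g b' then (mid a b a' b')%:E * pairing k a' b' else 0)
    <= (piZ (g b) / piY b * PX a a')%:E)%E.
Proof.
move=> ab; set K := piZ (g b) / piY b.
have K0 : 0 <= K by rewrite divr_ge0 ?ltW.
have KP0 := mulr_ge0 K0 (PX0 a a').
rewrite /mid; case: ltP => PZp; last first.
  by rewrite esum1 ?lee_fin// => b' _; rewrite mul0e if_same.
set p := PZ _ _ in PZp *.
have p0 : 0 <= p by exact: ltW.
apply: (@le_trans _ _ (\esum_(r in [set: seq C])
   (PX a a' / p * (alpha k r a' / gamma k r (f a')) * beta k.+1 (f a' :: r) b)%:E)).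
  under [leRHS]eq_esum => r _.
    rewrite EFinM betaS -esumZl; last 2 first.
    - by rewrite lee_fin mulr_ge0// divr_ge0.
    - by move=> b'; rewrite lee_fin; case: ifP => // _; rewrite mulr_ge0.
    over.
  rewrite esum_exchange; last first.
    move=> r b'; rewrite -EFinM lee_fin mulr_ge0//.
      by rewrite mulr_ge0// divr_ge0.
    by case: ifP => // _; rewrite mulr_ge0.
  apply: le_esum => b' _; rewrite eq_sym; case: ifPn => _; last first.
    by apply: esum_ge0 => r _; rewrite mule0.
  rewrite /pairing -esumZl ?lee_fin; last 2 first.
  - by rewrite divr_ge0// mulr_ge0.
  - by move=> r; rewrite lee_fin divr_ge0// mulr_ge0.
  apply: le_esum => r _; rewrite -!EFinM lee_fin le_eqVlt; apply/orP; left; apply/eqP.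
  by ring.
apply: (@le_trans _ _ (\esum_(r in [set: seq C]) ((K * PX a a')%:E * (alpha k r a')%:E))%E);
  last first.
  rewrite esumZl ?lee_fin//; last by move=> r; rewrite lee_fin.
  by rewrite esum_label_prob// mule1.
apply: le_esum => r _; rewrite -EFinM lee_fin.
have [->|gn0] := eqVneq (gamma k r (f a')) 0.
  by rewrite invr0 !(mulr0, mul0r) mulr_ge0.
have gp : 0 < gamma k r (f a') by rewrite lt_def gn0 gamma0.
have bK : beta k.+1 (f a' :: r) b <= K * (p * gamma k r (f a')).
  have := domY k.+1 (f a' :: r) b; rewrite gammaS -ab -/p => h.
  by rewrite /K -ab mulrAC ler_pdivlMr// mulrC.
apply: le_trans (ler_wpM2l _ bK) _.
  by rewrite mulr_ge0// divr_ge0.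
rewrite le_eqVlt; apply/orP; left; apply/eqP; field.
by rewrite gn0 gt_eqF.
Qed.

(** Pass to the limit in [R^(k+1) 1 = R (R^k 1)].  No single family dominates the
    sum over pairs of next states, but one dominates the sum over [b'] for each
    fixed [a'], and another the remaining sum over [a']. *)
Lemma fiber_harmonic (phi : Delta f g -> R) : (forall x, 0 <= phi x) ->
  (forall x, pairing k (Delta_fst x) (Delta_snd x) @[k --> \oo] --> (phi x)%:E) ->
  forall x, \esum_(y in [set: Delta f g]) (M x y * phi y)%:E = (phi x)%:E.
Proof.
move=> phi0 hphi x; set a := Delta_fst x; set b := Delta_snd x.
have ab : f a = g b by rewrite fiber_labels.
(* [Phi] is a limit only where the labels agree; [maxe 0] below keeps it
   nonnegative elsewhere *)
pose Phi a' b' : \bar R := limn (fun k => pairing k a' b').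
have PhiE y : Phi (Delta_fst y) (Delta_snd y) = (phi y)%:E by apply: cvg_lim (hphi y).
have hPhi a' b' : f a' = g b' -> pairing k a' b' @[k --> \oo] --> Phi a' b'.
  move=> /eqP ab'; pose y : Delta f g := exist _ (a', b') ab'.
  by rewrite (PhiE y); exact: (hphi y).
have Phi_ge0 a' b' : f a' = g b' -> (0 <= Phi a' b')%E.
  by move=> /eqP ab'; rewrite (PhiE (exist _ (a', b') ab')) lee_fin.
have lim1 : pairing k.+1 a b @[k --> \oo] --> (phi x)%:E.
  by have := hphi x; rewrite -(cvg_shiftS (fun k => pairing k a b)).
suff lim2 : pairing k.+1 a b @[k --> \oo] -->
    \esum_(y in [set: Delta f g]) (M x y * phi y)%:E.
  exact: (cvg_unique _ lim2 lim1).
have -> : \esum_(y in [set: Delta f g]) (M x y * phi y)%:E =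
    \esum_(a' in [set: A]) \esum_(b' in [set: B])
      (if f a' == g b' then (mid a b a' b')%:E * maxe 0 (Phi a' b') else 0)%E.
  rewrite -(esum_Delta (F := fun a' b' => (mid a b a' b')%:E * maxe 0 (Phi a' b')))%E.
    by apply: eq_esum => y _; rewrite EFinM PhiE max_r ?lee_fin.
  by move=> a' b'; rewrite mule_ge0 ?lee_fin// le_max lexx.
under eq_fun => k.
  rewrite pairingS (esum_Delta (F := fun a' b' => (mid a b a' b')%:E * pairing k a' b'))%E;
    last by move=> a' b'; rewrite mule_ge0 ?lee_fin// pairing_ge0.
  over.
have term0 k a' b' : (0 <= if f a' == g b' then (mid a b a' b')%:E * pairing k a' b' else 0)%E.
  by case: ifP => // _; rewrite mule_ge0 ?lee_fin// pairing_ge0.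
apply: (esum_dominated (g := fun a' => (piZ (g b) / piY b * PX a a')%:E)).
- by move=> k a'; exact: esum_ge0.
- by move=> k a'; exact: esum_mid_pairing_le.
- move=> a'; apply: (esum_dominated
    (g := fun b' => ((PX a a' / PZ (f a) (f a') * (piZ (f a') / piX a'))%:E * (PY b b')%:E)%E)).
  + by move=> k b'.
  + move=> k b'; have nn : 0 <= PX a a' / PZ (f a) (f a') * (piZ (f a') / piX a') * PY b b'.
      by rewrite !mulr_ge0// ?invr_ge0// ltW.
    case: ifP => _; last by rewrite -EFinM lee_fin.
    rewrite /mid; case: ifP => _; last by rewrite mul0e -EFinM lee_fin.
    apply: (@le_trans _ _ ((PX a a' * PY b b' / PZ (f a) (f a'))%:E * (piZ (f a') / piX a')%:E)%E).
      by rewrite lee_wpmul2l ?pairing_le_l// lee_fin divr_ge0// mulr_ge0.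
    rewrite -!EFinM lee_fin le_eqVlt; apply/orP; left; apply/eqP; ring.
  + move=> b'; case: eqP => [ab'|_]; last exact: cvg_cst.
    rewrite max_r ?Phi_ge0//; apply: cvgeZl => //; exact: hPhi.
  + rewrite esumZl; last 2 first.
    * by rewrite lee_fin !mulr_ge0// ?invr_ge0// ltW.
    * by move=> b'; rewrite lee_fin.
    by have [_ ->] := stY b; rewrite mule1 ltry.
- under eq_esum do rewrite EFinM.
  rewrite esumZl ?lee_fin ?divr_ge0 ?ltW//; last by move=> a'; rewrite lee_fin.
  by have [_ ->] := stX a; rewrite mule1 ltry.
Qed.

End FiberKernel.

(** * Words of a process *)

Section Words.

(** Finite-dimensional events are written [word ts X w = s]: the sequence [ts] of
    times may be a window [rtimes t k] of [k] times read forwards from [t], or the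
    past [ltimes t k] read backwards from [t - 1]. *)
Definition word {Om T : Type} (ts : seq int) (X : int -> Om -> T) (w : Om) : seq T :=
  [seq X t w | t <- ts].

Fixpoint rtimes (t : int) (k : nat) : seq int :=
  if k is k'.+1 then t :: rtimes (t + 1)%R k' else [::].

Fixpoint ltimes (t : int) (k : nat) : seq int :=
  if k is k'.+1 then (t - 1)%R :: ltimes (t - 1)%R k' else [::].

Lemma size_rtimes t k : size (rtimes t k) = k.
Proof. by elim: k t => //= k IHk t; rewrite IHk. Qed.

Lemma rtimes_rcons t k : rtimes t k.+1 = rcons (rtimes t k) (t + k%:Z)%R.
Proof.
elim: k t => [|k IHk] t; first by rewrite /= addr0.
rewrite -[rtimes t k.+2]/(t :: rtimes (t + 1)%R k.+1) IHk.
by rewrite -addrA -PoszD add1n.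
Qed.

Lemma size_ltimes t k : size (ltimes t k) = k.
Proof. by elim: k t => //= k IHk t; rewrite IHk. Qed.

Lemma size_word {Om T : Type} ts (X : int -> Om -> T) w : size (word ts X w) = size ts.
Proof. exact: size_map. Qed.

Lemma word_rtimesP {Om T : Type} (x0 : T) (X : int -> Om -> T) t n s w :
  size s = n -> (word (rtimes t n) X w = s <->
  forall i, (i < n)%N -> X (t + i%:Z)%R w = nth x0 s i).
Proof.
elim: n t s => [|n IHn] t [|x s] //= [sn].
split.
  move=> [<- E] [|i] i_n /=; first by rewrite addr0.
  by have [+ _] := IHn (t + 1)%R s sn; move=> /(_ E i i_n) <-; rewrite -addrA -PoszD add1n.
move=> H; congr cons; first by have := H 0%N isT; rewrite addr0.
apply/(IHn (t + 1)%R s sn) => i i_n.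
by have := H i.+1 i_n; rewrite intS addrA => ->.
Qed.

End Words.

Section WordEvents.
Context {Om : Type} {T : countType} (X : int -> Om -> T).

Section Closure.
Variables (G : set (set Om)) (sG : sigma_algebra setT G).

Lemma sigma_setI E F : G E -> G F -> G (E `&` F).
Proof.
move=> GE GF; have [_ GC GU] := sG.
rewrite -(setCK (E `&` F)) setCI -!setTD; apply: (GC _ _).
rewrite -bigcup2E; apply: GU => -[|[|n]] /=; [exact: (GC _)|exact: (GC _)|by case: sG].
Qed.

(** A countable union, reindexed by the natural numbers. *)
Lemma sigma_cover {U : countType} (E : U -> set Om) :
  (forall x, G (E x)) -> G (\bigcup_x E x).
Proof.
move=> GE; have [G0 _ GU] := sG.
rewrite (_ : \bigcup_x E x =
    \bigcup_n (if pickle_inv n is Some x then E x else set0)).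
  by apply: GU => n; case: (pickle_inv n).
apply/seteqP; split => w.
  by move=> [x _ Ex]; exists (pickle x) => //; rewrite pickleK_inv.
by move=> [n _]; case: (pickle_inv n) => // x Ex; exists x.
Qed.

Lemma sigma_word ts (Q : set (seq T)) : (forall t S, G (X t @^-1` S)) ->
  G [set w | Q (word ts X w)].
Proof.
move=> pX; have [G0 GC _] := sG; elim: ts Q => [|t ts IH] Q.
  have [q|q] := pselect (Q [::]).
    by rewrite (_ : mkset _ = setT `\` set0); [exact: (GC _ G0)|rewrite setD0; apply/seteqP; split].
  by rewrite (_ : mkset _ = set0) //; apply/seteqP; split.
rewrite (_ : mkset _ =
    \bigcup_x (X t @^-1` [set x] `&` [set w | Q (x :: word ts X w)])).
  apply: sigma_cover => x; apply: sigma_setI => //.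
  exact: (IH (fun s => Q (x :: s))).
apply/seteqP; split => w /=; first by move=> Qw; exists (X t w).
by move=> [x _ [/= <-]].
Qed.

End Closure.

Lemma sigma_process_word ts (Q : set (seq T)) :
  <<s process_events X >> [set w | Q (word ts X w)].
Proof.
apply: sigma_word; first exact: smallest_sigma_algebra.
by move=> t S; apply: sub_sigma_algebra; exists t, S.
Qed.

(** Joint values at finitely many times form a pi-system generating the events
    of a process. *)
Lemma process_lambda (H : set (set Om)) : lambda_system setT H ->
  (forall ts s, H [set w | word ts X w = s]) ->
  <<s process_events X >> `<=` H.
Proof.
move=> lH HX.
pose G := [set E | exists ts s, E = [set w | word ts X w = s]].
have sub : <<s G >> `<=` H.
  apply: lambda_system_subset => //; last by move=> _ [ts [s ->]].
  move=> _ _ [ts [s ->]] [ts' [s' ->]].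
  have [sz|sz] := eqVneq (size s) (size ts).
    exists (ts ++ ts'), (s ++ s'); apply/seteqP; split => w /=.
      by rewrite /word map_cat => -[-> ->].
    rewrite /word map_cat => /eqP; rewrite eqseq_cat ?size_map//.
    by move=> /andP[/eqP -> /eqP ->].
  exists ts, s; apply/seteqP; split => w /= => [[]//|E].
  by exfalso; move/eqP: sz; apply; rewrite -E size_word.
apply: subset_trans sub; apply: smallest_sub; first exact: smallest_sigma_algebra.
move=> _ [t [S ->]].
rewrite (_ : X t @^-1` S =
    \bigcup_x (if x \in S then [set w | word [:: t] X w = [:: x]] else set0)).
  apply: sigma_cover; first exact: smallest_sigma_algebra.
  move=> x; case: ifP => _; last exact: sigma_algebra0.
  by apply: sub_sigma_algebra; exists [:: t], [:: x].
apply/seteqP; split => w /=; first by move=> Sw; exists (X t w) => //; rewrite mem_set.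
by move=> [x _]; case: ifPn => //; rewrite inE => Sx /= [->].
Qed.

End WordEvents.

Section Measurability.
Context {d : measure_display} {Om : measurableType d}.

Lemma measurable_word {T : countType} (X : int -> Om -> T) ts (Q : set (seq T)) :
  is_process X -> measurable [set w | Q (word ts X w)].
Proof. by move=> pX; apply: sigma_word pX; exact: sigma_algebra_measurable. Qed.

Lemma measurable_path {T : Type} (X : int -> Om -> T) E :
  is_process X -> <<s @cylinders T >> E -> measurable [set w | E (X ^~ w)].
Proof.
move=> pX; pose H := [set F : set (int -> T) | measurable [set w | F (X ^~ w)]].
have sH : sigma_algebra setT H.
  split; first exact: measurable0.
    by move=> F HF; exact: (measurableD measurableT HF).
  move=> F HF; rewrite -[H _]/(measurable (\bigcup_k [set w | F k (X ^~ w)])).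
  by apply: bigcup_measurable => n _; exact: HF.
suff sub : <<s @cylinders T >> `<=` H by exact: sub.
by apply: smallest_sub => // _ [t [S ->]]; exact: pX.
Qed.

Lemma measure_esum {R : realType} {T : countType} (mu : {measure set Om -> \bar R})
    (h : Om -> T) E : measurable E -> (forall x, measurable (h @^-1` [set x])) ->
  mu E = \esum_(x in [set: T]) mu (E `&` h @^-1` [set x]).
Proof.
move=> mE mh.
pose F n := if pickle_inv n is Some x then E `&` h @^-1` [set x] else set0.
have mF n : measurable (F n).
  by rewrite /F; case: (pickle_inv n) => // x; exact: measurableI.
rewrite esum_nat -nneseries_esumT; last first.
  by move=> n; case: (pickle_inv n) => /=.
have -> : E = \bigcup_n F n.
  apply/seteqP; split => [w Ew|w [n _]].
    by exists (pickle (h w)) => //; rewrite /F pickleK_inv.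
  by rewrite /F; case: (pickle_inv n) => // x [].
rewrite measure_bigcup//.
  apply: congr_lim; apply/funext => n; apply: eq_big => // [i|i _].
    by rewrite in_setT.
  rewrite /F; case E' : (pickle_inv i) => [x|] /=; last by rewrite measure0.
  congr (mu _); apply/seteqP; split => w.
    by move=> [Ew hw]; split=> //; exists i => //; rewrite E'.
  by move=> [[n' _]]; case: (pickle_inv n') => // y [Ew _] hx.
apply/trivIsetP => i j _ _ ij; apply/seteqP; split => // w [].
rewrite /F.
have := @pickle_invK T i; have := @pickle_invK T j; rewrite /ocancel.
case: (pickle_inv i) => // x; case: (pickle_inv j) => //= y yj xi [_ hx] [_ hy].
by move/eqP: ij; apply; rewrite -xi -yj -hx -hy.
Qed.

End Measurability.

Section Laws.
Context {R : realType} {T : countType}.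

Lemma word_subset {Om Om' : Type} (X : int -> Om -> T) (X' : int -> Om' -> T) ts ts' w w' :
  {subset ts <= ts'} -> word ts' X w = word ts' X' w' -> word ts X w = word ts X' w'.
Proof. by move=> sub /eq_in_map E; apply/eq_in_map => t /sub /E. Qed.

Lemma mem_rtimes t n u : (u \in rtimes t n) = (t <= u < t + n%:Z)%R.
Proof.
elim: n t => [|n IH] t /=; first by rewrite in_nil; apply/esym/negbTE; lia.
by rewrite in_cons IH; apply/idP/idP; lia.
Qed.

Lemma rtimes_cover (ts : seq int) : exists t n, {subset ts <= rtimes t n.+1}.
Proof.
elim: ts => [|u ts [t [n sub]]]; first by exists 0%R, 0%N.
exists (t - `|u - t|%:Z)%R, (n + `|u - t| + `|u - t|)%N => v.
rewrite in_cons mem_rtimes => /predU1P[->|/sub]; first by lia.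
by rewrite mem_rtimes; lia.
Qed.

Context {d d' : measure_display} {Om : measurableType d} {Om' : measurableType d'}.
Context (Pr : probability Om R) (Pr' : probability Om' R).
Context (X : int -> Om -> T) (X' : int -> Om' -> T).
Hypotheses (pX : is_process X) (pX' : is_process X').

(** Windows of consecutive times determine a law: every finite set of times lies
    in a window, and finite-dimensional events form a pi-system. *)
Lemma eq_law_words :
  (forall t x s, Pr [set w | word (rtimes t (size s).+1) X w = x :: s] =
                 Pr' [set w | word (rtimes t (size s).+1) X' w = x :: s]) ->
  eq_law Pr X Pr' X'.
Proof.
move=> EX.
have EW t n u : Pr [set w | word (rtimes t n.+1) X w = u] =
                Pr' [set w | word (rtimes t n.+1) X' w = u].
  have [un|un] := eqVneq (size u) n.+1.
    by case: u un => // x s [<-].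
  have emp (O : Type) (V : int -> O -> T) : [set w | word (rtimes t n.+1) V w = u] = set0.
    apply/seteqP; split => // w E.
    by move/eqP: un; apply; rewrite -E size_word size_rtimes.
  by rewrite !emp !measure0.
have ET ts s : Pr [set w | word ts X w = s] = Pr' [set w | word ts X' w = s].
  have [t [n sub]] := rtimes_cover ts.
  rewrite (measure_esum Pr (h := word (rtimes t n.+1) X)); last 2 first.
  - exact: (measurable_word _ (fun u => u = s)).
  - by move=> u; exact: (measurable_word _ (fun v => v = u)).
  rewrite (measure_esum Pr' (h := word (rtimes t n.+1) X')); last 2 first.
  - exact: (measurable_word _ (fun u => u = s)).
  - by move=> u; exact: (measurable_word _ (fun v => v = u)).
  apply: eq_esum => u _.
  have [[y [yu ys]]|no] := pselect (exists y : int -> T,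
      word (rtimes t n.+1) (fun t _ => y t) tt = u /\ word ts (fun t _ => y t) tt = s).
    have inc (O : Type) (V : int -> O -> T) : [set w | word ts V w = s] `&`
        word (rtimes t n.+1) V @^-1` [set u] = [set w | word (rtimes t n.+1) V w = u].
      apply/seteqP; split => w /= => [[]//|E]; split => //.
      by rewrite -ys; apply: (word_subset sub); rewrite yu.
    by rewrite !inc; exact: EW.
  have emp (O : Type) (V : int -> O -> T) : [set w | word ts V w = s] `&`
      word (rtimes t n.+1) V @^-1` [set u] = set0.
    apply/seteqP; split => // w /= [E1 E2]; apply: no.
    by exists (V ^~ w); split; [rewrite -E2|rewrite -E1].
  by rewrite !emp !measure0.
pose H := [set E : set (int -> T) | [/\ measurable [set w | E (X ^~ w)],
  measurable [set w | E (X' ^~ w)] &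
  Pr [set w | E (X ^~ w)] = Pr' [set w | E (X' ^~ w)]]].
move=> E sE; suff [] : H E by [].
apply: (@process_lambda _ _ (fun t (x : int -> T) => x t) H _ _ E sE); last first.
  move=> ts s; split.
  - exact: (measurable_word _ (fun u => u = s)).
  - exact: (measurable_word _ (fun u => u = s)).
  - exact: ET.
split => //.
- by split => //; rewrite (_ : mkset _ = setT) ?probability_setT//.
- move=> F F' F'F [mF mF' EF] [mG mG' EG]; split.
  + exact: (measurableD mF mG).
  + exact: (measurableD mF' mG').
  + have sI : [set w | F' (X ^~ w)] `<=` [set w | F (X ^~ w)] by move=> w; exact: F'F.
    have sI' : [set w | F' (X' ^~ w)] `<=` [set w | F (X' ^~ w)] by move=> w; exact: F'F.
    rewrite -[LHS]/(Pr ([set w | F (X ^~ w)] `\` [set w | F' (X ^~ w)])).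
    rewrite -[RHS]/(Pr' ([set w | F (X' ^~ w)] `\` [set w | F' (X' ^~ w)])).
    rewrite !measureD ?fin_num_fun_lty//= ?(setIidr sI) ?(setIidr sI') ?EF ?EG//;
    by rewrite ?(le_lt_trans (probability_le1 _ _)) ?ltry.
- move=> F ndF HF; split.
  + by apply: bigcup_measurable => n _; case: (HF n).
  + by apply: bigcup_measurable => n _; case: (HF n).
  + have c1 := @nondecreasing_cvg_mu _ _ _ Pr (fun n => [set w | F n (X ^~ w)])
      (fun n => let: And3 h _ _ := HF n in h).
    have c2 := @nondecreasing_cvg_mu _ _ _ Pr' (fun n => [set w | F n (X' ^~ w)])
      (fun n => let: And3 _ h _ := HF n in h).
    have nd1 : nondecreasing_seq (fun n => [set w | F n (X ^~ w)]).
      by move=> i j ij; apply/subsetPset => w; have /subsetPset := ndF _ _ ij; apply.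
    have nd2 : nondecreasing_seq (fun n => [set w | F n (X' ^~ w)]).
      by move=> i j ij; apply/subsetPset => w; have /subsetPset := ndF _ _ ij; apply.
    have m1 : measurable (\bigcup_n [set w | F n (X ^~ w)]).
      by apply: bigcup_measurable => n _; case: (HF n).
    have m2 : measurable (\bigcup_n [set w | F n (X' ^~ w)]).
      by apply: bigcup_measurable => n _; case: (HF n).
    have {}c1 := c1 m1 nd1; have {}c2 := c2 m2 nd2.
    rewrite -[LHS]/(Pr (\bigcup_n [set w | F n (X ^~ w)])).
    rewrite -[RHS]/(Pr' (\bigcup_n [set w | F n (X' ^~ w)])).
    have EF : Pr \o (fun n => [set w | F n (X ^~ w)]) =
        Pr' \o (fun n => [set w | F n (X' ^~ w)]).
      by apply/funext => n /=; case: (HF n).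
    by rewrite EF in c1; exact: (cvg_unique _ c1 c2).
Qed.

End Laws.

Section PathWeight.
Context {R : realType} {T : countType} (P : T -> T -> R).
Local Open Scope ring_scope.

Fixpoint path_weight (x : T) (s : seq T) : R :=
  if s is y :: s' then P x y * path_weight y s' else 1.

Lemma path_weight_rcons x s y :
  path_weight x (rcons s y) = path_weight x s * P (last x s) y.
Proof. by elim: s x => /= [|z s IH] x; rewrite ?mulr1 ?mul1r// IH mulrA. Qed.

End PathWeight.

Lemma rev_mx_stochastic {R : realType} {T : countType} (p : T -> R) (P : T -> T -> R) :
  stochastic P -> invariant_distribution p P -> (forall x, (0 < p x)%R) ->
  stochastic (rev_mx p P).
Proof.
move=> sP invP supp x.
have PP y : (0 <= p y * P y x)%R.
  by have [P0 _] := sP y; rewrite mulr_ge0// ltW.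
split => [y|]; first by rewrite /rev_mx divr_ge0// ltW.
under eq_esum do rewrite /rev_mx EFinM.
rewrite esumZr ?lee_fin ?invr_ge0 ?(ltW (supp _))//.
by rewrite invP -EFinM divff// gt_eqF.
Qed.

Section ChainWords.
Context {R : realType} {d : measure_display} {Om : measurableType d} {T : countType}.
Context (Pr : probability Om R) (X : int -> Om -> T) (p : T -> R) (P : T -> T -> R).
Hypothesis chain : stationary_markov_chain Pr X p P.

Let pX : is_process X := smc_process chain.
Let stP : stochastic P := smc_stochastic chain.

(** Stationarity shifts by one step at a time, in both directions. *)
Lemma chain_marginal t x : Pr (X t @^-1` [set x]) = (p x)%:E.
Proof.
have step u : Pr (X u @^-1` [set x]) = Pr (X (u + 1)%R @^-1` [set x]).
  apply: (smc_stationary chain (E := [set y | y u = x])).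
  by apply: sub_sigma_algebra; exists u, [set x].
elim: t => [|n IHn|n IHn]; first exact: smc_distribution chain x.
- by rewrite -addn1 PoszD -step.
- by rewrite step (_ : (- n.+1%:Z + 1 = - n%:Z)%R) //; lia.
Qed.

Lemma chain_word t x s :
  Pr [set w | word (rtimes t (size s).+1) X w = x :: s] =
  (p x * path_weight P x s)%:E.
Proof.
elim/last_ind: s => [|s y IH].
  rewrite /= mulr1 -(chain_marginal t); congr (Pr _).
  by apply/seteqP; split => w /=; [case|move=> ->].
have wE u n : size u = n -> [set w | word (rtimes t n) X w = u] =
    [set w | forall i, (i < n)%N -> X (t + i%:Z)%R w = nth x u i].
  by move=> un; apply/seteqP; split => w /=; move/(word_rtimesP x X t w un).
rewrite path_weight_rcons mulrA EFinM -IH size_rcons !wE ?size_rcons//=.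
rewrite -{1}/(size (x :: s)) (last_nth x) [in RHS]/=.
have := smc_markov chain t (size s) (nth x (x :: rcons s y)).
rewrite /= nth_rcons ltnn eqxx => ->; congr (_ * (P _ _)%:E).
  congr (Pr _); apply/seteqP; split => w /= H i i_s; rewrite H//.
    by rewrite -rcons_cons nth_rcons /= i_s.
  by rewrite -rcons_cons nth_rcons /= ltnS i_s.
  by rewrite -rcons_cons nth_rcons /= ltnSn.
by rewrite size_rcons.
Qed.

Lemma chain_invariant : invariant_distribution p P.
Proof.
move=> y; rewrite -(chain_marginal 1%R).
have mX t x : measurable (X t @^-1` [set x]) by exact: pX.
rewrite (measure_esum Pr (mX 1%R y) (mX 0%R)).
apply: eq_esum => x _.
rewrite -[P x y]mulr1 -[(P x y * 1)%R]/(path_weight P x [:: y]) -(chain_word 0%R) /=.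
congr (Pr _); apply/seteqP; split => w /=; first by rewrite add0r => -[-> ->].
by rewrite add0r => -[-> ->].
Qed.

Hypothesis supp : forall x, (0 < p x)%R.

Let P0 y z : (0 <= P y z)%R. Proof. by have [+ _] := stP y; apply. Qed.
Let p0 y : (0 <= p y)%R. Proof. exact: ltW. Qed.

Lemma rev_stochastic : stochastic (rev_mx p P).
Proof. exact: rev_mx_stochastic chain_invariant supp. Qed.

Context {C : countType} (lab : T -> C).
Let lX t w := lab (X t w).

Let plX : is_process lX.
Proof. by move=> t S; exact: (pX t (lab @^-1` S)). Qed.

Lemma measurable_window ts1 ts2 ts3 l s r : measurable
  [set w | [/\ word ts1 lX w = l, word ts2 X w = s & word ts3 lX w = r]].
Proof.
rewrite (_ : mkset _ = [set w | word ts1 lX w = l] `&` ([set w | word ts2 X w = s]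
    `&` [set w | word ts3 lX w = r])).
  by do 2?apply: measurableI; exact: (measurable_word _ (fun u => u = _)).
by apply/seteqP; split => w /= [] // ? [].
Qed.

(** Given the word [x :: s] seen at times [t, .., t + size s], the labels before
    and after are independent, and the past runs along the reversed kernel. *)
Lemma chain_window t j k l x s r :
  Pr [set w | [/\ word (ltimes t j) lX w = l,
      word (rtimes t (size s).+1) X w = x :: s &
      word (rtimes (t + (size s).+1%:Z) k) lX w = r]] =
  (label_prob (rev_mx p P) lab j l x * (p x * path_weight P x s) *
   label_prob P lab k r (last x s))%:E.
Proof.
have stR := rev_stochastic.
have pw0 y u : (0 <= path_weight P y u)%R.
  by elim: u y => //= z u IH y; rewrite mulr_ge0.
elim: k s r => [|k IHk] s r.
  case: r => [|c r] /=; last first.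
    by rewrite mulr0 (_ : mkset _ = set0) ?measure0//; apply/seteqP; split => w [].
  rewrite mulr1; elim: j t x s l => [|j IHj] t x s [|c l] /=.
  - rewrite mul1r -(chain_word t); congr (Pr _).
    by apply/seteqP; split => w /=; [case|].
  - by rewrite mul0r (_ : mkset _ = set0) ?measure0//; apply/seteqP; split => w [].
  - by rewrite mul0r (_ : mkset _ = set0) ?measure0//; apply/seteqP; split => w [].
  rewrite [in RHS]EFinM -/(label_prob (rev_mx p P) lab j.+1 (c :: l) x).
  rewrite label_prob_cons// -esumZr; last 2 first.
  - by rewrite lee_fin mulr_ge0.
  - move=> y; rewrite lee_fin; case: ifP => // _.
    by rewrite mulr_ge0 ?label_prob_ge0//; have [+ _] := stR x; apply.
  rewrite (@measure_esum _ _ _ _ Pr (X (t - 1))); last 2 first.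
  - exact: (@measurable_window (ltimes t j.+1) (rtimes t (size s).+1) [::]).
  - by move=> y; exact: pX.
  apply: eq_esum => y _; case: ifPn => [/eqP yc|yc]; last first.
    rewrite mul0e (_ : _ `&` _ = set0) ?measure0//; apply/seteqP; split => // w /=.
    by move=> [[[E _] _ _] Xy]; move: yc; rewrite -Xy -E eqxx.
  have := IHj (t - 1)%R y (x :: s) l; rewrite /= subrK => E.
  transitivity (label_prob (rev_mx p P) lab j l y * (p y * (P y x * path_weight P x s)))%:E.
    rewrite -E; congr (Pr _); apply/seteqP; split => w /=.
      by move=> [[[_ ->] [-> ->] _] ->].
    move=> [-> [Xy -> ->] _]; split=> //; split=> //.
    by rewrite /lX Xy yc.
  rewrite -EFinM /rev_mx; congr EFin; field; by rewrite gt_eqF.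
case: r => [|c r] /=.
  by rewrite mulr0 (_ : mkset _ = set0) ?measure0//; apply/seteqP; split => w [].
rewrite [in RHS]EFinM -/(label_prob P lab k.+1 (c :: r) (last x s)).
rewrite label_prob_cons// -esumZl; last 2 first.
- by rewrite lee_fin !mulr_ge0 ?label_prob_ge0.
- by move=> y; rewrite lee_fin; case: ifP => // _; rewrite mulr_ge0 ?label_prob_ge0.
rewrite (@measure_esum _ _ _ _ Pr (X (t + (size s).+1%:Z))); last 2 first.
- exact: (@measurable_window (ltimes t j) (rtimes t (size s).+1) (rtimes (t + (size s).+1%:Z) k.+1)).
- by move=> y; exact: pX.
apply: eq_esum => y _; case: ifPn => [/eqP yc|yc]; last first.
  rewrite mule0 (_ : _ `&` _ = set0) ?measure0//; apply/seteqP; split => // w /=.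
  by move=> [[_ _ [E _]] Xy]; move: yc; rewrite -Xy -E eqxx.
have := IHk (rcons s y) r; rewrite last_rcons path_weight_rcons size_rcons.
rewrite -[(size s).+2]addn1 PoszD addrA => E.
transitivity (label_prob (rev_mx p P) lab j l x * (p x * (path_weight P x s * P (last x s) y)) *
    label_prob P lab k r y)%:E; last by rewrite -EFinM; congr EFin; ring.
rewrite -E; congr (Pr _).
have wE w : word (rtimes t ((size s).+1 + 1)) X w =
    rcons (word (rtimes t (size s).+1) X w) (X (t + (size s).+1%:Z) w).
  by rewrite addn1 rtimes_rcons /word map_rcons.
apply/seteqP; split => w.
  move=> [[H1 H2 [_ H3]] H4]; split=> //.
  have {}H2 : word (rtimes t (size s).+1) X w = x :: s := H2.
  by rewrite wE H2 -rcons_cons; congr rcons.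
move=> [H1 H2 H4]; move: H2; rewrite wE -rcons_cons => /rcons_inj[H2 H2' H3].
have {H2'}H2 : X t w :: word (rtimes (t + 1)%R (size s)) X w = x :: s.
  by congr cons.
by split=> //; split=> //; rewrite H4 /lX H3 yc.
Qed.

End ChainWords.

(** * Relatively independent couplings of finite windows *)

Section Lumping.
Context {R : realType} {A C : countType} {dX dZ : measure_display}.
Context {OX : measurableType dX} {OZ : measurableType dZ}.
Context (PrX : probability OX R) (PrZ : probability OZ R).
Context (X : int -> OX -> A) (Z : int -> OZ -> C).
Context (piX : A -> R) (piZ : C -> R) (PX : A -> A -> R) (PZ : C -> C -> R).
Hypothesis chainX : stationary_markov_chain PrX X piX PX.
Hypothesis chainZ : stationary_markov_chain PrZ Z piZ PZ.
Hypotheses (suppX : forall a, (0 < piX a)%R) (suppZ : forall c, (0 < piZ c)%R).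
Context (f : A -> C).
Hypothesis lawX : eq_law PrX (fun t w => f (X t w)) PrZ Z.

Definition word_mass {T : countType} (p : T -> R) (P : T -> T -> R) (x : T) (s : seq T) : R :=
  (p x * path_weight P x s)%R.

(** The mass of the word [x s] together with the labels [l] of the [j] times
    before it, read backwards, and the labels [r] of the [k] times after it. *)
Definition window_mass {T : countType} (lab : T -> C) (p : T -> R) (P : T -> T -> R)
    j k l (x : T) (s : seq T) r : R :=
  (label_prob (rev_mx p P) lab j l x * word_mass p P x s *
   label_prob P lab k r (last x s))%R.

Lemma path_weight_ge0 {T : countType} (P : T -> T -> R) x s :
  stochastic P -> (0 <= path_weight P x s)%R.
Proof.
move=> stP; elim: s x => //= z u IH y; rewrite mulr_ge0//.
by have [+ _] := stP y; apply.
Qed.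

Lemma word_mass_ge0 a s : (0 <= word_mass piX PX a s)%R.
Proof. by rewrite mulr_ge0 ?path_weight_ge0 ?(ltW (suppX _))//; case: chainX. Qed.

Lemma window_mass_ge0 j k l a s r : (0 <= window_mass f piX PX j k l a s r)%R.
Proof.
rewrite /window_mass mulr_ge0 ?label_prob_ge0//; last by case: chainX.
rewrite mulr_ge0 ?word_mass_ge0 ?label_prob_ge0//; exact: rev_stochastic chainX _.
Qed.

Lemma esum_window_mass j k a s :
  \esum_(l in [set: seq C]) \esum_(r in [set: seq C])
    (window_mass f piX PX j k l a s r)%:E = (word_mass piX PX a s)%:E.
Proof.
have stX : stochastic PX by case: chainX.
have stR := rev_stochastic chainX suppX.
transitivity (\esum_(l in [set: seq C])
   ((label_prob (rev_mx piX PX) f j l a)%:E * (word_mass piX PX a s)%:E)).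
  apply: eq_esum => l _; rewrite /window_mass.
  under eq_esum do rewrite EFinM.
  rewrite esumZl ?esum_label_prob ?mule1 ?EFinM//.
    by rewrite -EFinM lee_fin mulr_ge0 ?word_mass_ge0 ?label_prob_ge0.
  by move=> r; rewrite lee_fin label_prob_ge0.
rewrite esumZr ?esum_label_prob ?mul1e// ?lee_fin ?word_mass_ge0//.
by move=> r; rewrite lee_fin label_prob_ge0.
Qed.

Lemma esum_word_mass n :
  \esum_(a in [set: A]) \esum_(s in [set: seq A])
    (if size s == n then word_mass piX PX a s else 0)%:E = 1.
Proof.
have wm0 a s : (0 <= word_mass piX PX a s)%R by exact: word_mass_ge0.
rewrite esum_pair; last by move=> a s; rewrite lee_fin; case: ifP.
have pX : is_process X by case: chainX.
pose h w := (X 0%R w, word (rtimes 1 n) X w).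
have hE x : h @^-1` [set x] = [set w | word (rtimes 0 n.+1) X w = x.1 :: x.2].
  case: x => a s; apply/seteqP; split => w /=; rewrite /h add0r.
    by move=> [-> ->].
  by move=> [-> ->].
rewrite -(probability_setT PrX) (measure_esum PrX (h := h)) => //; last first.
  by move=> x; rewrite hE; exact: (measurable_word _ (fun u => u = _)).
apply: eq_esum => -[a s] _ /=; rewrite setTI hE /=.
case: eqP => [<-|ns]; first by rewrite -(chain_word chainX 0).
rewrite (_ : mkset _ = set0) ?measure0//; apply/seteqP; split => // w /= [_ E].
by apply: ns; rewrite -E size_word size_rtimes.
Qed.

(** Summing the window masses of the lifts of a word of [Z] gives back the
    window mass of that word, because [f(X)] has the law of [Z]. *)
Lemma lump_window j k l c u r :
  \esum_(a in [set: A]) \esum_(s in [set: seq A])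
    (if (f a == c) && (map f s == u) then window_mass f piX PX j k l a s r else 0)%:E =
  (window_mass id piZ PZ j k l c u r)%:E.
Proof.
have wm0 a s : (0 <= window_mass f piX PX j k l a s r)%R.
  exact: window_mass_ge0.
rewrite esum_pair; last by move=> a s; rewrite lee_fin; case: ifP.
have pX : is_process X by case: chainX.
rewrite /window_mass /word_mass -(chain_window chainZ suppZ id 0).
set n := size u.
pose E := [set x : int -> C | [/\ word (ltimes 0 j) (fun t x => x t) x = l,
  word (rtimes 0 n.+1) (fun t x => x t) x = c :: u &
  word (rtimes (0 + n.+1%:Z) k) (fun t x => x t) x = r]].
have mE : <<s @cylinders C >> E.
  have mw ts v := @sigma_process_word _ _ (fun t (x : int -> C) => x t) ts (fun u => u = v).
  have sI := sigma_setI (@smallest_sigma_algebra _ setT (@cylinders C)).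
  have := sI _ _ (sI _ _ (mw (ltimes 0 j) l) (mw (rtimes 0 n.+1) (c :: u)))
    (mw (rtimes (0 + n.+1%:Z)%R k) r).
  by congr (<<s _ >> _); apply/seteqP; split => x; [case=> -[]|case].
transitivity (PrZ [set w | E (Z ^~ w)]); last by [].
rewrite -(lawX mE).
pose h w := (X 0%R w, word (rtimes 1 n) X w).
have hE x : h @^-1` [set x] = [set w | word (rtimes 0 n.+1) X w = x.1 :: x.2].
  case: x => a s; apply/seteqP; split => w /=; rewrite /h add0r.
    by move=> [-> ->].
  by move=> [-> ->].
rewrite (measure_esum PrX (h := h)); last 2 first.
- apply: measurable_path mE => t S; exact: (pX t (f @^-1` S)).
- by move=> x; rewrite hE; exact: (measurable_word _ (fun u => u = _)).
apply: eq_esum => -[a s] _; rewrite hE /=.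
case: ifPn => [/andP[/eqP fa /eqP fs]|mis]; last first.
  rewrite (_ : _ `&` _ = set0) ?measure0//; apply/seteqP; split => // w.
  move=> [[_ E2 _]] E3; move/negP: mis; apply.
  have : map f (word (rtimes 0 n.+1) X w) = c :: u by rewrite -E2 /word -map_comp.
  have {}E3 : word (rtimes 0 n.+1) X w = a :: s := E3.
  by rewrite E3 => -[-> ->]; rewrite !eqxx.
have sn : size s = n by rewrite /n -fs size_map.
rewrite -[label_prob _ _ _ _ _]/(label_prob (rev_mx piX PX) f j l a).
rewrite -(chain_window chainX suppX f 0) sn; congr (PrX _).
apply/seteqP; split => w; last by move=> [[E1 _ E3] E2]; split.
move=> [E1 E2 E3]; split => //; split => //.
rewrite -[LHS]/(word (rtimes 0 n.+1) (fun t w => f (X t w)) w).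
by rewrite /word (map_comp f (X ^~ w)) -/(word _ X w) E2 /= fa fs.
Qed.

Lemma window_mass_le j k l a s r :
  (window_mass f piX PX j k l a s r <= window_mass id piZ PZ j k l (f a) (map f s) r)%R.
Proof.
rewrite -lee_fin -lump_window.
have wm0 a' s' : (0 <= window_mass f piX PX j k l a' s' r)%R.
  exact: window_mass_ge0.
rewrite esum_pair; last by move=> a' s'; rewrite lee_fin; case: ifP.
apply: (le_trans _ (@esum_term_le _ _ _ (a, s) _)).
  by rewrite /= !eqxx.
by move=> [a' s'] /=; rewrite lee_fin; case: ifP.
Qed.

(** A state is one of the lifts that [lump_window] adds up. *)
Lemma label_prob_dominated k r a : (piX a * label_prob PX f k r a <=
  piZ (f a) * label_prob PZ id k r (f a))%R.
Proof.
have := window_mass_le 0 k [::] a [::] r.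
by rewrite /window_mass /word_mass /= !mulr1 !mul1r.
Qed.

Lemma rev_label_prob_dominated j l a : (piX a * label_prob (rev_mx piX PX) f j l a <=
  piZ (f a) * label_prob (rev_mx piZ PZ) id j l (f a))%R.
Proof.
have := window_mass_le j 0 l a [::] [::].
by rewrite /window_mass /word_mass /= !mulr1 mulrC [leRHS]mulrC.
Qed.

End Lumping.

Section Coupling.
Context {R : realType} {A B C : countType}.
Context {dX dY dZ : measure_display}.
Context {OX : measurableType dX} {OY : measurableType dY} {OZ : measurableType dZ}.
Context (PrX : probability OX R) (PrY : probability OY R) (PrZ : probability OZ R).
Context (X : int -> OX -> A) (Y : int -> OY -> B) (Z : int -> OZ -> C).
Context (piX : A -> R) (piY : B -> R) (piZ : C -> R).
Context (PX : A -> A -> R) (PY : B -> B -> R) (PZ : C -> C -> R).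
Hypothesis chainX : stationary_markov_chain PrX X piX PX.
Hypothesis chainY : stationary_markov_chain PrY Y piY PY.
Hypothesis chainZ : stationary_markov_chain PrZ Z piZ PZ.
Hypotheses (suppX : forall a, (0 < piX a)%R) (suppY : forall b, (0 < piY b)%R)
  (suppZ : forall c, (0 < piZ c)%R).
Context (f : A -> C) (g : B -> C).
Hypothesis lawX : eq_law PrX (fun t w => f (X t w)) PrZ Z.
Hypothesis lawY : eq_law PrY (fun t w => g (Y t w)) PrZ Z.

Definition matching (x : A * seq A) (y : B * seq B) : bool :=
  (f x.1 == g y.1) && (map f x.2 == map g y.2).

(** The mass given to the pair of words [x], [y] by the coupling of the windows
    [[-j, n + k]] of the two chains that is conditionally independent given the
    labels in that window. *)
Definition coupling j k (x : A * seq A) (y : B * seq B) : \bar R :=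
  if matching x y then \esum_(q in [set: seq C * seq C])
    (window_mass f piX PX j k q.1 x.1 x.2 q.2 *
     window_mass g piY PY j k q.1 y.1 y.2 q.2 /
     window_mass id piZ PZ j k q.1 (f x.1) (map f x.2) q.2)%:E else 0.

Let wX0 j k l a s r : (0 <= window_mass f piX PX j k l a s r)%R.
Proof. exact: (window_mass_ge0 chainX suppX). Qed.
Let wY0 j k l a s r : (0 <= window_mass g piY PY j k l a s r)%R.
Proof. exact: (window_mass_ge0 chainY suppY). Qed.
Let wZ0 j k l a s r : (0 <= window_mass id piZ PZ j k l a s r)%R.
Proof. exact: (window_mass_ge0 chainZ suppZ). Qed.

Lemma coupling_ge0 j k x y : 0 <= coupling j k x y.
Proof.
rewrite /coupling; case: ifP => // _; apply: esum_ge0 => q _.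
by rewrite lee_fin; apply: divr_ge0 => //; exact: mulr_ge0.
Qed.

(** Summing the masses of [Y] over the words with given labels cancels the
    denominator, by [lump_window]. *)
Lemma coupling_fst j k x :
  \esum_(y in [set: B * seq B]) coupling j k x y = (word_mass piX PX x.1 x.2)%:E.
Proof.
rewrite /coupling.
transitivity (\esum_(y in [set: B * seq B]) \esum_(q in [set: seq C * seq C])
  ((window_mass f piX PX j k q.1 x.1 x.2 q.2 /
    window_mass id piZ PZ j k q.1 (f x.1) (map f x.2) q.2)%:E *
   (if matching x y then window_mass g piY PY j k q.1 y.1 y.2 q.2 else 0)%:E)).
  apply: eq_esum => y _; case: ifP => _; last first.
    by rewrite esum1// => q _; rewrite mule0.
  by apply: eq_esum => q _; rewrite -EFinM mulrAC.
rewrite esum_exchange; last first.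
  move=> y q; rewrite -EFinM lee_fin; apply: mulr_ge0; first exact: divr_ge0.
  by case: ifP.
rewrite -(esum_window_mass chainX suppX f j k) [RHS]esum_pair; last first.
  by move=> l r; rewrite lee_fin.
apply: eq_esum => -[l r] _ /=.
rewrite esumZl; last 2 first.
- by rewrite lee_fin; exact: divr_ge0.
- by move=> y; rewrite lee_fin; case: ifP.
have -> : \esum_(y in [set: B * seq B])
    (if matching x y then window_mass g piY PY j k l y.1 y.2 r else 0)%:E =
    (window_mass id piZ PZ j k l (f x.1) (map f x.2) r)%:E.
  rewrite -(lump_window chainY chainZ suppY suppZ lawY) esum_pair; last first.
    by move=> b v; rewrite lee_fin; case: ifP.
  apply: eq_esum => -[b v] _; rewrite /matching /=.
  by rewrite (eq_sym (f _)) (eq_sym (map f _)).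
rewrite -EFinM; congr EFin.
have := window_mass_le chainX chainZ suppX suppZ lawX j k l x.1 x.2 r.
set z := window_mass id _ _ _ _ _ _ _ _; have [-> le0|zn0 _] := eqVneq z 0%R.
  by rewrite mulr0; apply/eqP; rewrite eq_le le0 wX0.
by rewrite divfK.
Qed.

Let stX : stochastic PX. Proof. by case: chainX. Qed.
Let stY : stochastic PY. Proof. by case: chainY. Qed.
Let stZ : stochastic PZ. Proof. by case: chainZ. Qed.
Let srX := rev_stochastic chainX suppX.
Let srY := rev_stochastic chainY suppY.
Let srZ := rev_stochastic chainZ suppZ.

Local Notation wmX := (word_mass piX PX).
Local Notation wmY := (word_mass piY PY).
Local Notation wmZ := (word_mass piZ PZ).
Local Notation fwd := (pairing f g PX PY PZ).
Local Notation bwd := (pairing f g (rev_mx piX PX) (rev_mx piY PY) (rev_mx piZ PZ)).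

Lemma coupling_split j k x y : matching x y ->
  coupling j k x y =
  (wmX x.1 x.2 * wmY y.1 y.2 / wmZ (f x.1) (map f x.2))%:E *
    (bwd j x.1 y.1 * fwd k (last x.1 x.2) (last y.1 y.2)).
Proof.
move=> xy; rewrite /coupling xy.
have wm0 : (0 <= wmX x.1 x.2 * wmY y.1 y.2 / wmZ (f x.1) (map f x.2))%R.
  apply: divr_ge0; first apply: mulr_ge0.
  - exact: (word_mass_ge0 chainX suppX).
  - exact: (word_mass_ge0 chainY suppY).
  - exact: (word_mass_ge0 chainZ suppZ).
have b0 l : (0 <= label_prob (rev_mx piX PX) f j l x.1 *
    label_prob (rev_mx piY PY) g j l y.1 / label_prob (rev_mx piZ PZ) id j l (f x.1))%R.
  by rewrite divr_ge0 ?mulr_ge0 ?label_prob_ge0.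
have f0 r : (0 <= label_prob PX f k r (last x.1 x.2) *
    label_prob PY g k r (last y.1 y.2) / label_prob PZ id k r (f (last x.1 x.2)))%R.
  by rewrite divr_ge0 ?mulr_ge0 ?label_prob_ge0.
rewrite {1}/pairing -esumZr; last 2 first.
- exact: pairing_ge0.
- by move=> l; rewrite lee_fin.
rewrite -esumZl ?lee_fin//; last first.
  by move=> l; rewrite mule_ge0 ?lee_fin ?pairing_ge0.
rewrite -(esum_pair (F := fun l r => (window_mass f piX PX j k l x.1 x.2 r *
     window_mass g piY PY j k l y.1 y.2 r /
     window_mass id piZ PZ j k l (f x.1) (map f x.2) r)%:E)); last first.
  by move=> l r; rewrite lee_fin; apply: divr_ge0 => //; exact: mulr_ge0.
apply: eq_esum => l _; rewrite /pairing -esumZl ?lee_fin//.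
rewrite -esumZl ?lee_fin//; last by move=> r; rewrite -EFinM lee_fin mulr_ge0.
apply: eq_esum => r _; rewrite -!EFinM; congr EFin.
rewrite /window_mass (last_map f) !invfM; ring.
Qed.

Lemma coupling_nomatch j k x y : ~~ matching x y -> coupling j k x y = 0.
Proof. by rewrite /coupling => /negbTE ->. Qed.

End Coupling.

Section CouplingLimit.
Context {R : realType} {A B C : countType}.
Context {dX dY dZ : measure_display}.
Context {OX : measurableType dX} {OY : measurableType dY} {OZ : measurableType dZ}.
Context (PrX : probability OX R) (PrY : probability OY R) (PrZ : probability OZ R).
Context (X : int -> OX -> A) (Y : int -> OY -> B) (Z : int -> OZ -> C).
Context (piX : A -> R) (piY : B -> R) (piZ : C -> R).
Context (PX : A -> A -> R) (PY : B -> B -> R) (PZ : C -> C -> R).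
Hypothesis chainX : stationary_markov_chain PrX X piX PX.
Hypothesis chainY : stationary_markov_chain PrY Y piY PY.
Hypothesis chainZ : stationary_markov_chain PrZ Z piZ PZ.
Hypotheses (suppX : forall a, (0 < piX a)%R) (suppY : forall b, (0 < piY b)%R)
  (suppZ : forall c, (0 < piZ c)%R).
Context (f : A -> C) (g : B -> C).
Hypothesis lawX : eq_law PrX (fun t w => f (X t w)) PrZ Z.
Hypothesis lawY : eq_law PrY (fun t w => g (Y t w)) PrZ Z.

Local Notation wmX := (word_mass piX PX).
Local Notation wmY := (word_mass piY PY).
Local Notation wmZ := (word_mass piZ PZ).
Local Notation fwd := (pairing f g PX PY PZ).
Local Notation bwd := (pairing f g (rev_mx piX PX) (rev_mx piY PY) (rev_mx piZ PZ)).
Local Notation cpl := (coupling piX piY piZ PX PY PZ f g).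

Lemma coupling_snd j k y :
  \esum_(x in [set: A * seq A]) cpl j k x y = (wmY y.1 y.2)%:E.
Proof.
rewrite -(coupling_fst chainY chainX chainZ suppY suppX suppZ lawY lawX j k y).
apply: eq_esum => x _; rewrite /coupling /matching eq_sym (eq_sym (map f _)).
case: ifP => // /andP[/eqP <- /eqP <-]; apply: eq_esum => q _.
by rewrite (mulrC (window_mass f _ _ _ _ _ _ _ _)).
Qed.

(** The size test makes the bound summable: among words of all lengths, each
    length has total mass one. *)
Lemma coupling_le_snd j k x y :
  cpl j k x y <= (if size y.2 == size x.2 then wmY y.1 y.2 else 0)%:E.
Proof.
case: ifPn => [_|sz]; last first.
  rewrite coupling_nomatch//; apply: contra sz => /andP[_ /eqP E].
  by rewrite -(size_map g) -E size_map.
rewrite -(coupling_snd j k); apply: (le_trans _ (@esum_term_le _ _ _ x _)) => //.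
by move=> x'; exact: (coupling_ge0 chainX chainY chainZ suppX suppY suppZ).
Qed.

Lemma coupling_le_fst j k x y :
  cpl j k x y <= (if size x.2 == size y.2 then wmX x.1 x.2 else 0)%:E.
Proof.
case: ifPn => [_|sz]; last first.
  rewrite coupling_nomatch//; apply: contra sz => /andP[_ /eqP E].
  by rewrite -(size_map f) E size_map.
rewrite -(coupling_fst chainX chainY chainZ suppX suppY suppZ lawX lawY j k).
apply: (le_trans _ (@esum_term_le _ _ _ y _)) => //.
by move=> y'; exact: (coupling_ge0 chainX chainY chainZ suppX suppY suppZ).
Qed.

Variables (phi phirev : Delta f g -> R).
Hypothesis hphi : forall x, fwd k (Delta_fst x) (Delta_snd x) @[k --> \oo] --> (phi x)%:E.
Hypothesis hphirev : forall x, bwd k (Delta_fst x) (Delta_snd x) @[k --> \oo] --> (phirev x)%:E.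

(** Extension by zero of a function on [Delta]: the words of a pair need not
    match. *)
Definition extend (u : Delta f g -> R) (a : A) (b : B) : R :=
  oapp u 0%R (insub (a, b)).

Lemma extendE u (x : Delta f g) : extend u (Delta_fst x) (Delta_snd x) = u x.
Proof.
rewrite /extend; case: insubP => [z zP zE|/negP[]]; last by case: x => -[].
rewrite /= (_ : z = x)//; apply: val_inj; rewrite /= zE.
by rewrite /Delta_fst /Delta_snd -surjective_pairing.
Qed.

(** The limit of the couplings, and the law of the words of the chain on
    [Delta'']. *)
Definition joint_mass (x : A * seq A) (y : B * seq B) : R :=
  if matching f g x y then
    (wmX x.1 x.2 * wmY y.1 y.2 / wmZ (f x.1) (map f x.2) *
      (extend phirev x.1 y.1 * extend phi (last x.1 x.2) (last y.1 y.2)))%R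
  else 0%R.

Lemma coupling_cvg x y : cpl k k x y @[k --> \oo] --> (joint_mass x y)%:E.
Proof.
rewrite /joint_mass; case: ifPn => xy; last first.
  by under eq_fun do rewrite coupling_nomatch//; exact: cvg_cst.
under eq_fun do rewrite (coupling_split chainX chainY chainZ)//.
rewrite EFinM; apply: cvgeZl => //; rewrite EFinM; apply: cvgeM => //.
- have /andP[xy1 _] := xy.
  by have := @hphirev (exist _ (x.1, y.1) xy1 : Delta f g); rewrite -extendE.
- have ll : f (last x.1 x.2) == g (last y.1 y.2).
    by have /andP[/eqP h1 /eqP h2] := xy; rewrite -last_map h1 h2 last_map.
  have := @hphi (exist _ (last x.1 x.2, last y.1 y.2) ll : Delta f g).
  by rewrite -extendE.
Qed.

(** No mass escapes in the limit, since each coupling is dominated by its other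
    marginal. *)
Lemma esum_joint_mass x :
  \esum_(y in [set: B * seq B]) (joint_mass x y)%:E = (wmX x.1 x.2)%:E.
Proof.
have : \esum_(y in [set: B * seq B]) cpl k k x y @[k --> \oo] -->
    \esum_(y in [set: B * seq B]) (joint_mass x y)%:E.
  apply: (esum_dominated (g := fun y : B * seq B =>
     (if size y.2 == size x.2 then wmY y.1 y.2 else 0)%:E)).
  - by move=> k y; exact: (coupling_ge0 chainX chainY chainZ suppX suppY suppZ).
  - by move=> k y; exact: coupling_le_snd.
  - by move=> y; exact: coupling_cvg.
  - rewrite -(esum_pair (F := fun b v => (if size v == size x.2 then wmY b v else 0)%:E)).
      by rewrite (esum_word_mass chainY)// ltry.
    move=> b v; rewrite lee_fin; case: ifP => // _.
    exact: (word_mass_ge0 chainY suppY).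
under eq_fun do rewrite (coupling_fst chainX chainY chainZ)//.
by move=> /cvg_lim <-//; rewrite lim_cst.
Qed.

Lemma esum_joint_mass_snd y :
  \esum_(x in [set: A * seq A]) (joint_mass x y)%:E = (wmY y.1 y.2)%:E.
Proof.
have : \esum_(x in [set: A * seq A]) cpl k k x y @[k --> \oo] -->
    \esum_(x in [set: A * seq A]) (joint_mass x y)%:E.
  apply: (esum_dominated (g := fun x : A * seq A =>
     (if size x.2 == size y.2 then wmX x.1 x.2 else 0)%:E)).
  - by move=> k x; exact: (coupling_ge0 chainX chainY chainZ suppX suppY suppZ).
  - by move=> k x; exact: coupling_le_fst.
  - by move=> x; exact: coupling_cvg.
  - rewrite -(esum_pair (F := fun a s => (if size s == size y.2 then wmX a s else 0)%:E)).
      by rewrite (esum_word_mass chainX)// ltry.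
    move=> a s; rewrite lee_fin; case: ifP => // _.
    exact: (word_mass_ge0 chainX suppX).
under eq_fun do rewrite coupling_snd//.
by move=> /cvg_lim <-//; rewrite lim_cst.
Qed.

End CouplingLimit.

Lemma eq_law_comp {R : realType} {d d' : measure_display} {Om : measurableType d}
    {Om' : measurableType d'} {T U : Type} (Pr : probability Om R) (X : int -> Om -> T)
    (Pr' : probability Om' R) (X' : int -> Om' -> T) (h : T -> U) :
  eq_law Pr X Pr' X' ->
  eq_law Pr (fun t w => h (X t w)) Pr' (fun t w => h (X' t w)).
Proof.
move=> EX E sE; apply: (EX [set x | E (fun t => h (x t))]).
pose H := [set F : set (int -> U) | <<s @cylinders T >> [set x | F (fun t => h (x t))]].
suff sub : <<s @cylinders U >> `<=` H by exact: sub.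
have [s0 sC sU] := @smallest_sigma_algebra _ setT (@cylinders T).
apply: smallest_sub.
  by split => [|F HF|F HF]; [exact: s0|exact: (sC _ HF)|exact: (sU _ HF)].
by move=> _ [t [S ->]]; apply: sub_sigma_algebra; exists t, (h @^-1` S).
Qed.

(** Only the law of the process matters in [chain_window]. *)
Lemma eq_law_window {R : realType} {T C : countType} {d d' : measure_display}
    {Om : measurableType d} {Om' : measurableType d'}
    (Pr : probability Om R) (X : int -> Om -> T) (Pr' : probability Om' R)
    (X' : int -> Om' -> T) (p : T -> R) (P : T -> T -> R) (lab : T -> C) :
  eq_law Pr X Pr' X' -> stationary_markov_chain Pr' X' p P -> (forall x, (0 < p x)%R) ->
  forall t j k l x s r,
  Pr [set w | [/\ word (ltimes t j) (fun t w => lab (X t w)) w = l,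
      word (rtimes t (size s).+1) X w = x :: s &
      word (rtimes (t + (size s).+1%:Z) k) (fun t w => lab (X t w)) w = r]] =
  (window_mass lab p P j k l x s r)%:E.
Proof.
move=> EX chain supp t j k l x s r.
rewrite /window_mass -(chain_window chain supp lab t).
apply: (EX [set y | [/\ word (ltimes t j) (fun t y => lab (y t)) y = l,
  word (rtimes t (size s).+1) (fun t y => y t) y = x :: s &
  word (rtimes (t + (size s).+1%:Z)%R k) (fun t y => lab (y t)) y = r]]).
have mw ts Q := @sigma_process_word _ _ (fun t (y : int -> T) => y t) ts Q.
have sI := sigma_setI (@smallest_sigma_algebra _ setT (@cylinders T)).
have := sI _ _ (mw (ltimes t j) (fun u => map lab u = l))
  (sI _ _ (mw (rtimes t (size s).+1) (fun u => u = x :: s))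
     (mw (rtimes (t + (size s).+1%:Z)%R k) (fun u => map lab u = r))).
congr (<<s _ >> _); apply/seteqP; split => y; rewrite /setI /mkset /word -!map_comp.
  by move=> [? []].
by move=> [].
Qed.

(** * Averages over a refining sequence of countable partitions *)

Lemma integral_fibers {R : realType} {d : measure_display} {T : measurableType d}
    {D : countType} (mu : {measure set T -> \bar R}) (E : set T) (kappa : T -> D)
    (h : T -> \bar R) :
  measurable E -> (forall c, measurable (kappa @^-1` [set c])) ->
  measurable_fun E h -> (forall x, 0 <= h x) ->
  \int[mu]_(x in E) h x =
  \esum_(c in [set: D]) \int[mu]_(x in E `&` kappa @^-1` [set c]) h x.
Proof.
move=> mE mk mh h0.
pose F n := if pickle_inv n is Some c then E `&` kappa @^-1` [set c] else set0.
have mF n : measurable (F n).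
  by rewrite /F; case: (pickle_inv n) => // c; exact: measurableI.
have EF : E = \bigcup_n F n.
  apply/seteqP; split => [x Ex|x [n _]].
    by exists (pickle (kappa x)) => //; rewrite /F pickleK_inv.
  by rewrite /F; case: (pickle_inv n) => // c [].
have tF : trivIset setT F.
  apply/trivIsetP => i j _ _ ij; apply/seteqP; split => // w [].
  rewrite /F; have := @pickle_invK D i; have := @pickle_invK D j; rewrite /ocancel.
  case: (pickle_inv i) => // x; case: (pickle_inv j) => //= y yj xi [_ hx] [_ hy].
  by move/eqP: ij; apply; rewrite -xi -yj -hx -hy.
rewrite [X in \int[mu]_(x in X) _]EF ge0_integral_bigcup//; last by rewrite -EF.
rewrite esum_nat -nneseries_esumT; last first.
  by move=> n; case: (pickle_inv n) => //= c; exact: integral_ge0.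
apply: congr_lim; apply/funext => n; apply: eq_big => // i _.
by rewrite /F; case: (pickle_inv i) => //=; rewrite integral_set0.
Qed.

Section BlockAverages.
Context {R : realType} {d : measure_display} {T : measurableType d} {D : countType}.
Context (P : probability T R) (m : {finite_measure set T -> \bar R}).
Hypothesis mP : forall V, measurable V -> m V <= P V.
Context (kappa : nat -> T -> D).
Local Notation block k c := (kappa k @^-1` [set c]).
Hypothesis mkappa : forall k c, measurable (block k c).
Hypothesis refine : forall k x y, kappa k.+1 x = kappa k.+1 y -> kappa k x = kappa k y.
Hypothesis generating : forall V : set T, measurable V ->
  <<s [set E | exists k c, E = block k c] >> V.

Definition ratio k c : R := (fine (m (block k c)) / fine (P (block k c)))%R.

Lemma ratio_ge0 k c : (0 <= ratio k c)%R.
Proof. by rewrite divr_ge0// fine_ge0. Qed.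

Let Pfin V : measurable V -> P V \is a fin_num.
Proof. exact: fin_num_measure. Qed.

Let mfin V : measurable V -> m V \is a fin_num.
Proof. exact: fin_num_measure. Qed.

Lemma ratioP k c : (ratio k c)%:E * P (block k c) = m (block k c).
Proof.
have := mP (mkappa k c); rewrite /ratio.
rewrite -(fineK (Pfin (mkappa k c))) -(fineK (mfin (mkappa k c))) lee_fin /= => le.
have [P0|Pn0] := eqVneq (fine (P (block k c))) 0%R; last by rewrite -EFinM divfK.
by rewrite P0 mule0; congr EFin; apply/eqP; rewrite eq_le fine_ge0//= -P0.
Qed.

Lemma ratio_le1 k c : (ratio k c <= 1)%R.
Proof.
have [P0|Pn0] := eqVneq (fine (P (block k c))) 0%R.
  by rewrite /ratio P0 invr0 mulr0.
rewrite ler_pdivrMr ?mul1r.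
  by apply: fine_le; [exact: mfin|exact: Pfin|exact: mP].
by rewrite lt_def Pn0 fine_ge0.
Qed.

Lemma refine_le j k x y : (j <= k)%N -> kappa k x = kappa k y -> kappa j x = kappa j y.
Proof.
move=> jk; rewrite -(subnK jk); elim: (k - j)%N => [//|n IH] /=.
by rewrite addSn => /refine.
Qed.

Lemma block_subset j k c c' : (j <= k)%N ->
  block j c `&` block k c' = block k c' \/ block j c `&` block k c' = set0.
Proof.
move=> jk; have [[x [xc xc']]|no] := pselect (exists x, (block j c `&` block k c') x).
  left; apply/seteqP; split => [y []//|y yc']; split => //=.
  by rewrite -xc; apply: refine_le jk _; rewrite xc'.
by right; apply/seteqP; split => // x h; apply: no; exists x.
Qed.

(** The integral against [P] of [h] times the conditional expectation, given the
    [k]-th partition, of the density of [m] with respect to [P]. *)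
Definition average k (h : T -> \bar R) : \bar R :=
  \esum_(c in [set: D]) ((ratio k c)%:E * \int[P]_(x in block k c) h x).

Definition average_set k V : \bar R :=
  \esum_(c in [set: D]) ((ratio k c)%:E * P (V `&` block k c)).

Lemma average_set_term_ge0 k V c : 0 <= (ratio k c)%:E * P (V `&` block k c).
Proof. by rewrite mule_ge0// lee_fin ratio_ge0. Qed.

Lemma average_set_ge0 k V : 0 <= average_set k V.
Proof. by apply: esum_ge0 => c _; exact: average_set_term_ge0. Qed.

Lemma average_set_le k V : measurable V -> average_set k V <= P V.
Proof.
move=> mV; rewrite (measure_esum P mV (mkappa k)); apply: le_esum => c _.
by rewrite -[leRHS]mul1e lee_wpmul2r// lee_fin ratio_le1.
Qed.

Lemma average_setT k : average_set k setT = m setT.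
Proof.
rewrite (measure_esum m measurableT (mkappa k)); apply: eq_esum => c _.
by rewrite setTI ratioP.
Qed.

Lemma average_set_bigcup k (F : (set T)^nat) : (forall n, measurable (F n)) ->
  trivIset setT F ->
  average_set k (\bigcup_n F n) = \esum_(n in [set: nat]) average_set k (F n).
Proof.
move=> mF tF; rewrite /average_set esum_exchange; last first.
  by move=> n c; exact: average_set_term_ge0.
apply: eq_esum => c _; rewrite esumZl ?lee_fin ?ratio_ge0//; congr (_ * _).
rewrite setI_bigcupl measure_bigcup//; last 2 first.
- by move=> n _; exact: measurableI.
- apply/trivIsetP => i j _ _ ij; rewrite setIACA.
  by move/trivIsetP : tF => /(_ i j Logic.I Logic.I ij) ->; rewrite set0I.
rewrite -nneseries_esumT//; apply: congr_lim; apply/funext => n.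
by apply: eq_big => // i; rewrite in_setT.
Qed.

Lemma average_setC k V : measurable V ->
  average_set k V + average_set k (~` V) = m setT.
Proof.
move=> mV; rewrite -(average_setT k) /average_set -esumD.
- apply: eq_esum => c _; rewrite -ge0_muleDr//; congr (_ * _).
  rewrite setTI [RHS](measureDI P (mkappa k c) mV) addeC setDE.
  by rewrite (setIC (block k c)) (setIC (block k c)).
- by move=> c _; exact: average_set_term_ge0.
- by move=> c _; exact: average_set_term_ge0.
Qed.

(** The averages are eventually constant on blocks, and the domination [m <= P]
    lets the limit pass to complements and countable disjoint unions.  This takes
    the place of the martingale convergence theorem. *)
Lemma average_set_cvg V : measurable V -> average_set k V @[k --> \oo] --> m V.
Proof.
pose H := [set E | measurable E /\ average_set k E @[k --> \oo] --> m E].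
move=> mV; suff [] : H V by [].
pose G := [set E | E = set0 \/ exists k c, E = block k c].
have mG : G `<=` measurable by move=> _ [->|[k [c ->]]].
suff sub : <<s G >> `<=` H.
  apply: sub; have := generating mV; apply: sub_smallest2r => //.
  by move=> E [k [c ->]]; right; exists k, c.
apply: lambda_system_subset => //.
- have sym j c k c' : (j <= k)%N -> G (block j c `&` block k c').
    by move=> /block_subset => /(_ c c')[] ->; [right; exists k, c'|left].
  move=> _ _ [->|[j [c ->]]] [->|[k [c' ->]]]; rewrite ?set0I ?setI0; try by left.
  have [|/ltnW] := leqP j k; [exact: sym|rewrite setIC; exact: sym].
- apply/dynkin_lambda_system; split.
  + split => //; under eq_fun do rewrite average_setT; exact: cvg_cst.
  + move=> E [mE cE]; split; first exact: measurableC.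
    have fS k F : measurable F -> average_set k F \is a fin_num.
      move=> mF; rewrite ge0_fin_numE ?average_set_ge0//.
      by rewrite (le_lt_trans (average_set_le k mF))// ltey_eq Pfin.
    have -> : m (~` E) = m setT - m E.
      rewrite -setTD measureD//; last by rewrite ltey_eq mfin.
      by rewrite setTI.
    have -> : (fun k => average_set k (~` E)) = (fun k => m setT - average_set k E).
      apply/funext => k; rewrite -(average_setC k mE) addeAC subee ?add0e//.
      exact: fS.
    by apply: cvgeB => //; [rewrite fin_num_adde_defr// mfin|exact: cvg_cst].
  + move=> F tF HF; have mF n : measurable (F n) by case: (HF n).
    split; first exact: bigcup_measurable.
    under eq_fun do rewrite average_set_bigcup//.
    have -> : m (\bigcup_n F n) = \esum_(n in [set: nat]) m (F n).
      rewrite measure_bigcup// -nneseries_esumT//; apply: congr_lim.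
      by apply/funext => n; apply: eq_big => // i; rewrite in_setT.
    apply: (esum_dominated (g := fun n => P (F n))).
    * by move=> k n; exact: average_set_ge0.
    * by move=> k n; exact: average_set_le.
    * by move=> n; case: (HF n).
    * rewrite -nneseries_esumT//.
      have -> : \sum_(n <oo) P (F n) = P (\bigcup_n F n).
        rewrite measure_bigcup//; apply: congr_lim.
        by apply/funext => n; apply: eq_big => // i; rewrite in_setT.
      by rewrite ltey_eq Pfin//; exact: bigcup_measurable.
- move=> E [->|[j [c ->]]].
    split => //; rewrite measure0.
    under eq_fun do rewrite /average_set.
    have -> : (fun k => average_set k set0) = cst 0.
      by apply/funext => k; apply: esum1 => c _; rewrite set0I measure0 mule0.
    exact: cvg_cst.
  split; first exact: mkappa.
  apply: cvg_near_cst; exists j => // k /= jk.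
  rewrite (measure_esum m (mkappa j c) (mkappa k)); apply: eq_esum => c' _.
  have [->|->] := block_subset c c' jk; first by rewrite ratioP.
  by rewrite !measure0 mule0.
Qed.

Import HBNNSimple.

Lemma integral_nnsfun_sum (mu : {measure set T -> \bar R}) E (h : {nnsfun T >-> R}) :
  measurable E -> \int[mu]_(x in E) (h x)%:E =
  \sum_(y \in range h) (y%:E * mu (h @^-1` [set y] `&` E)).
Proof.
move=> mE; under eq_integral do rewrite fimfunE -fsumEFin//.
have indich r : measurable_fun E (fun x => (r * \1_(h @^-1` [set r]) x)%:E).
  by apply: (measurable_comp measurableT) => //; exact: measurable_funM.
rewrite ge0_integral_fsum//; last by move=> y x Ex; exact: nnfun_muleindic_ge0.
apply: eq_fsbigr => r rhn.
by under eq_integral do rewrite EFinM; rewrite integralZl_indic_nnsfun// integral_indic.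
Qed.

Lemma average_le k (h : T -> \bar R) : measurable_fun [set: T] h ->
  (forall x, 0 <= h x) -> average k h <= \int[P]_x h x.
Proof.
move=> mh h0; rewrite (integral_fibers P measurableT (mkappa k))//.
apply: le_esum => c _; rewrite setTI.
rewrite -[leRHS]mul1e lee_wpmul2r// ?lee_fin ?ratio_le1//.
exact: integral_ge0.
Qed.

Lemma averageD k (h1 h2 : T -> \bar R) :
  measurable_fun [set: T] h1 -> (forall x, 0 <= h1 x) ->
  measurable_fun [set: T] h2 -> (forall x, 0 <= h2 x) ->
  average k (fun x => h1 x + h2 x) = average k h1 + average k h2.
Proof.
move=> m1 h10 m2 h20.
have t0 (h : T -> \bar R) c : (forall x, 0 <= h x) ->
    0 <= (ratio k c)%:E * \int[P]_(x in block k c) h x.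
  by move=> h0; rewrite mule_ge0 ?lee_fin ?ratio_ge0// integral_ge0.
rewrite /average -esumD; [|by move=> c _; exact: t0|by move=> c _; exact: t0].
apply: eq_esum => c _; rewrite ge0_integralD//; [|exact: measurable_funS m1|exact: measurable_funS m2].
by rewrite ge0_muleDr// integral_ge0.
Qed.

Lemma average_nnsfun_cvg (h : {nnsfun T >-> R}) :
  average k (fun x => (h x)%:E) @[k --> \oo] --> \int[m]_x (h x)%:E.
Proof.
(* the values [y] of [h] are nonnegative, but the summation index is any real
   number: writing their absolute value makes all the terms nonnegative *)
have E (mu : {measure set T -> \bar R}) V : measurable V ->
    \int[mu]_(x in V) (h x)%:E =
    \sum_(y <- finmap.enum_fset (fset_set (range h))) (`|y|%:E * mu (h @^-1` [set y] `&` V)).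
  move=> mV; rewrite integral_nnsfun_sum// fsbig_finite//=.
  rewrite big_seq [RHS]big_seq; apply: eq_bigr => y.
  by rewrite in_fset_set// inE => -[x _ <-]; rewrite ger0_norm.
rewrite E//; under eq_bigr do rewrite setIT.
have -> : (fun k => average k (fun x => (h x)%:E)) =
   (fun k => \sum_(y <- finmap.enum_fset (fset_set (range h))) (`|y|%:E * average_set k (h @^-1` [set y]))).
  apply/funext => k; rewrite /average.
  under eq_esum => c _.
    rewrite (E P)// ge0_sume_distrr; last by move=> y _; rewrite mule_ge0.
    over.
  rewrite esum_sum; last by move=> c y _ _; rewrite !mule_ge0 ?lee_fin ?ratio_ge0.
  apply: eq_bigr => y _; rewrite /average_set -esumZl ?lee_fin//; last first.
    by move=> c; exact: average_set_term_ge0.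
  by apply: eq_esum => c _; rewrite muleCA.
apply: cvg_nnesum => y _.
  by apply: nearW => k; rewrite mule_ge0// average_set_ge0.
by apply: cvgeZl => //; apply: average_set_cvg.
Qed.

(** Interchange of limits: [b n] approximates [a] up to [e n], uniformly in [k]. *)
Lemma squeeze_approx (a : nat -> R) (b : nat -> nat -> R) (J e : nat -> R) (j : R) :
  (forall n k, (b n k <= a k <= b n k + e n)%R) -> e n @[n --> \oo] --> 0%R ->
  (forall n, b n k @[k --> \oo] --> J n) -> J n @[n --> \oo] --> j ->
  a k @[k --> \oo] --> j.
Proof.
move=> ab e0 bJ Jj; apply/cvgrPdist_lt => eps eps0.
have eps3 : (0 < eps / 3)%R by rewrite divr_gt0.
have /cvgrPdist_lt /(_ _ eps3) [N1 _ HN1] := e0.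
have /cvgrPdist_lt /(_ _ eps3) [N2 _ HN2] := Jj.
pose n := maxn N1 N2.
have {}HN1 := HN1 n (leq_maxl _ _); have {}HN2 := HN2 n (leq_maxr _ _).
have /cvgrPdist_lt /(_ _ eps3) [K _ HK] := bJ n.
exists K => // k /HK /= {}HK; rewrite /= in HN1 HN2.
have /andP[l1 l2] := ab n k.
move: HN1 HN2 HK; rewrite sub0r normrN !ltr_norml => /andP[? ?] /andP[? ?] /andP[? ?].
by apply/andP; split; lra.
Qed.

(** Approximation of [h] from below by simple functions; the error is at most the
    error of their integrals against [P], whatever [k] is. *)
Lemma average_cvg (h : T -> R) : measurable_fun [set: T] h -> (forall x, (0 <= h x)%R) ->
  \int[P]_x (h x)%:E < +oo ->
  average k (fun x => (h x)%:E) @[k --> \oo] --> \int[m]_x (h x)%:E.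
Proof.
move=> mh h0 hoo.
have mEh : measurable_fun [set: T] (EFin \o h) by exact/measurable_EFinP.
pose s := nnsfun_approx measurableT mEh.
have sh n x : (s n x <= h x)%R.
  by rewrite -lee_fin /s nnsfun_approxE; apply: (@le_approx _ _ _ setT (EFin \o h)) => //= y _; rewrite lee_fin.
have scv x : EFin (s n x) @[n --> \oo] --> (h x)%:E.
  by apply: (@cvg_nnsfun_approx _ _ _ _ measurableT _ mEh) => // y _; rewrite /= lee_fin.
have ms n : measurable_fun [set: T] (EFin \o s n) by exact/measurable_EFinP.
have mono (mu : {measure set T -> \bar R}) :
    \int[mu]_x (s n x)%:E @[n --> \oo] --> \int[mu]_x (h x)%:E.
  have -> : \int[mu]_x (h x)%:E = \int[mu]_x limn (fun n => (s n x)%:E).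
    by apply: eq_integral => x _; rewrite (cvg_lim _ (scv x)).
  apply: (@cvg_monotone_convergence _ _ _ mu setT measurableT (fun n x => (s n x)%:E)) => //.
    by move=> n x _; rewrite lee_fin.
  by move=> x _ i j ij; rewrite lee_fin; exact/lefP/nd_nnsfun_approx.
have Pint n : \int[P]_x (s n x)%:E <= \int[P]_x (h x)%:E.
  apply: ge0_le_integral => //; try exact: (ms n); try exact: mEh;
  by move=> x _; rewrite lee_fin.
have i0 (mu : {measure set T -> \bar R}) (u : T -> R) :
    (forall x, (0 <= u x)%R) -> 0 <= \int[mu]_x (u x)%:E.
  by move=> u0; apply: integral_ge0 => x _; rewrite lee_fin.
have Pfs n : \int[P]_x (s n x)%:E \is a fin_num.
  by rewrite ge0_fin_numE ?i0// (le_lt_trans (Pint n)).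
have Pfh : \int[P]_x (h x)%:E \is a fin_num by rewrite ge0_fin_numE ?i0.
have av0 k (u : T -> R) : (forall x, (0 <= u x)%R) -> 0 <= average k (fun x => (u x)%:E).
  move=> u0; apply: esum_ge0 => c _; rewrite mule_ge0 ?lee_fin ?ratio_ge0//.
  by apply: integral_ge0 => x _; rewrite lee_fin.
have avle k (u : T -> R) : measurable_fun [set: T] (EFin \o u) -> (forall x, (0 <= u x)%R) ->
    average k (fun x => (u x)%:E) <= \int[P]_x (u x)%:E.
  by move=> mu u0; apply: average_le => // x; rewrite lee_fin.
have avfs k n : average k (fun x => (s n x)%:E) \is a fin_num.
  rewrite ge0_fin_numE ?av0//; apply: (@le_lt_trans _ _ (\int[P]_x (s n x)%:E)).
    exact: avle.
  by rewrite ltey_eq Pfs.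
have avfh k : average k (fun x => (h x)%:E) \is a fin_num.
  rewrite ge0_fin_numE ?av0//; apply: (@le_lt_trans _ _ (\int[P]_x (h x)%:E)) => //.
  exact: avle.
have mle n : \int[m]_x (s n x)%:E <= \int[P]_x (h x)%:E.
  rewrite -(cvg_lim _ (@average_nnsfun_cvg (s n)))//; apply: lime_le.
    by apply/cvg_ex; eexists; exact: (@average_nnsfun_cvg (s n)).
  by apply: nearW => k; apply: le_trans (Pint n); exact: avle.
have mfs n : \int[m]_x (s n x)%:E \is a fin_num.
  by rewrite ge0_fin_numE ?i0// (le_lt_trans (mle n)).
have mfh : \int[m]_x (h x)%:E \is a fin_num.
  rewrite ge0_fin_numE ?i0//; apply: le_lt_trans hoo.
  rewrite -(cvg_lim _ (@mono m))//; apply: lime_le.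
    by apply/cvg_ex; eexists; exact: (@mono m).
  by apply: nearW => n; exact: mle.
have decomp k n : average k (fun x => (h x)%:E) =
    average k (fun x => (s n x)%:E) + average k (fun x => (h x - s n x)%:E).
  rewrite -averageD//.
  - by congr average; apply/funext => x; rewrite -EFinD addrC subrK.
  - exact: (ms n).
  - by move=> x; rewrite lee_fin.
  - by apply/measurable_EFinP; exact: measurable_funB.
  - by move=> x; rewrite lee_fin subr_ge0.
rewrite -(fineK mfh).
have -> : (fun k => average k (fun x => (h x)%:E)) =
    EFin \o (fun k => fine (average k (fun x => (h x)%:E))).
  by apply/funext => k /=; rewrite fineK.
apply: cvg_EFin; first by apply: nearW.
apply: (@squeeze_approx _ (fun n k => fine (average k (fun x => (s n x)%:E)))
  (fun n => fine (\int[m]_x (s n x)%:E))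
  (fun n => fine (\int[P]_x (h x)%:E) - fine (\int[P]_x (s n x)%:E))%R).
- move=> n k.
  have le1 : average k (fun x => (h x - s n x)%:E) <=
      \int[P]_x (h x)%:E - \int[P]_x (s n x)%:E.
    rewrite -integralB//=.
    + apply: avle; last by move=> x; rewrite subr_ge0.
      by apply/measurable_EFinP; exact: measurable_funB.
    + apply/integrableP; split => //; under eq_integral => x _ do rewrite gee0_abs ?lee_fin//.
      exact: hoo.
    + apply/integrableP; split; first exact: (ms n).
      under eq_integral => x _ do rewrite gee0_abs ?lee_fin//.
      by rewrite ltey_eq Pfs.
  have ge1 : 0 <= average k (fun x => (h x - s n x)%:E).
    by apply: av0 => x; rewrite subr_ge0.
  have f1 : average k (fun x => (h x - s n x)%:E) \is a fin_num.
    by rewrite ge0_fin_numE// (le_lt_trans le1)// ltey_eq fin_numB Pfh Pfs.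
  apply/andP; split; rewrite /= -lee_fin ?EFinD ?EFinN !fineK//.
    by rewrite (decomp k n) leeDl.
  by rewrite (decomp k n) leeD2l.
- rewrite -(subrr (fine (\int[P]_x (h x)%:E))); apply: cvgB; first exact: cvg_cst.
  by apply: fine_cvg; rewrite fineK//; exact: mono.
- by move=> n; apply: fine_cvg; rewrite fineK//; exact: average_nnsfun_cvg.
- by apply: fine_cvg; rewrite fineK//; exact: mono.
Qed.

End BlockAverages.

(** * Conditional probabilities given a sub-sigma-algebra *)

Import HBNNSimple.

Section Traces.
Context {R : realType} {d : measure_display} {Om : measurableType d}.
Context (Pr : probability Om R) (G : set (set Om)).

(** The measures [V |-> Pr (V `&` E)] and [Pr] on the sigma-algebra generated by
    [G].  The assumptions are arguments because the measure structures declared on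
    these functions depend on them. *)
Definition trace (E : set Om) (GM : G `<=` measurable) (mE : measurable E)
  (V : set (g_sigma_algebraType G)) : \bar R := Pr (V `&` E).

Definition trace_prob (GM : G `<=` measurable)
  (V : set (g_sigma_algebraType G)) : \bar R := Pr V.

Lemma sub_measurable (GM : G `<=` measurable) : <<s G >> `<=` measurable.
Proof. by apply: smallest_sub => //; exact: sigma_algebra_measurable. Qed.

Section TraceMeasure.
Variables (E : set Om) (GM : G `<=` measurable) (mE : measurable E).

Let tr0 : trace GM mE set0 = 0.
Proof. by rewrite /trace set0I measure0. Qed.

Let tr_ge0 V : 0 <= trace GM mE V.
Proof. exact: measure_ge0. Qed.

Let tr_additive : semi_sigma_additive (trace GM mE).
Proof.
move=> F mF tF mUF; rewrite /trace setI_bigcupl.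
have mF' n : @measurable d Om (F n) := sub_measurable GM (mF n).
apply: measure_semi_sigma_additive.
- by move=> n; exact: measurableI.
- apply/trivIsetP => i j _ _ ij; rewrite setIACA.
  by move/trivIsetP : tF => /(_ i j Logic.I Logic.I ij) ->; rewrite set0I.
- by apply: bigcup_measurable => n _; exact: measurableI.
Qed.

HB.instance Definition _ := isMeasure.Build _ _ _ (trace GM mE) tr0 tr_ge0 tr_additive.

Let tr_fin : fin_num_fun (trace GM mE).
Proof.
by move=> V mV; apply: fin_num_measure; apply: measurableI => //; exact: (sub_measurable GM mV).
Qed.

HB.instance Definition _ := Measure_isFinite.Build _ _ _ (trace GM mE) tr_fin.

End TraceMeasure.

Section TraceProb.
Variable GM : G `<=` measurable.

Let tr0 : trace_prob GM set0 = 0.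
Proof. by rewrite /trace_prob measure0. Qed.

Let tr_ge0 V : 0 <= trace_prob GM V.
Proof. exact: measure_ge0. Qed.

Let tr_additive : semi_sigma_additive (trace_prob GM).
Proof.
move=> F mF tF mUF; apply: measure_semi_sigma_additive => //.
- by move=> n; exact: (sub_measurable GM (mF n)).
- exact: (sub_measurable GM mUF).
Qed.

HB.instance Definition _ := isMeasure.Build _ _ _ (trace_prob GM) tr0 tr_ge0 tr_additive.

Let tr_setT : trace_prob GM setT = 1.
Proof. exact: probability_setT. Qed.

HB.instance Definition _ := Measure_isProbability.Build _ _ _ (trace_prob GM) tr_setT.

End TraceProb.

Variable GM : G `<=` measurable.
Local Notation OmG := (g_sigma_algebraType G).

Lemma measurable_fun_sub {d'} {U : measurableType d'} D (h : OmG -> U) :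
  measurable_fun [set: OmG] h -> measurable D -> measurable_fun D (h : Om -> U).
Proof.
move=> mh mD _ B mB; apply: measurableI => //.
by apply: (sub_measurable GM); rewrite -[X in <<s G >> X]setTI; exact: mh.
Qed.

Lemma integral_restr (mu : {measure set Om -> \bar R}) E (mE : measurable E) (h : Om -> \bar R) :
  measurable_fun [set: Om] h -> (forall x, 0 <= h x) ->
  \int[mrestr mu mE]_x h x = \int[mu]_(x in E) h x.
Proof.
move=> mh h0; pose s := nnsfun_approx measurableT mh.
have lim (nu : {measure set Om -> \bar R}) V : measurable V ->
    \int[nu]_(x in V) (s n x)%:E @[n --> \oo] --> \int[nu]_(x in V) h x.
  move=> mV.
  have -> : \int[nu]_(x in V) h x = \int[nu]_(x in V) limn (fun n => (s n x)%:E).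
    by apply: eq_integral => x _; apply/esym/cvg_lim => //; exact: cvg_nnsfun_approx.
  apply: (@cvg_monotone_convergence _ _ _ nu V mV (fun n x => (s n x)%:E)) => //.
    by move=> n; apply/measurable_EFinP; exact: measurable_funTS.
    by move=> n x _; rewrite lee_fin.
  by move=> x _ i j ij; rewrite lee_fin; exact/lefP/nd_nnsfun_approx.
have := lim (mrestr mu mE) setT measurableT.
under eq_fun => n.
  rewrite (integral_nnsfun_sum (mrestr mu mE))//.
  under eq_fsbigr do rewrite setIT.
  rewrite -(integral_nnsfun_sum mu (s n) mE).
  over.
by move=> l1; exact: (cvg_unique _ l1 (@lim mu E mE)).
Qed.

Lemma integral_trace E (mE : measurable E) V (h : OmG -> \bar R) : measurable V ->
  measurable_fun [set: OmG] h -> (forall x, 0 <= h x) ->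
  \int[trace GM mE]_(x in V) h x = \int[Pr]_(x in V `&` E) h x.
Proof.
move=> mV mh h0.
have mid : measurable_fun [set: Om] (id : Om -> OmG).
  by move=> _ B mB; rewrite setTI; exact: (sub_measurable GM mB).
have mhO : measurable_fun [set: Om] (h : Om -> \bar R).
  exact: measurable_fun_sub mh _.
have mVO : @measurable d Om V := sub_measurable GM mV.
transitivity (\int[mrestr Pr mE]_(x in V) (h : Om -> \bar R) x).
  have := @ge0_integral_pushforward _ _ _ _ R _ mid (mrestr Pr mE) V h mV
    (measurable_funTS mh).
  by move=> <- // x _; exact: h0.
rewrite integral_mkcond integral_restr//.
- rewrite [RHS]integral_mkcond [LHS]integral_mkcond; apply: eq_integral => x _.
  by rewrite !patchE in_setI; case: (x \in V); case: (x \in E).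
- by apply/(measurable_restrictT _ mVO); exact: measurable_funTS.
- by move=> x; rewrite patchE; case: ifP.
Qed.

Lemma integral_trace_prob V (h : OmG -> \bar R) : measurable V ->
  measurable_fun [set: OmG] h -> (forall x, 0 <= h x) ->
  \int[trace_prob GM]_(x in V) h x = \int[Pr]_(x in V) h x.
Proof.
move=> mV mh h0; rewrite -{2}[V]setIT.
rewrite -(@integral_trace setT measurableT)//; apply: eq_measure_integral => A mA _.
by rewrite /= /trace setIT.
Qed.

Lemma trace_le E (mE : measurable E) V : measurable V -> trace GM mE V <= trace_prob GM V.
Proof.
move=> mV; have mVO : @measurable d Om V := sub_measurable GM mV.
by rewrite /trace /trace_prob le_measure// inE//; exact: measurableI.
Qed.

Lemma trace_dominated E (mE : measurable E) : trace GM mE `<< trace_prob GM.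
Proof.
apply/null_content_dominatesP => A mA A0.
apply/eqP; rewrite eq_le measure_ge0 andbT.
by have := trace_le mE mA; rewrite (A0 : trace_prob GM A = 0).
Qed.

(** A version of [Pr (E | G)]: the density of one measure with respect to the
    other. *)
Definition cond_density E (mE : measurable E) (w : Om) : R :=
  fine (Radon_Nikodym_SigmaFinite.f (trace GM mE) (trace_prob GM) w).

Section Density.
Variables (E : set Om) (mE : measurable E).
Local Notation q := (cond_density mE).

Lemma cond_densityE (w : OmG) :
  (q w)%:E = Radon_Nikodym_SigmaFinite.f (trace GM mE) (trace_prob GM) w.
Proof.
by rewrite fineK//; apply: Radon_Nikodym_SigmaFinite.f_fin_num; exact: trace_dominated.
Qed.

Lemma cond_density_ge0 w : (0 <= q w)%R.
Proof.
by rewrite fine_ge0//; apply: Radon_Nikodym_SigmaFinite.f_ge0; exact: trace_dominated.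
Qed.

Lemma measurable_cond_density : measurable_fun [set: OmG] (q : OmG -> R).
Proof.
apply/measurable_EFinP.
rewrite (_ : _ \o _ = Radon_Nikodym_SigmaFinite.f (trace GM mE) (trace_prob GM)).
  apply: measurable_int (Radon_Nikodym_SigmaFinite.f_integrable _).
  exact: trace_dominated.
by apply/funext => w /=; rewrite cond_densityE.
Qed.

Lemma integral_cond_density V : <<s G >> V -> \int[Pr]_(w in V) (q w)%:E = Pr (V `&` E).
Proof.
move=> mV; rewrite -integral_trace_prob//.
- under eq_integral do rewrite cond_densityE.
  rewrite -Radon_Nikodym_SigmaFinite.f_integral//; exact: trace_dominated.
- by apply/measurable_EFinP; exact: measurable_cond_density.
- by move=> w; rewrite lee_fin cond_density_ge0.
Qed.

Lemma is_cond_prob_density : is_cond_prob Pr G E q.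
Proof.
split; first exact: measurable_cond_density.
- apply/integrableP; split.
    apply/measurable_EFinP; apply: measurable_fun_sub => //.
    exact: measurable_cond_density.
  under eq_integral do rewrite /= ger0_norm ?cond_density_ge0//.
  rewrite integral_cond_density; last exact: (@measurableT _ OmG).
  by rewrite setTI ltey_eq fin_num_measure.
- by move=> V mV; rewrite integral_cond_density// setIC.
Qed.

End Density.

(** The density of the trace of [E] may replace integration over [E], because
    the other factor is measurable for the sub-sigma-algebra. *)
Lemma integral_cond_densityM E F (mE : measurable E) (mF : measurable F) V : <<s G >> V ->
  \int[Pr]_(w in V) (cond_density mE w * cond_density mF w)%:E =
  \int[Pr]_(w in V `&` E) (cond_density mF w)%:E.
Proof.
move=> mV; have m1 := measurable_cond_density mE; have m2 := measurable_cond_density mF.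
rewrite -integral_trace//; last 2 first.
- by apply/measurable_EFinP.
- by move=> w; rewrite lee_fin cond_density_ge0.
rewrite -integral_trace_prob//; last 2 first.
- by apply/measurable_EFinP; exact: measurable_funM.
- by move=> w; rewrite lee_fin mulr_ge0// cond_density_ge0.
rewrite -(Radon_Nikodym_SigmaFinite.change_of_variables (trace_dominated mE))//.
- by apply: eq_integral => w _; rewrite -cond_densityE mulrC EFinM.
- by move=> w; rewrite lee_fin cond_density_ge0.
- by apply: measurable_funTS; apply/measurable_EFinP.
Qed.

(** Averaging over finer and finer partitions that generate [G] converges to
    conditioning on [G]. *)
Lemma partition_cvg {D : countType} (kappa : nat -> Om -> D) E F
    (mE : measurable E) (mF : measurable F) :
  (forall k c, <<s G >> (kappa k @^-1` [set c])) ->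
  (forall k x y, kappa k.+1 x = kappa k.+1 y -> kappa k x = kappa k y) ->
  G `<=` <<s [set V | exists k c, V = kappa k @^-1` [set c]] >> ->
  \esum_(c in [set: D]) (fine (Pr (kappa k @^-1` [set c] `&` E)) *
     fine (Pr (kappa k @^-1` [set c] `&` F)) / fine (Pr (kappa k @^-1` [set c])))%:E
    @[k --> \oo] --> \int[Pr]_(w in E) (cond_density mF w)%:E.
Proof.
move=> mk ref gen.
have := @average_cvg R _ OmG D (trace_prob GM) (trace GM mE) (trace_le mE)
  kappa mk ref _ (cond_density mF) (measurable_cond_density mF).
have gen' (V : set OmG) : measurable V ->
    <<s [set V | exists k c, V = kappa k @^-1` [set c]] >> V.
  suff sub : <<s G >> `<=` <<s [set V | exists k c, V = kappa k @^-1` [set c]] >>.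
    exact: sub.
  by apply: smallest_sub => //; exact: smallest_sigma_algebra.
move=> /(_ gen' (cond_density_ge0 mF)).
have -> : \int[trace_prob GM]_x (cond_density mF x)%:E = Pr F.
  rewrite integral_trace_prob//.
  - by rewrite integral_cond_density ?setTI//; exact: (@measurableT _ OmG).
  - by apply/measurable_EFinP; exact: measurable_cond_density.
  - by move=> w; rewrite lee_fin cond_density_ge0.
rewrite ltey_eq fin_num_measure// => /(_ isT).
rewrite integral_trace//; last 2 first.
- by apply/measurable_EFinP; exact: measurable_cond_density.
- by move=> w; rewrite lee_fin cond_density_ge0.
rewrite setTI; set L := \int[_]_(_ in _) _.
suff -> : (fun k => \esum_(c in [set: D]) (fine (Pr (kappa k @^-1` [set c] `&` E)) *
     fine (Pr (kappa k @^-1` [set c] `&` F)) / fine (Pr (kappa k @^-1` [set c])))%:E) =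
  (fun k => average (trace_prob GM) (trace GM mE) kappa k
    (fun x : OmG => (cond_density mF x)%:E)) by [].
apply/funext => k; apply: eq_esum => c _; rewrite integral_trace_prob//.
- rewrite integral_cond_density// /ratio /trace /trace_prob.
  rewrite -[Pr (_ `&` F)]fineK ?fin_num_measure//.
    by rewrite -EFinM mulrAC.
  by apply: measurableI => //; exact: (sub_measurable GM (mk k c)).
- exact: mk.
- by apply/measurable_EFinP; exact: measurable_cond_density.
- by move=> w; rewrite lee_fin cond_density_ge0.
Qed.

(** The words at times [ts] are determined by those at a larger set of times. *)
Lemma cond_density_words {T : countType} (X : int -> Om -> T) F (mF : measurable F)
    ts' ts : is_process X -> {subset ts <= ts'} ->
  (forall u, \int[Pr]_(w in [set w | word ts' X w = u]) (cond_density mF w)%:E =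
     Pr ([set w | word ts' X w = u] `&` F)) ->
  forall s, \int[Pr]_(w in [set w | word ts X w = s]) (cond_density mF w)%:E =
     Pr ([set w | word ts X w = s] `&` F).
Proof.
move=> pX sub Hu s; have mw ts0 v : measurable [set w | word ts0 X w = v].
  exact: (measurable_word _ (fun u => u = v)).
rewrite (integral_fibers Pr (kappa := word ts' X))//; last 3 first.
- by move=> c; exact: mw.
- apply/measurable_EFinP; apply: measurable_fun_sub => //.
  exact: measurable_cond_density.
- by move=> w; rewrite lee_fin cond_density_ge0.
rewrite [RHS](measure_esum Pr (h := word ts' X)); last 2 first.
- by apply: measurableI => //; exact: mw.
- by move=> c; exact: mw.
apply: eq_esum => u _.
have [[w0 [w0u w0s]]|no] := pselect (exists w, word ts' X w = u /\ word ts X w = s).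
  have E : [set w | word ts X w = s] `&` word ts' X @^-1` [set u] =
      [set w | word ts' X w = u].
    apply/seteqP; split => w; first by case.
    move=> wu; split => //; rewrite /mkset -w0s; apply: (word_subset sub).
    by rewrite w0u.
  by rewrite E (Hu u) setIAC E.
have E : [set w | word ts X w = s] `&` word ts' X @^-1` [set u] = set0.
  by apply/seteqP; split => // w [E1 E2]; apply: no; exists w.
by rewrite setIAC E integral_set0 set0I measure0.
Qed.

(** If conditioning on [G] decouples [F] from the finite-dimensional events of a
    process, it decouples it from all its events. *)
Lemma decoupled_process {T : countType} (X : int -> Om -> T) F (mF : measurable F) :
  is_process X ->
  (forall ts s, \int[Pr]_(w in [set w | word ts X w = s]) (cond_density mF w)%:E =
     Pr ([set w | word ts X w = s] `&` F)) ->
  forall E, <<s process_events X >> E ->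
    \int[Pr]_(w in E) (cond_density mF w)%:E = Pr (E `&` F).
Proof.
move=> pX HX.
pose H := [set E | measurable E /\
  \int[Pr]_(w in E) (cond_density mF w)%:E = Pr (E `&` F)].
have mq D : measurable D -> measurable_fun D (fun w => (cond_density mF w)%:E).
  move=> mD; apply/measurable_EFinP; apply: measurable_fun_sub => //.
  exact: measurable_cond_density.
have q0 w : 0 <= (cond_density mF w)%:E by rewrite lee_fin cond_density_ge0.
have IT : \int[Pr]_w (cond_density mF w)%:E = Pr F.
  by rewrite integral_cond_density ?setTI//; exact: (@measurableT _ OmG).
have Pfin E : measurable E -> Pr E \is a fin_num by move=> mE; exact: fin_num_measure.
move=> E sE; suff [] : H E by [].
apply: (process_lambda (X := X) (H := H) _ _ sE); last first.
  by move=> ts s; split; [exact: (measurable_word _ (fun u => u = s))|exact: HX].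
apply/dynkin_lambda_system; split.
- by split => //; rewrite IT setTI.
- move=> V [mV IV]; split; first exact: measurableC.
  have : \int[Pr]_(w in V `|` ~` V) (cond_density mF w)%:E =
      \int[Pr]_(w in V) (cond_density mF w)%:E + \int[Pr]_(w in ~` V) (cond_density mF w)%:E.
    apply: ge0_integral_setU => //; first exact: measurableC.
    - by apply: mq; apply: measurableU => //; exact: measurableC.
    - by rewrite disj_set2E setICr.
  rewrite setUv IT IV (measureDI Pr mF mV) setDE (setIC F V) (setIC F (~` V)) addeC.
  move=> /(congr1 (fun z => z - Pr (V `&` F))).
  rewrite addeK; last by apply: Pfin; exact: measurableI.
  by rewrite addeK; [move=> ->|apply: Pfin; exact: measurableI].
- move=> V tV HV; have mV n : measurable (V n) by case: (HV n).
  split; first exact: bigcup_measurable.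
  rewrite ge0_integral_bigcup//; last first.
    by apply: mq; exact: bigcup_measurable.
  rewrite setI_bigcupl measure_bigcup//; last 2 first.
  + by move=> n _; exact: measurableI.
  + apply/trivIsetP => i j _ _ ij; rewrite setIACA.
    by move/trivIsetP : tV => /(_ i j Logic.I Logic.I ij) ->; rewrite set0I.
  apply: congr_lim; apply/funext => n; apply: eq_big => // i; first by rewrite in_setT.
  by case: (HV i).
Qed.

End Traces.

Section Frames.
Context {Om : Type} {T : countType} (Z : int -> Om -> T) (t : int) (n : nat).

Lemma mem_ltimes u k v : (v \in ltimes u k) = (u - k%:Z <= v < u)%R.
Proof.
elim: k u => [|k IH] u /=; first by rewrite in_nil; apply/esym/negbTE; lia.
by rewrite in_cons IH; apply/idP/idP; lia.
Qed.

(** What is seen in the window of [n + 1] times from [t] and in its neighbourhoods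
    of size [k] on both sides.  Its fibres form finer and finer partitions that
    generate all the events of the process. *)
Definition frame k w : seq T * (seq T * seq T) :=
  (word (rtimes t n.+1) Z w,
   (word (ltimes t k) Z w, word (rtimes (t + n.+1%:Z)%R k) Z w)).

Lemma frame_event k c : <<s process_events Z >> (frame k @^-1` [set c]).
Proof.
case: c => u [l r].
rewrite (_ : _ @^-1` _ = [set w | word (rtimes t n.+1) Z w = u] `&`
    ([set w | word (ltimes t k) Z w = l] `&`
     [set w | word (rtimes (t + n.+1%:Z)%R k) Z w = r])).
  have sI := sigma_setI (@smallest_sigma_algebra _ setT (process_events Z)).
  have mw ts v : <<s process_events Z >> [set w | word ts Z w = v].
    exact: (sigma_process_word ts (fun u => u = v)).
  by apply: (sI) => //; apply: (sI).
apply/seteqP; split => w /=; first by move=> [-> -> ->].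
by move=> [E1 [E2 E3]]; rewrite /frame -E1 -E2 -E3.
Qed.

Lemma frame_value k w w' u : (t - k%:Z <= u < t + n.+1%:Z + k%:Z)%R ->
  frame k w = frame k w' -> Z u w = Z u w'.
Proof.
move=> uk [E1 E2 E3 E4].
have E1' : word (rtimes t n.+1) Z w = word (rtimes t n.+1) Z w' by congr cons.
suff : word [:: u] Z w = word [:: u] Z w' by case.
have [ut|ut] := boolP (u < t)%R.
  by apply: (word_subset _ E3) => v; rewrite inE => /eqP ->; rewrite mem_ltimes; lia.
have [un|un] := boolP (u < t + n.+1%:Z)%R.
  by apply: (word_subset _ E1') => v; rewrite inE => /eqP ->; rewrite mem_rtimes; lia.
by apply: (word_subset _ E4) => v; rewrite inE => /eqP ->; rewrite mem_rtimes; lia.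
Qed.

Lemma frame_refine k w w' : frame k.+1 w = frame k.+1 w' -> frame k w = frame k w'.
Proof.
move=> E; have V u h := @frame_value k.+1 w w' u h E.
rewrite /frame /word; congr (_, (_, _)); apply/eq_in_map => u;
  rewrite ?mem_rtimes ?mem_ltimes => h; apply: V; lia.
Qed.

Lemma frame_generate :
  process_events Z `<=` <<s [set V | exists k c, V = frame k @^-1` [set c]] >>.
Proof.
move=> _ [u [S ->]]; pose k := (`|(u - t)%R| + 1)%N.
rewrite (_ : Z u @^-1` S = \bigcup_c
    (if `[< exists2 w, frame k w = c & S (Z u w) >] then frame k @^-1` [set c] else set0)).
  apply: sigma_cover => [|c]; first exact: smallest_sigma_algebra.
  case: ifP => _; last exact: sigma_algebra0.
  by apply: sub_sigma_algebra; exists k, c.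
apply/seteqP; split => w.
  by move=> Sw; exists (frame k w) => //; case: asboolP => // -[]; exists w.
move=> [c _]; case: asboolP => // -[w' E Sw'] E'; rewrite /preimage /mkset.
rewrite (@frame_value k w w' u) //; first by rewrite /k; lia.
by rewrite E.
Qed.

End Frames.

Section Decoupling.
Context {R : realType} {d : measure_display} {Om : measurableType d}.
Context (Pr : probability Om R) (G : set (set Om)) (GM : G `<=` measurable).
Local Notation cd := (cond_density Pr GM).

Lemma integral_cond_densityC E F (mE : measurable E) (mF : measurable F) :
  \int[Pr]_(w in E) (cd mF w)%:E = \int[Pr]_(w in F) (cd mE w)%:E.
Proof.
have sT : <<s G >> setT by exact: (@measurableT _ (g_sigma_algebraType G)).
have := integral_cond_densityM Pr GM mE mF sT.
have := integral_cond_densityM Pr GM mF mE sT; rewrite !setTI => <- <-.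
by apply: eq_integral => w _; rewrite mulrC.
Qed.

Context {S T : countType} (X : int -> Om -> S) (Y : int -> Om -> T).
Hypotheses (pX : is_process X) (pY : is_process Y).

Lemma process_measurable {U : Type} (V : int -> Om -> U) : is_process V ->
  process_events V `<=` measurable.
Proof. by move=> pV _ [t [Q ->]]; exact: pV. Qed.

Hypothesis windows : forall t n u v (mF : measurable [set w | word (rtimes t n.+1) Y w = v]),
  \int[Pr]_(w in [set w | word (rtimes t n.+1) X w = u]) (cd mF w)%:E =
  Pr ([set w | word (rtimes t n.+1) X w = u] `&` [set w | word (rtimes t n.+1) Y w = v]).

(** The two variables are enlarged one at a time, exchanging the roles of the
    two events in between. *)
Lemma decoupled_windows E F (mF : measurable F) :
  <<s process_events X >> E -> <<s process_events Y >> F ->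
  \int[Pr]_(w in E) (cd mF w)%:E = Pr (E `&` F).
Proof.
move=> sE sF; apply: (decoupled_process pX _ sE) => ts s.
have mw (U : countType) (V : int -> Om -> U) : is_process V ->
    forall ts v, measurable [set w | word ts V w = v].
  by move=> pV ts0 v; exact: (measurable_word _ (fun u => u = v)).
have mE := mw _ _ pX ts s.
rewrite (integral_cond_densityC mE mF) setIC.
apply: (decoupled_process pY _ sF) => ts' s'.
have [t [n sub]] := rtimes_cover (ts ++ ts').
have sub1 : {subset ts <= rtimes t n.+1} by move=> u uts; apply: sub; rewrite mem_cat uts.
have sub2 : {subset ts' <= rtimes t n.+1}.
  by move=> u uts; apply: sub; rewrite mem_cat uts orbT.
apply: (cond_density_words pY sub2) => v.
have mv := mw _ _ pY (rtimes t n.+1) v.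
rewrite (integral_cond_densityC mv mE) setIC.
by apply: (cond_density_words pX sub1) => u; exact: windows.
Qed.

End Decoupling.

(** For an event [H] of the labels, [E `&` H] is again an event of [X], so the
    hypothesis evaluates the integral over [H] of the product of the two conditional
    probabilities. *)
Lemma decoupled_cond_independent {R : realType} {d : measure_display}
    {Om : measurableType d} (Pr : probability Om R) {S T U : Type}
    (X : int -> Om -> S) (Y : int -> Om -> T) (f : S -> U)
    (GM : process_events (fun t w => f (X t w)) `<=` measurable) :
  process_events X `<=` measurable -> process_events Y `<=` measurable ->
  (forall E F (mF : measurable F),
     <<s process_events X >> E -> <<s process_events Y >> F ->
     \int[Pr]_(w in E) (cond_density Pr GM mF w)%:E = Pr (E `&` F)) ->
  cond_independent Pr X Y (fun t w => f (X t w)).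
Proof.
move=> mX mY dec E F sE sF.
set G := process_events (fun t w => f (X t w)).
have mE : measurable E := sub_measurable mX sE.
have mF : measurable F := sub_measurable mY sF.
exists (cond_density Pr GM mE), (cond_density Pr GM mF).
split; [exact: is_cond_prob_density|exact: is_cond_prob_density|].
have GX : <<s G >> `<=` <<s process_events X >>.
  apply: smallest_sub; first exact: smallest_sigma_algebra.
  by move=> _ [t [Q ->]]; apply: sub_sigma_algebra; exists t, (f @^-1` Q).
have I H : <<s G >> H ->
    \int[Pr]_(w in H) (cond_density Pr GM mE w * cond_density Pr GM mF w)%:E =
    Pr (E `&` F `&` H).
  move=> sH; rewrite integral_cond_densityM// dec//.
    by rewrite -setIA setIC.
  by apply: (sigma_setI (@smallest_sigma_algebra _ setT _)) => //; exact: GX.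
have mq := measurable_cond_density Pr GM mE.
have mr := measurable_cond_density Pr GM mF.
split => //.
- exact: measurable_funM.
- apply/integrableP; split.
    apply/measurable_EFinP; apply: (measurable_fun_sub GM) => //.
    exact: measurable_funM.
  under eq_integral do rewrite /= ger0_norm ?mulr_ge0 ?cond_density_ge0//.
  rewrite I; last exact: (@measurableT _ (g_sigma_algebraType G)).
  by rewrite setIT ltey_eq fin_num_measure//; exact: measurableI.
Qed.

(** * Existence of a stationary chain *)

Section NestedIntervals.
Context {R : realType} {U : countType}.
Local Open Scope ring_scope.
(* [Q] prescribes the law of the first letters of a sequence; words are read
   with the last letter at the head. *)
Variable Q : seq U -> R.
Hypothesis Q_ge0 : forall r, 0 <= Q r.
Hypothesis Q_nil : Q [::] = 1.
Hypothesis Q_cons : forall r, \esum_(x in [set: U]) (Q (x :: r))%:E = (Q r)%:E.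

(** The unit interval is cut into cells of length [Q r], nested and ordered by
    [pickle]; the letters of a point are those of the cells that contain it. *)
Definition cumul (r : seq U) (n : nat) : R :=
  \sum_(0 <= i < n) oapp (fun x => Q (x :: r)) 0 (pickle_inv i).

Fixpoint left_end (r : seq U) : R :=
  if r is x :: r' then left_end r' + cumul r' (pickle x) else 0.

Definition cell (r : seq U) : set R := [set` `[left_end r, left_end r + Q r[].

Lemma cumulS r n : cumul r n.+1 =
  cumul r n + oapp (fun x => Q (x :: r)) 0 (pickle_inv n).
Proof. by rewrite /cumul big_nat_recr. Qed.

Lemma cumul_pickle r x : cumul r (pickle x).+1 = cumul r (pickle x) + Q (x :: r).
Proof. by rewrite cumulS pickleK_inv. Qed.

Lemma cumul_homo r : {homo cumul r : m n / (m <= n)%N >-> m <= n}.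
Proof.
apply: homo_leq => [//|y x z|n]; first exact: le_trans.
by rewrite cumulS lerDl; case: (pickle_inv n) => /=.
Qed.

Lemma cumul_ge0 r n : 0 <= cumul r n.
Proof. by have := @cumul_homo r 0 n isT; rewrite {1}/cumul big_geq. Qed.

Lemma cumul_cvg r : (cumul r n)%:E @[n --> \oo] --> (Q r)%:E.
Proof.
pose a i : \bar R := oapp (fun x => (Q (x :: r))%:E) 0%E (pickle_inv i).
have a0 i : (0 <= a i)%E by rewrite /a; case: (pickle_inv i) => //= x; rewrite lee_fin.
rewrite -Q_cons esum_nat -nneseries_esumT//.
rewrite (_ : (fun n => _) = (fun n => \sum_(0 <= i < n) a i)%E).
  exact: is_cvg_nneseries.
apply/funext => n; rewrite /cumul -sumEFin; apply: eq_bigr => i _.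
by rewrite /a; case: (pickle_inv i).
Qed.

Lemma cumul_le r n : cumul r n <= Q r.
Proof.
rewrite -lee_fin -(cvg_lim _ (@cumul_cvg r))//; apply: lime_ge.
  by apply/cvg_ex; exists (Q r)%:E; exact: cumul_cvg.
by exists n => // k /= nk; rewrite lee_fin cumul_homo.
Qed.

Lemma cell_cons_subset x r : cell (x :: r) `<=` cell r.
Proof.
move=> w; rewrite /cell /= !in_itv /= => /andP[h1 h2]; apply/andP; split.
  by apply: le_trans h1; rewrite lerDl cumul_ge0.
by apply: lt_le_trans h2 _; rewrite -addrA lerD2l -cumul_pickle cumul_le.
Qed.

Lemma cell_disjoint x y r w : cell (x :: r) w -> cell (y :: r) w -> x = y.
Proof.
have lt_disj a b : cell (a :: r) w -> cell (b :: r) w -> (pickle a < pickle b)%N -> False.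
  rewrite /cell /= !in_itv /= => /andP[_ h1] /andP[h2 _] ab.
  have := lt_le_trans h1 (_ : _ <= left_end r + cumul r (pickle b)).
  rewrite -addrA lerD2l -cumul_pickle cumul_homo// => /(_ isT) h.
  by have := le_lt_trans h2 h; rewrite ltxx.
move=> hx hy; case: (ltngtP (pickle x) (pickle y)) => [xy|yx|E].
- by case: (lt_disj _ _ hx hy xy).
- by case: (lt_disj _ _ hy hx yx).
- by have := congr1 (@unpickle U) E; rewrite !pickleK => -[].
Qed.

Lemma cell_cover r w : cell r w -> exists x, cell (x :: r) w.
Proof.
rewrite /cell /= in_itv /= => /andP[h1 h2].
pose u := w - left_end r.
have u0 : 0 <= u by rewrite subr_ge0.
have uQ : u < Q r by rewrite ltrBlDl.
have [n un] : exists n, u < cumul r n.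
  have := @cumul_cvg r => /fine_cvg /=.
  move=> /cvgr_gt /(_ u uQ) [n _ /(_ n (leqnn n)) /= h]; by exists n.
have ex : exists n, u < cumul r n by exists n.
case: (ex_minnP ex) => -[|k] uk kmin.
  by move: uk; rewrite /cumul big_geq// ltNge u0.
have ku : cumul r k <= u by rewrite leNgt; apply/negP => /kmin; rewrite ltnn.
move: uk; rewrite cumulS; case E : (pickle_inv k) => [x|] /=; last first.
  by rewrite addr0 ltNge ku.
have kx : pickle x = k by have := @pickle_invK U k; rewrite /ocancel E.
move=> uk; exists x; rewrite /cell /= in_itv /= kx.
by rewrite -addrA -lerBrDl -/u ku /= -ltrBlDl.
Qed.

Lemma some_letter : exists x : U, True.
Proof.
have [|x _] := @cell_cover [::] 0; last by exists x.
by rewrite /cell /= in_itv /= lexx /= add0r Q_nil ltr01.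
Qed.

(** A default letter is used outside the cell of [r]. *)
Definition next_letter (r : seq U) (w : R) : U :=
  match pselect (exists x, cell (x :: r) w) with
  | left h => sval (cid h)
  | right _ => sval (cid some_letter)
  end.

Fixpoint address (n : nat) (w : R) : seq U :=
  if n is n'.+1 then next_letter (address n' w) w :: address n' w else [::].

Lemma size_address n w : size (address n w) = n.
Proof. by elim: n => //= n ->. Qed.

Lemma cell_nil : cell [::] = [set` `[0, 1[].
Proof. by rewrite /cell /= add0r Q_nil. Qed.

Lemma addressP n r w : cell [::] w -> size r = n -> (address n w = r <-> cell r w).
Proof.
move=> w01; elim: n r => [|n IH] [|x r] //= [sr].
have IHr := IH r sr; have cA : cell (address n w) w.
  by apply/(IH _ (size_address n w)).
split.
  move=> [<- <-]; rewrite /next_letter; case: pselect => [h|no]; first exact: svalP (cid h).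
  by case: no; exact: cell_cover.
move=> cx; have Er : address n w = r by apply/IHr; exact: cell_cons_subset cx.
rewrite Er; congr cons; rewrite /next_letter; case: pselect => [h|no].
  by apply: cell_disjoint cx; exact: svalP (cid h).
by case: no; exists x.
Qed.

Lemma address_out n w : ~ cell [::] w -> address n w = nseq n (sval (cid some_letter)).
Proof.
move=> w01; have out r : ~ cell r w.
  by elim: r => // x r IH /cell_cons_subset.
elim: n => //= n ->; congr cons; rewrite /next_letter; case: pselect => // -[x cx].
by case: (out _ cx).
Qed.

Lemma measurable_cell r : measurable (cell r).
Proof. exact: measurable_itv. Qed.

Lemma measurable_address n r : measurable [set w | address n w = r].
Proof.
have -> : [set w | address n w = r] =
    ((cell [::]) `&` (if size r == n then cell r else set0)) `|`
    (~` (cell [::]) `&` (if nseq n (sval (cid some_letter)) == r then setT else set0)).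
  apply/seteqP; split => w.
    move=> /= E; have [w01|w01] := pselect (cell [::] w).
      have sr : size r = n by rewrite -E size_address.
      by left; split => //; rewrite sr eqxx; apply/(addressP w01 sr).
    by right; split => //; rewrite -E address_out// eqxx.
  move=> [[w01]|[w01]].
    by case: eqP => // sr cr; apply/(addressP w01 sr).
  by case: eqP => // <- _; exact: address_out.
apply: measurableU; apply: measurableI.
- exact: measurable_cell.
- by case: ifP => // _; exact: measurable_cell.
- by apply: measurableC; exact: measurable_cell.
- by case: ifP.
Qed.

Lemma cell_subset_unit r : cell r `<=` [set` `[0, 1]].
Proof.
move=> w cr; have : cell [::] w by elim: r cr => // x r IH /cell_cons_subset.
by rewrite cell_nil /= !in_itv /= => /andP[-> /ltW ->].
Qed.

Lemma uniform_address n r : size r = n ->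
  uniform_prob (@ltr01 R) [set w | address n w = r] = (Q r)%:E.
Proof.
move=> sr; set A := [set w | _].
have mA : measurable A := measurable_address n r.
have -> : uniform_prob (@ltr01 R) A = lebesgue_measure (A `&` [set` `[0, 1]]).
  have mI : measurable_fun [set: R] (EFin \o (\1_A : R -> R)).
    by apply/measurable_EFinP; exact: measurable_indic.
  have := @integral_uniform R 0 1 ltr01 (EFin \o \1_A) mI.
  have I0 x : (0 <= (EFin \o (\1_A : R -> R)) x)%E by rewrite lee_fin.
  move=> /(_ I0); rewrite subr0 invr1 mul1e !integral_indic ?setIT//; exact: measurable_itv.
have m1 : @measurable _ R [set 1] by exact: measurable_set1.
have mc : @measurable _ R (cell r) by exact: measurable_cell.
have mu1 : @lebesgue_measure R [set 1%R] = 0%E by exact: lebesgue_measure_set1.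
have muc : @lebesgue_measure R (cell r) = (Q r)%:E.
  rewrite /cell lebesgue_measure_itv /= lte_fin ltrDl.
  case: ltP => [_|Q0]; first by rewrite -EFinD addrAC subrr add0r.
  by congr EFin; apply/eqP; rewrite eq_le Q_ge0 Q0.
apply/eqP; rewrite eq_le; apply/andP; split.
  apply: (@le_trans _ _ (lebesgue_measure (cell r `|` [set 1]))).
    apply: le_measure; rewrite ?inE.
    - by apply: measurableI => //; exact: measurable_itv.
    - exact: measurableU.
    - move=> w [Aw]; rewrite /= in_itv /= => /andP[w0 w1].
      move: w1; rewrite le_eqVlt => /predU1P[->|w1]; [by right|left].
      by apply/(@addressP n) => //; rewrite cell_nil /= in_itv /= w0.
  have := @measureU2 _ _ _ (@lebesgue_measure R) (cell r) [set 1%R] mc m1.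
  move=> h; apply: (le_trans h); move: muc mu1 => E1 E2.
  by rewrite -[(Q r)%:E]adde0 -E1 -E2; exact: lexx.
rewrite -muc; apply: le_measure; rewrite ?inE//.
  by apply: measurableI => //; exact: measurable_itv.
move=> w cr; split; last exact: cell_subset_unit cr.
have w01 : cell [::] w by elim: (r) cr => // x r' IH /cell_cons_subset.
exact/(addressP w01 sr).
Qed.

End NestedIntervals.

Section ForwardChain.
Context {R : realType} {U : countType} (p : U -> R) (K : U -> U -> R).
Hypotheses (dp : is_distribution p) (sK : stochastic K).
Local Open Scope ring_scope.

Let p0 u : 0 <= p u. Proof. by have [+ _] := dp; apply. Qed.
Let K0 u v : 0 <= K u v. Proof. by have [+ _] := sK u; apply. Qed.

(** The mass of a word of the chain, read from its last letter. *)
Fixpoint rev_weight (r : seq U) : R :=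
  if r is u :: r' then (if r' is v :: _ then K v u else p u) * rev_weight r' else 1.

Lemma rev_weight_ge0 r : 0 <= rev_weight r.
Proof. by elim: r => //= u [|v r] IH; rewrite mulr_ge0. Qed.

Lemma rev_weight_cons r :
  \esum_(u in [set: U]) (rev_weight (u :: r))%:E = (rev_weight r)%:E.
Proof.
case: r => [|v r] /=.
  by have [_ <-] := dp; apply: eq_esum => u _; rewrite mulr1.
under eq_esum do rewrite EFinM.
have r0 := rev_weight_ge0 (v :: r).
rewrite esumZr ?lee_fin//; last by move=> u; rewrite lee_fin.
by have [_ ->] := sK v; rewrite mul1e.
Qed.

Lemma rev_weight_catrev u s r : rev_weight (catrev s (u :: r)) =
  path_weight K u s * rev_weight (u :: r).
Proof.
elim: s u r => [|v s IH] u r; first by rewrite mul1r.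
rewrite -[catrev (v :: s) _]/(catrev s (v :: u :: r)) IH.
rewrite -[rev_weight (v :: _)]/(K u v * rev_weight (u :: r)).
rewrite -[path_weight K u (v :: s)]/(K u v * path_weight K v s).
by rewrite mulrCA mulrA.
Qed.

Lemma forward_chain_exists : exists (d : measure_display) (Om : measurableType d)
  (Pr : probability Om R) (xi : int -> Om -> U),
  is_process xi /\
  forall u s, Pr [set w | word (rtimes 0 (size s).+1) xi w = u :: s] =
    (p u * path_weight K u s)%:E.
Proof.
have q0 := rev_weight_ge0; have qc := rev_weight_cons.
pose ad := address (Q := rev_weight) q0 erefl qc.
pose dflt := sval (cid (some_letter q0 erefl qc)).
pose xi (t : int) (w : R) := head dflt (ad `|t|.+1 w).
have adS n w : ad n.+1 w = xi n w :: ad n w by [].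
have adE n w : ad n w = rev (word (rtimes 0 n) xi w).
  elim: n => [//|n IH]; rewrite adS IH rtimes_rcons add0r.
  by rewrite /word map_rcons rev_rcons.
have mad n r : @measurable _ R [set w | ad n w = r] by exact: measurable_address.
exists _, (measurableTypeR R), (uniform_prob (@ltr01 R)), xi; split.
  move=> t S.
  rewrite (_ : _ @^-1` _ = \bigcup_r (if head dflt r \in S
      then [set w | ad `|t|.+1 w = r] else set0)).
    apply: sigma_cover; first exact: sigma_algebra_measurable.
    by move=> r; case: ifP => _; [exact: mad|exact: measurable0].
  apply/seteqP; split => w.
    by move=> Sw; exists (ad `|t|.+1 w) => //; rewrite ifT// inE.
  by move=> [r _]; case: ifPn => //; rewrite inE => Sr /= adr; rewrite -adr in Sr; exact: Sr.
move=> u s.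
rewrite (_ : mkset _ = [set w | ad (size s).+1 w = rev (u :: s)]); last first.
  apply/seteqP; split => w; first by move=> E; rewrite /mkset adE; congr rev.
  by rewrite /mkset adE => /(congr1 rev); rewrite !revK.
apply: (etrans (uniform_address q0 erefl qc _)); first by rewrite size_rev.
by rewrite -[rev _]/(catrev s [:: u]) rev_weight_catrev /= mulr1 mulrC.
Qed.

End ForwardChain.

Section TwoSidedChain.
Context {R : realType} {T : countType} (p : T -> R) (P : T -> T -> R).
Hypotheses (dp : is_distribution p) (sP : stochastic P)
  (invP : invariant_distribution p P) (supp : forall x, (0 < p x)%R).

Let p0 x : (0 <= p x)%R. Proof. exact: ltW. Qed.
Let P0 x y : (0 <= P x y)%R. Proof. by have [+ _] := sP x; apply. Qed.

Let sR : stochastic (rev_mx p P). Proof. exact: rev_mx_stochastic. Qed.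

(** A chain of pairs started on the diagonal: the first coordinate runs along [P]
    and gives the future, the second along the reversed kernel and gives the
    past. *)
Definition double_init (u : T * T) : R := if u.1 == u.2 then p u.1 else 0%R.

Definition double_mx (u v : T * T) : R := (P u.1 v.1 * rev_mx p P u.2 v.2)%R.

Lemma double_init_distribution : is_distribution double_init.
Proof.
split => [u|]; first by rewrite /double_init; case: ifP.
rewrite -(esum_pair (F := fun x y => (if x == y then p x else 0)%:E)); last first.
  by move=> x y; rewrite lee_fin; case: ifP.
have [_ <-] := dp; apply: eq_esum => x _.
rewrite (@esum_single _ _ _ x) ?eqxx ?lee_fin// => y.
by rewrite eq_sym => /negbTE ->.
Qed.

Lemma double_stochastic : stochastic double_mx.
Proof.
move=> u; have R0 x y : (0 <= rev_mx p P x y)%R by have [+ _] := sR x; apply.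
split => [v|]; first by rewrite mulr_ge0.
rewrite -(esum_pair (F := fun x y => (P u.1 x * rev_mx p P u.2 y)%:E)); last first.
  by move=> x y; rewrite lee_fin mulr_ge0.
have [_ <-] := sP u.1; apply: eq_esum => x _.
under eq_esum do rewrite EFinM.
rewrite esumZl ?lee_fin//; last by move=> y; rewrite lee_fin.
by have [_ ->] := sR u.2; rewrite mule1.
Qed.

Lemma double_path_weight x y s l : size s = size l ->
  path_weight double_mx (x, y) (zip s l) =
  (path_weight P x s * path_weight (rev_mx p P) y l)%R.
Proof.
elim: s l x y => [|x' s IH] [|y' l] //= x y; first by rewrite mulr1.
by move=> [sl]; rewrite IH// /double_mx /=; ring.
Qed.

Definition list_mass (s : seq T) : R :=
  if s is x :: s' then word_mass p P x s' else 1%R.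

(** Prepending [y] to a word multiplies its mass by the reversed kernel. *)
Lemma list_mass_catrev l x s : list_mass (catrev l (x :: s)) =
  (path_weight (rev_mx p P) x l * word_mass p P x s)%R.
Proof.
elim: l x s => [|y l IH] x s; first by rewrite /= mul1r.
rewrite -[catrev (y :: l) _]/(catrev l (y :: x :: s)) IH /word_mass /= /rev_mx.
by field; rewrite gt_eqF.
Qed.

Lemma ltimes_rtimes n m t : catrev (ltimes t n) (rtimes t m) = rtimes (t - n%:Z)%R (n + m).
Proof.
elim: n m t => [|n IH] m t; first by rewrite subr0.
rewrite -[catrev _ _]/(catrev (ltimes (t - 1)%R n) (t - 1 :: rtimes t m)%R).
have -> : ((t - 1)%R :: rtimes t m) = rtimes (t - 1)%R m.+1 by rewrite /= subrK.
rewrite IH addSnnS; congr (rtimes _ _); rewrite intS; ring.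
Qed.

(** Words in windows centred at zero have the right mass by construction; other
    windows are obtained by dropping letters at either end. *)
Lemma two_sided_chain_exists : exists (d : measure_display) (Om : measurableType d)
  (Pr : probability Om R) (W : int -> Om -> T), stationary_markov_chain Pr W p P.
Proof.
have [d [Om [Pr [xi [pxi xiE]]]]] := forward_chain_exists double_init_distribution double_stochastic.
pose W (t : int) (w : Om) := if (0 <= t)%R then (xi t w).1 else (xi (- t)%R w).2.
have pW : is_process W.
  move=> t S; rewrite /W; case: (0 <= t)%R.
    exact: (pxi t (fst @^-1` S)).
  exact: (pxi (- t)%R (snd @^-1` S)).
exists d, Om, Pr, W.
have WE n : forall w, word (rtimes 0 n) W w = unzip1 (word (rtimes 0 n) xi w).
  move=> w; rewrite /unzip1 /word -map_comp; apply/eq_in_map => t.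
  by rewrite mem_rtimes /W => /andP[-> _].
have WEl n : forall w, word (ltimes 0 n) W w = unzip2 (word (rtimes 1 n) xi w).
  have gen k : forall w, word (ltimes (- k%:Z)%R n) W w = unzip2 (word (rtimes (k%:Z + 1)%R n) xi w).
    elim: n k => [//|n IH] k w.
    rewrite [LHS]/= [RHS]/= -!/(word _ _ _); congr cons.
      by rewrite /W ifF ?opprB ?opprD ?opprK; [congr (xi _ w).2; ring|lia].
    have := IH k.+1 w; rewrite intS opprD addrC => ->.
    by congr (unzip2 (word (rtimes _ _) _ _)); ring.
  by move=> w; have := gen 0%N w; rewrite oppr0 add0r.
have centered n x s l : size s = n -> size l = n ->
    Pr ([set w | word (ltimes 0 n) W w = l] `&` [set w | word (rtimes 0 n.+1) W w = x :: s]) =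
    (list_mass (catrev l (x :: s)))%:E.
  move=> sn ln.
  rewrite (measure_esum Pr (h := fun w => (xi 0%R w).2)); last 2 first.
  - apply: measurableI; exact: (measurable_word _ (fun u => u = _)).
  - by move=> y; exact: (pxi 0%R (snd @^-1` [set y])).
  have szl : size (zip s l) = n by rewrite size_zip sn ln minnn.
  have E y : Pr ([set w | word (ltimes 0 n) W w = l] `&`
      [set w | word (rtimes 0 n.+1) W w = x :: s] `&` (fun w => (xi 0%R w).2) @^-1` [set y]) =
      (double_init (x, y) * path_weight double_mx (x, y) (zip s l))%:E.
    rewrite -xiE szl; congr (Pr _); apply/seteqP; split => w.
      move=> [[]]; rewrite /mkset WEl WE => E1 E2 E3.
      rewrite -(zip_unzip (word (rtimes 0 n.+1) xi w)) E2 [unzip2 _]/= -/(word _ _ _) add0r.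
      by rewrite E1 (E3 : (xi 0%R w).2 = y).
    rewrite /mkset /= -/(word _ _ _) => E3.
    have {}E3 : word (rtimes 0 n.+1) xi w = (x, y) :: zip s l := E3.
    split; last by case: E3 => /= ->.
    have E4 : word (rtimes 0 n.+1) W w = x :: s.
      by rewrite WE E3 -[LHS]/(x :: unzip1 _) unzip1_zip// sn ln.
    split => //; rewrite /mkset WEl.
    by case: E3 => _; rewrite add0r => ->; rewrite unzip2_zip// sn ln.
  rewrite (eq_esum (fun y _ => E y)).
  rewrite (@esum_single _ _ _ x).
  - rewrite /double_init /= eqxx double_path_weight ?sn ?ln// list_mass_catrev /word_mass.
    by congr EFin; ring.
  - rewrite lee_fin mulr_ge0 ?path_weight_ge0//; last exact: double_stochastic.
    by have [+ _] := double_init_distribution; apply.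
  - by move=> y yx; rewrite /double_init /= eq_sym (negbTE yx) mul0r.
have window n x s : size s = (n + n)%N ->
    Pr [set w | word (rtimes (- n%:Z)%R (n + n).+1) W w = x :: s] = (word_mass p P x s)%:E.
  move=> sz; pose u := x :: s.
  have su : size u = (n + n).+1 by rewrite /= sz.
  have sl : size (rev (take n u)) = n by rewrite size_rev size_take su ltnS leq_addr.
  have sd : size (drop n u) = n.+1 by rewrite size_drop su -addnS addKn.
  case Ed : (drop n u) sd => [//|y s'] [s'n].
  have Eu : catrev (rev (take n u)) (y :: s') = u by rewrite catrevE revK -Ed cat_take_drop.
  move: (rev (take n u)) sl Eu => tk sl Eu.
  rewrite -[word_mass p P x s]/(list_mass u) -Eu -(centered n)//.
  congr (Pr _).
  have wE w : word (rtimes (- n%:Z)%R (n + n).+1) W w =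
      catrev (word (ltimes 0 n) W w) (word (rtimes 0 n.+1) W w).
    rewrite -addnS -[(- _)%R]add0r -ltimes_rtimes !catrevE /word map_cat map_rev//.
  apply/seteqP; split => w; rewrite /mkset wE.
    rewrite -/u -Eu !catrevE => /eqP; rewrite eqseq_cat; last first.
      by rewrite !size_rev size_word size_ltimes sl.
    by move=> /andP[/eqP E1 /eqP E2]; split; [exact: (inv_inj revK)|exact: E2].
  by move=> [-> ->]; rewrite Eu.
pose C t n := forall x s, size s = n ->
  Pr [set w | word (rtimes t n.+1) W w = x :: s] = (word_mass p P x s)%:E.
have mW ts s : measurable [set w | word ts W w = s].
  exact: (measurable_word _ (fun u => u = s)).
have shrinkr t n : C t n.+1 -> C t n.
  move=> Cn x s sn; rewrite (measure_esum Pr (h := W (t + n.+1%:Z)%R))//.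
  transitivity (\esum_(y in [set: T]) ((word_mass p P x s)%:E * (P (last x s) y)%:E)).
    apply: eq_esum => y _; rewrite -EFinM -mulrA -path_weight_rcons -Cn ?size_rcons ?sn//.
    congr (Pr _); have wE w : word (rtimes t n.+2) W w =
        rcons (word (rtimes t n.+1) W w) (W (t + n.+1%:Z)%R w).
      by rewrite rtimes_rcons /word map_rcons.
    apply/seteqP; split => w; rewrite /mkset wE -rcons_cons.
      by move=> [E1 E2]; rewrite (E1 : word _ _ _ = _) (E2 : W _ _ = _).
    by move=> /rcons_inj [E1 E2 E3]; split => //; rewrite /mkset; congr cons.
  rewrite esumZl ?lee_fin; last 2 first.
  - by rewrite mulr_ge0 ?path_weight_ge0.
  - by move=> y; rewrite lee_fin.
  by have [_ ->] := sP (last x s); rewrite mule1.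
have shrinkl t n : C t n.+1 -> C (t + 1)%R n.
  move=> Cn x s sn; rewrite (measure_esum Pr (h := W t))//.
  transitivity (\esum_(y in [set: T]) ((p y * P y x)%:E * (path_weight P x s)%:E)).
    apply: eq_esum => y _.
    rewrite -EFinM -mulrA -[(p y * _)%R]/(word_mass p P y (x :: s)) -(Cn y (x :: s)); last by rewrite /= sn.
    congr (Pr _); apply/seteqP; split => w; first by move=> [E1 E2]; congr cons.
    by move=> [E1 E2 E3]; split => //; congr cons.
  rewrite esumZr ?lee_fin ?path_weight_ge0//; last by move=> y; rewrite lee_fin mulr_ge0.
  by rewrite invP -EFinM.
have all t n : C t n.
  have start N : C (- N%:Z)%R (N + N)%N by move=> x s; exact: window.
  have left m u k : C u (m + k)%N -> C (u + m%:Z)%R k.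
    elim: m u => [|m IH] u; first by rewrite addr0.
    rewrite addSn => /shrinkl /IH; congr (C _ _); rewrite intS; ring.
  have right m u k : C u (m + k)%N -> C u k.
    by elim: m => // m IH; rewrite addSn => /shrinkr.
  (* the times [t, .., t + n] all lie between [- N] and [N] *)
  pose N := (`|t| + n)%N.
  have tN : (t + N%:Z = `|(t + N%:Z)%R|%N%:Z)%R by rewrite /N; lia.
  have := start N; rewrite (_ : (N + N)%N = (`|(t + N%:Z)%R| + ((N + N - `|(t + N%:Z)%R| - n) + n))%N); last by rewrite /N; lia.
  by move=> /left /right; rewrite -tN (_ : (- N%:Z + (t + N%:Z) = t)%R)//; ring.
have words t x s : Pr [set w | word (rtimes t (size s).+1) W w = x :: s] = (word_mass p P x s)%:E.
  exact: all.
split => //.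
- apply: eq_law_words => // t x s; rewrite words -(words (t + 1)%R); congr (Pr _).
  have E n u : forall w, word (rtimes u n) (fun t => W (t + 1)%R) w = word (rtimes (u + 1)%R n) W w.
    by move=> w; elim: n u => [//|n IH] u; rewrite [LHS]/= -/(word _ _ _) IH.
  by apply/seteqP; split => w; rewrite /mkset E.
- move=> x; have := words 0%R x [::]; rewrite /word_mass /= mulr1 => <-.
  by congr (Pr _); apply/seteqP; split => w /=; [move=> ->|case].
- move=> t n x.
  have E m : [set w | forall i, (i <= m)%N -> W (t + i%:Z)%R w = x i] =
      [set w | word (rtimes t (size [seq x i | i <- iota 1 m]).+1) W w =
         x 0%N :: [seq x i | i <- iota 1 m]].
    rewrite size_map size_iota.
    have sz : size (x 0%N :: [seq x i | i <- iota 1 m]) = m.+1 by rewrite /= size_map size_iota.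
    have nthE i : (i < m.+1)%N -> nth (x 0%N) (x 0%N :: [seq x i | i <- iota 1 m]) i = x i.
      case: i => // i im; rewrite /= (nth_map 0%N) ?size_iota// nth_iota//.
    apply/seteqP; split => w; rewrite /mkset => H.
      by apply/(word_rtimesP (x 0%N) W t w sz) => i im; rewrite nthE// H.
    by move=> i im; move/(word_rtimesP (x 0%N) W t w sz): H => ->//; rewrite nthE.
  rewrite !E !words -EFinM; congr EFin.
  have iota_rcons m k : iota m k.+1 = rcons (iota m k) (m + k)%N.
    by rewrite -(addn1 k) iotaD cats1.
  rewrite iota_rcons map_rcons add1n /word_mass path_weight_rcons mulrA.
  by congr (_ * P _ _)%R; case: (n) => // k; rewrite iota_rcons map_rcons last_rcons add1n.
Qed.

End TwoSidedChain.

(** * The chain on [Delta''] *)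

Section JointChain.
Context {R : realType} {A B C : countType}.
Context {dX dY dZ : measure_display}.
Context {OX : measurableType dX} {OY : measurableType dY} {OZ : measurableType dZ}.
Context (PrX : probability OX R) (PrY : probability OY R) (PrZ : probability OZ R).
Context (X : int -> OX -> A) (Y : int -> OY -> B) (Z : int -> OZ -> C).
Context (piX : A -> R) (piY : B -> R) (piZ : C -> R).
Context (PX : A -> A -> R) (PY : B -> B -> R) (PZ : C -> C -> R).
Hypothesis chainX : stationary_markov_chain PrX X piX PX.
Hypothesis chainY : stationary_markov_chain PrY Y piY PY.
Hypothesis chainZ : stationary_markov_chain PrZ Z piZ PZ.
Hypotheses (suppX : forall a, (0 < piX a)%R) (suppY : forall b, (0 < piY b)%R)
  (suppZ : forall c, (0 < piZ c)%R).
Context (f : A -> C) (g : B -> C).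
Hypothesis lawX : eq_law PrX (fun t w => f (X t w)) PrZ Z.
Hypothesis lawY : eq_law PrY (fun t w => g (Y t w)) PrZ Z.

Local Notation M := (fiber_mx f g PX PY PZ).
Local Notation Mrev := (fiber_mx f g (rev_mx piX PX) (rev_mx piY PY) (rev_mx piZ PZ)).
Local Notation fwd := (pairing f g PX PY PZ).
Local Notation bwd := (pairing f g (rev_mx piX PX) (rev_mx piY PY) (rev_mx piZ PZ)).
Local Notation wmX := (word_mass piX PX).
Local Notation wmY := (word_mass piY PY).
Local Notation wmZ := (word_mass piZ PZ).

Variables (phi phirev : Delta f g -> R).
Hypotheses (phi0 : forall x, (0 <= phi x)%R) (phirev0 : forall x, (0 <= phirev x)%R).
Hypothesis hphi : forall x, fwd k (Delta_fst x) (Delta_snd x) @[k --> \oo] --> (phi x)%:E.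
Hypothesis hphirev : forall x, bwd k (Delta_fst x) (Delta_snd x) @[k --> \oo] --> (phirev x)%:E.
Hypothesis harm : forall x,
  \esum_(y in [set: Delta f g]) (M x y * phi y)%:E = (phi x)%:E.
Hypothesis harm_rev : forall x,
  \esum_(y in [set: Delta f g]) (Mrev x y * phirev y)%:E = (phirev x)%:E.

Local Notation D2 := (Delta2 phi phirev).
Local Notation piW := (joint_distribution phi phirev piX piY piZ).
Local Notation PW := (joint_transition phi phirev M).
Local Notation jm := (joint_mass piX piY piZ PX PY PZ phi phirev).

Let stX : stochastic PX. Proof. by case: chainX. Qed.
Let stY : stochastic PY. Proof. by case: chainY. Qed.
Let stZ : stochastic PZ. Proof. by case: chainZ. Qed.
Let PX0 x y : (0 <= PX x y)%R. Proof. by have [+ _] := stX x; apply. Qed.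
Let PY0 x y : (0 <= PY x y)%R. Proof. by have [+ _] := stY x; apply. Qed.
Let PZ0 x y : (0 <= PZ x y)%R. Proof. by have [+ _] := stZ x; apply. Qed.
Let piX0 x : (0 <= piX x)%R. Proof. exact: ltW. Qed.
Let piY0 x : (0 <= piY x)%R. Proof. exact: ltW. Qed.
Let piZ0 x : (0 <= piZ x)%R. Proof. exact: ltW. Qed.

Lemma fiber_mxE (KX : A -> A -> R) (KY : B -> B -> R) (KZ : C -> C -> R) :
  (forall c c', (0 <= KZ c c')%R) -> forall x y, fiber_mx f g KX KY KZ x y =
  (KX (Delta_fst x) (Delta_fst y) * KY (Delta_snd x) (Delta_snd y) /
   KZ (f (Delta_fst x)) (f (Delta_fst y)))%R.
Proof.
move=> KZ0 x y; rewrite /fiber_mx; case: ltP => // KZle.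
have -> : KZ (f (Delta_fst x)) (f (Delta_fst y)) = 0%R.
  by apply/eqP; rewrite eq_le KZle KZ0.
by rewrite invr0 mulr0.
Qed.

Definition fiber_weight (x : Delta f g) : R :=
  (piX (Delta_fst x) * piY (Delta_snd x) / piZ (f (Delta_fst x)))%R.

Lemma fiber_weight_gt0 x : (0 < fiber_weight x)%R.
Proof. by rewrite divr_gt0 ?mulr_gt0. Qed.

Let rZ0 c c' : (0 <= rev_mx piZ PZ c c')%R.
Proof. by rewrite /rev_mx divr_ge0// mulr_ge0. Qed.

(** Detailed balance between [R] and [R^rev]. *)
Lemma fiber_mx_rev x y : (fiber_weight x * M x y = fiber_weight y * Mrev y x)%R.
Proof.
rewrite !fiber_mxE// /fiber_weight /rev_mx.
have [->|zn0] := eqVneq (PZ (f (Delta_fst x)) (f (Delta_fst y))) 0%R.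
  by rewrite mulr0 mul0r !invr0 !mulr0.
by field; rewrite zn0 !gt_eqF.
Qed.

Lemma M_ge0 x y : (0 <= M x y)%R.
Proof. by rewrite fiber_mxE// divr_ge0 ?mulr_ge0. Qed.

Lemma Mrev_ge0 x y : (0 <= Mrev x y)%R.
Proof.
rewrite (fiber_mxE _ _ rZ0); apply: divr_ge0 => //.
by apply: mulr_ge0; rewrite /rev_mx divr_ge0// mulr_ge0.
Qed.

Lemma Mrev_gt0 x y : (0 < M x y)%R -> (0 < Mrev y x)%R.
Proof.
move=> M0; rewrite -(pmulr_rgt0 _ (fiber_weight_gt0 y)) -fiber_mx_rev.
by rewrite mulr_gt0// fiber_weight_gt0.
Qed.

(** Positivity of [phi] propagates backwards along transitions, that of [phirev]
    forwards. *)
Lemma phi_gt0 x y : (0 < M x y)%R -> (0 < phi y)%R -> (0 < phi x)%R.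
Proof.
move=> M0 py; apply: (@lt_le_trans _ _ (M x y * phi y)%R); first exact: mulr_gt0.
rewrite -lee_fin -harm; apply: (@esum_term_le _ _ _ y) => z.
by rewrite lee_fin mulr_ge0// M_ge0.
Qed.

Lemma phirev_gt0 x y : (0 < M x y)%R -> (0 < phirev x)%R -> (0 < phirev y)%R.
Proof.
move=> /Mrev_gt0 M0 px; apply: (@lt_le_trans _ _ (Mrev y x * phirev x)%R).
  exact: mulr_gt0.
rewrite -lee_fin -harm_rev; apply: (@esum_term_le _ _ _ x) => z.
by rewrite lee_fin mulr_ge0// Mrev_ge0.
Qed.

Lemma D2P (x : D2) : (0 < phi (sval x))%R /\ (0 < phirev (sval x))%R.
Proof. by have /andP := valP x. Qed.

Lemma piW_gt0 x : (0 < piW x)%R.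
Proof.
have [p1 p2] := D2P x; rewrite /joint_distribution !mulr_gt0// invr_gt0; exact: suppZ.
Qed.

(** Harmonicity of [phi], once the terms outside [Delta''] are seen to vanish: a
    transition out of [Delta''] reaches a state where [phirev] is positive. *)
Lemma joint_stochastic : stochastic PW.
Proof.
move=> x; have [px qx] := D2P x; split => [y|].
  by rewrite /joint_transition !mulr_ge0 ?invr_ge0 ?M_ge0.
transitivity (\esum_(y in [set: Delta f g])
    (((phi (sval x))^-1)%:E * (M (sval x) y * phi y)%:E)); last first.
  rewrite esumZl ?lee_fin ?invr_ge0//; last by move=> y; rewrite lee_fin mulr_ge0// M_ge0.
  by rewrite harm -EFinM mulVf// gt_eqF.
rewrite (esum_subtype (fun y => (0 < phi y)%R && (0 < phirev y)%R)
  (fun y => ((phi (sval x))^-1 * M (sval x) y * phi y)%:E)).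
apply: eq_esum => y _; rewrite -EFinM mulrA; case: ifPn => // ny; congr EFin.
apply/eqP; rewrite eq_sym; apply/negPn/negP => nz; move/negP: ny; apply.
have Mn : (0 < M (sval x) y)%R.
  by rewrite lt_def M_ge0 andbT; apply: contra_neq nz => ->; rewrite mulr0 mul0r.
have pn : (0 < phi y)%R.
  by rewrite lt_def phi0 andbT; apply: contra_neq nz => ->; rewrite mulr0.
by rewrite pn (phirev_gt0 Mn qx).
Qed.

(** By detailed balance this is harmonicity of [phirev] for [R^rev]. *)
Lemma joint_invariant : invariant_distribution piW PW.
Proof.
move=> y; have [py qy] := D2P y.
transitivity (\esum_(x in [set: Delta f g])
    ((fiber_weight (sval y) * phi (sval y))%:E * (Mrev (sval y) x * phirev x)%:E)); last first.
  rewrite esumZl ?lee_fin; last 2 first.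
  - by rewrite mulr_ge0// ltW// fiber_weight_gt0.
  - by move=> x; rewrite lee_fin mulr_ge0// Mrev_ge0.
  by rewrite harm_rev -EFinM.
pose F (x : Delta f g) : \bar R := (fiber_weight x * M x (sval y) * phi (sval y) * phirev x)%:E.
transitivity (\esum_(x in [set: D2]) F (val x)).
  apply: eq_esum => x _; have [px qx] := D2P x; congr EFin.
  rewrite /joint_distribution /joint_transition -/(fiber_weight (sval x)).
  by field; rewrite gt_eqF.
rewrite (esum_subtype (fun y => (0 < phi y)%R && (0 < phirev y)%R) F).
apply: eq_esum => x _; rewrite -EFinM.
have -> : (fiber_weight (sval y) * phi (sval y) * (Mrev (sval y) x * phirev x) =
    fiber_weight x * M x (sval y) * phi (sval y) * phirev x)%R.
  by rewrite fiber_mx_rev; ring.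
case: ifPn => // nx; congr EFin.
apply/eqP; rewrite eq_sym; apply/negPn/negP => nz; move/negP: nx; apply.
have Mn : (0 < M x (sval y))%R.
  by rewrite lt_def M_ge0 andbT; apply: contra_neq nz => ->; rewrite !(mulr0, mul0r).
have pn : (0 < phirev x)%R.
  by rewrite lt_def phirev0 andbT; apply: contra_neq nz => ->; rewrite mulr0.
by rewrite pn (phi_gt0 Mn py).
Qed.

Lemma joint_mass_ge0 x y : (0 <= jm x y)%R.
Proof.
rewrite /joint_mass; case: ifP => // _; apply: mulr_ge0.
  by rewrite /word_mass divr_ge0 ?mulr_ge0 ?path_weight_ge0.
by rewrite mulr_ge0// /extend; case: insub.
Qed.

(** The masses of pairs of one-letter words have the law [piX] as marginal. *)
Lemma joint_is_distribution : is_distribution piW.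
Proof.
split => [x|]; first exact/ltW/piW_gt0.
pose F (x : Delta f g) : \bar R := (fiber_weight x * phi x * phirev x)%:E.
transitivity (\esum_(x in [set: D2]) F (val x)); first by [].
rewrite (esum_subtype (fun y => (0 < phi y)%R && (0 < phirev y)%R) F).
transitivity (\esum_(x in [set: Delta f g]) F x).
  apply: eq_esum => x _; case: ifPn => //; rewrite negb_and -!leNgt /F => /orP[h|h].
    by rewrite (_ : phi x = 0%R) ?mulr0 ?mul0r//; apply/eqP; rewrite eq_le h phi0.
  by rewrite (_ : phirev x = 0%R) ?mulr0//; apply/eqP; rewrite eq_le h phirev0.
pose G a b : \bar R := (piX a * piY b / piZ (f a) * extend phi a b * extend phirev a b)%:E.
have e0 u a b : (forall x, 0 <= u x)%R -> (0 <= extend (f := f) (g := g) u a b :> R)%R.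
  by move=> u0; rewrite /extend; case: insub.
transitivity (\esum_(x in [set: Delta f g]) G (Delta_fst x) (Delta_snd x)).
  by apply: eq_esum => x _; rewrite /F /G !extendE.

rewrite esum_Delta; last first.
  by move=> a b; rewrite lee_fin !mulr_ge0 ?invr_ge0 ?e0.
rewrite -(esum_word_mass chainX suppX 0%N); apply: eq_esum => a _.
rewrite (@esum_single _ _ _ [::]); last 2 first.
- by rewrite lee_fin (word_mass_ge0 chainX suppX).
- by move=> [].
have jm0 y : 0 <= (jm (a, [::]) y)%:E by rewrite lee_fin joint_mass_ge0.
rewrite /= -(esum_joint_mass chainX chainY chainZ suppX suppY suppZ lawX lawY
  hphi hphirev (a, [::])).
rewrite -(esum_pair (F := fun b v => (jm (a, [::]) (b, v))%:E))//.
apply: eq_esum => b _.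
rewrite (@esum_single _ _ _ [::])//; last first.
  by move=> [|y v] _ //; rewrite /joint_mass /matching /= andbF.
rewrite /joint_mass /matching /= eqxx andbT; case: ifP => // _.
by rewrite /G /word_mass /= !mulr1; congr EFin; ring.
Qed.

(** The factors [phi] of the transitions telescope. *)
Lemma joint_word_mass (x : D2) us : word_mass piW PW x us =
  jm (Delta2_fst x, map (@Delta2_fst _ _ _ _ _ _ phi phirev) us)
     (Delta2_snd x, map (@Delta2_snd _ _ _ _ _ _ phi phirev) us).
Proof.
have lab (y : D2) : f (Delta2_fst y) = g (Delta2_snd y).
  by rewrite /Delta2_fst /Delta2_snd fiber_labels.
have pw u v : (path_weight PW u v * phi (sval u) =
    path_weight PX (Delta2_fst u) (map (@Delta2_fst _ _ _ _ _ _ phi phirev) v) *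
    path_weight PY (Delta2_snd u) (map (@Delta2_snd _ _ _ _ _ _ phi phirev) v) /
    path_weight PZ (f (Delta2_fst u)) (map f (map (@Delta2_fst _ _ _ _ _ _ phi phirev) v)) *
    phi (sval (last u v)))%R.
  elim: v u => [|w v IH] u /=; first by rewrite mulr1 invr1 mulr1.
  have [pu _] := D2P u; have [pw _] := D2P w.
  rewrite {1}/joint_transition fiber_mxE//.
  rewrite !invfM; set rhs := RHS.
  transitivity (PX (Delta2_fst u) (Delta2_fst w) * PY (Delta2_snd u) (Delta2_snd w) /
    PZ (f (Delta2_fst u)) (f (Delta2_fst w)) * (path_weight PW w v * phi (sval w)))%R.
    by rewrite /Delta2_fst /Delta2_snd; set z := (PZ _ _)^-1%R; field; rewrite gt_eqF.
  by rewrite IH /rhs; ring.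
rewrite /joint_mass /matching /= lab eqxx -!map_comp.
have -> : map (f \o @Delta2_fst _ _ _ _ _ _ phi phirev) us =
    map (g \o @Delta2_snd _ _ _ _ _ _ phi phirev) us.
  by apply: eq_map => y /=; exact: lab.
rewrite eqxx /= -lab {1}/word_mass {1}/joint_distribution.
have := pw x us; rewrite -!map_comp => E.
rewrite !last_map /Delta2_fst /Delta2_snd !extendE -/(Delta2_fst _) -/(Delta2_snd _).
have -> : map (g \o @Delta2_snd _ _ _ _ _ _ phi phirev) us =
    map (f \o @Delta2_fst _ _ _ _ _ _ phi phirev) us.
  by apply: eq_map => y /=; rewrite lab.
rewrite /word_mass !invfM.
transitivity (piX (Delta2_fst x) * piY (Delta2_snd x) / piZ (f (Delta2_fst x)) * phirev (sval x) *
  (path_weight PW x us * phi (sval x)))%R; first by ring.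
by rewrite E; ring.
Qed.

Local Notation dfst := (@Delta2_fst _ _ _ _ f g phi phirev).
Local Notation dsnd := (@Delta2_snd _ _ _ _ f g phi phirev).

Lemma path_lift s v (x : Delta f g) : map f s = map g v -> (0 < phirev x)%R ->
  (0 < extend phi (last (Delta_fst x) s) (last (Delta_snd x) v))%R ->
  (path_weight PX (Delta_fst x) s != 0)%R -> (path_weight PY (Delta_snd x) v != 0)%R ->
  (path_weight PZ (f (Delta_fst x)) (map f s) != 0)%R ->
  (0 < phi x)%R /\ exists us : seq D2, map dfst us = s /\ map dsnd us = v.
Proof.
elim: s v x => [|a s IH] [|b v] x //=.
  by move=> _ qx; rewrite extendE => px _ _ _; split=> //; exists [::].
move=> [ab sv] qx pl; rewrite !mulf_eq0 !negb_or.
move=> /andP[X1 X2] /andP[Y1 Y2] /andP[Z1 Z2].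
have ab' : f a == g b by apply/eqP.
pose y : Delta f g := exist _ (a, b) ab'.
have Mn : (0 < M x y)%R.
  by rewrite fiber_mxE// divr_gt0 ?mulr_gt0// lt_def ?X1 ?Y1 ?Z1 ?PX0 ?PY0 ?PZ0.
have qy := phirev_gt0 Mn qx.
have [py [us [us1 us2]]] := IH v y sv qy pl X2 Y2 Z2.
split; first exact: phi_gt0 Mn py.
have yP : (0 < phi y)%R && (0 < phirev y)%R by rewrite py.
exists (exist _ y yP :: us); split; last by rewrite /= us2.
by rewrite /= us1.
Qed.

(** Pairs of words of positive mass are read off words of [Delta'']. *)
Lemma joint_lift a s b v : (jm (a, s) (b, v) != 0)%R ->
  exists (x : D2) us, [/\ dfst x = a, dsnd x = b, map dfst us = s & map dsnd us = v].
Proof.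
rewrite /joint_mass /matching /=; case: ifP => [/andP[ab /eqP sv]|_]; last by rewrite eqxx.
rewrite /word_mass !mulf_eq0 !invr_eq0 !mulf_eq0 !negb_or.
move=> /andP[/andP[/andP[/andP[_ X1] /andP[_ Y1]] /andP[_ Z1]] /andP[q1 p1]].
pose x : Delta f g := exist _ (a, b) ab.
have e0 u c d : (forall x, 0 <= u x)%R -> (0 <= extend (f := f) (g := g) u c d :> R)%R.
  by move=> u0; rewrite /extend; case: insub.
have qx : (0 < phirev x)%R by rewrite -extendE lt_def q1 e0.
have pl : (0 < extend phi (last a s) (last b v))%R by rewrite lt_def p1 e0.
have [px [us [us1 us2]]] := @path_lift s v x sv qx pl X1 Y1 Z1.
have xP : (0 < phi x)%R && (0 < phirev x)%R by rewrite px.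
by exists (exist _ x xP), us; split.
Qed.

Lemma Delta2_inj (us us' : seq D2) :
  map dfst us = map dfst us' -> map dsnd us = map dsnd us' -> us = us'.
Proof.
elim: us us' => [|x us IH] [|y us'] //= [E1 E2] [E3 E4].
rewrite (IH us')//; congr cons; apply: val_inj; apply: val_inj.
rewrite [LHS]surjective_pairing [RHS]surjective_pairing.
by congr pair; [exact: E1|exact: E3].
Qed.

Section Law.
Context {d : measure_display} {Om : measurableType d} (Pr : probability Om R).
Context (W : int -> Om -> D2).
Hypothesis chainW : stationary_markov_chain Pr W piW PW.

Let Xt t w := dfst (W t w).
Let Yt t w := dsnd (W t w).
Let Zt t w := f (Xt t w).

Let pW : is_process W. Proof. by case: chainW. Qed.
Let pX : is_process Xt. Proof. by move=> t S; exact: (pW t (dfst @^-1` S)). Qed.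
Let pY : is_process Yt. Proof. by move=> t S; exact: (pW t (dsnd @^-1` S)). Qed.
Let pZ : is_process Zt. Proof. by move=> t S; exact: (pX t (f @^-1` S)). Qed.

Lemma joint_label t w : f (Xt t w) = g (Yt t w).
Proof. by rewrite /Xt /Yt /Delta2_fst /Delta2_snd fiber_labels. Qed.

(** If no word of [Delta''] projects to the two given words, then the event is
    empty, and the mass is zero by [joint_lift]. *)
Lemma joint_words t a s b v :
  Pr [set w | word (rtimes t (size s).+1) Xt w = a :: s /\
              word (rtimes t (size s).+1) Yt w = b :: v] = (jm (a, s) (b, v))%:E.
Proof.
have wX ts w : word ts Xt w = map dfst (word ts W w) by rewrite /word -map_comp.
have wY ts w : word ts Yt w = map dsnd (word ts W w) by rewrite /word -map_comp.
have [[x [us [xa xb us1 us2]]]|no] := pselect (exists (x : D2) us,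
    [/\ dfst x = a, dsnd x = b, map dfst us = s & map dsnd us = v]).
  rewrite -xa -xb -us1 -us2 -joint_word_mass -(chain_word chainW t) size_map.
  congr (Pr _); apply/seteqP; split => w; rewrite /mkset wX wY.
    by move=> [E1 E2]; apply: Delta2_inj; rewrite ?E1 ?E2.
  by move=> ->.
have [->|/joint_lift//] := eqVneq (jm (a, s) (b, v)) 0%R.
rewrite (_ : mkset _ = set0) ?measure0//; apply/seteqP; split => // w.
rewrite /mkset wX wY; case: (word _ W w) => [|x us] [] //= [E1 E2] [E3 E4].
by apply: no; exists x, us.
Qed.

Lemma joint_law_fst : eq_law Pr Xt PrX X.
Proof.
apply: eq_law_words => //; first by case: chainX.
move=> t a s; rewrite (chain_word chainX) -/(word_mass _ _ _ _).
rewrite -[word_mass _ _ _ _]/(wmX (a, s).1 (a, s).2).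
rewrite -(esum_joint_mass chainX chainY chainZ suppX suppY suppZ lawX lawY hphi hphirev).
rewrite (measure_esum Pr (h := fun w => (Yt t w, word (rtimes (t + 1)%R (size s)) Yt w))).
- apply: eq_esum => -[b v] _; rewrite -(joint_words t); congr (Pr _).
  by apply/seteqP; split => w [E1]; rewrite /mkset => -[E2 E3]; split=> //;
    rewrite /= E2 E3.
- exact: (measurable_word _ (fun u => u = _)).
- move=> [b v]; rewrite (_ : _ @^-1` _ =
      [set w | word (rtimes t (size s).+1) Yt w = b :: v]).
    exact: (measurable_word _ (fun u => u = _)).
  by apply/seteqP; split => w /= [-> ->].
Qed.

Lemma joint_law_snd : eq_law Pr Yt PrY Y.
Proof.
apply: eq_law_words => //; first by case: chainY.
move=> t b v; rewrite (chain_word chainY) -/(word_mass _ _ _ _).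
rewrite -[word_mass _ _ _ _]/(wmY (b, v).1 (b, v).2).
rewrite -(esum_joint_mass_snd chainX chainY chainZ suppX suppY suppZ lawX lawY hphi hphirev).
rewrite (measure_esum Pr (h := fun w => (Xt t w, word (rtimes (t + 1)%R (size v)) Xt w))).
- apply: eq_esum => -[a s] _.
  have [sz|sz] := eqVneq (size s) (size v).
    rewrite -(joint_words t) sz; congr (Pr _).
    apply/seteqP; split => w.
      by move=> [E1]; rewrite /mkset => -[E2 E3]; split => //; rewrite /= E2 E3.
    by move=> [[E2 E3] E1]; split => //; rewrite /mkset /= E2 E3.
  rewrite /joint_mass /matching /= ifF; last first.
    apply/negbTE; apply: contra sz => /andP[_ /eqP E].
    by rewrite -(size_map f) E size_map.
  rewrite (_ : _ `&` _ = set0) ?measure0//; apply/seteqP; split => // w [_].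
  by rewrite /mkset => -[_ E]; move/eqP: sz; apply; rewrite -E size_word size_rtimes.
- exact: (measurable_word _ (fun u => u = _)).
- move=> [a s]; rewrite (_ : _ @^-1` _ = (if size s == size v then
      [set w | word (rtimes t (size v).+1) Xt w = a :: s] else set0)).
    by case: ifP => // _; exact: (measurable_word _ (fun u => u = _)).
  case: eqP => sz; apply/seteqP; split => w //= [].
  + by move=> -> ->.
  + by move=> -> ->.
  + by move=> _ E; apply: sz; rewrite -E size_word size_rtimes.
Qed.

Let lawXt : eq_law Pr Xt PrX X. Proof. exact: joint_law_fst. Qed.
Let lawYt : eq_law Pr Yt PrY Y. Proof. exact: joint_law_snd. Qed.
Let lawZt : eq_law Pr Zt PrZ Z.
Proof. by move=> E sE; rewrite (eq_law_comp f lawXt sE) lawX. Qed.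

Let ZtE : Zt = fun t w => g (Yt t w).
Proof. by apply/funext => t; apply/funext => w; exact: joint_label. Qed.

Let GM : process_events Zt `<=` measurable.
Proof. exact: process_measurable. Qed.

Let word_map {S T : Type} (h : S -> T) (V : int -> Om -> S) ts w :
  word ts (fun t w => h (V t w)) w = map h (word ts V w).
Proof. by rewrite /word -map_comp. Qed.

(** Averaging over the frames of the labels gives the couplings, whose limit is
    the probability of the pair of words. *)
Lemma joint_windows t n u v (mF : measurable [set w | word (rtimes t n.+1) Yt w = v]) :
  \int[Pr]_(w in [set w | word (rtimes t n.+1) Xt w = u]) (cond_density Pr GM mF w)%:E =
  Pr ([set w | word (rtimes t n.+1) Xt w = u] `&` [set w | word (rtimes t n.+1) Yt w = v]).
Proof.
have emp (T : Type) (V : int -> Om -> T) u' : size u' != n.+1 ->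
    [set w | word (rtimes t n.+1) V w = u'] = set0.
  move=> nu; apply/seteqP; split => // w; rewrite /mkset => E; move/eqP: nu; apply.
  by rewrite -E size_word size_rtimes.
have [su|/emp ->] := eqVneq (size u) n.+1; last by rewrite integral_set0 set0I measure0.
have mE : measurable [set w | word (rtimes t n.+1) Xt w = u].
  exact: (measurable_word _ (fun u => u = _)).
have [sv|/emp v0] := eqVneq (size v) n.+1; last first.
  by rewrite (integral_cond_densityC Pr GM mE mF) v0 integral_set0 setI0 measure0.
case: u su mE => // a s [sn] mE; case: v sv mF => // b v [vn] mF.
transitivity (jm (a, s) (b, v))%:E; last first.
  by rewrite -(joint_words t) sn.
have lim := partition_cvg mE (@frame_event _ _ Zt t n) (@frame_refine _ _ Zt t n)
  (@frame_generate _ _ Zt t n) (GM := GM) (mF := mF).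
suff E k : \esum_(c in [set: seq C * (seq C * seq C)])
   (fine (Pr (frame Zt t n k @^-1` [set c] `&` [set w | word (rtimes t n.+1) Xt w = a :: s])) *
    fine (Pr (frame Zt t n k @^-1` [set c] `&` [set w | word (rtimes t n.+1) Yt w = b :: v])) /
    fine (Pr (frame Zt t n k @^-1` [set c])))%:E =
   coupling piX piY piZ PX PY PZ f g k k (a, s) (b, v).
  have lim' : coupling piX piY piZ PX PY PZ f g k k (a, s) (b, v) @[k --> \oo] -->
      \int[Pr]_(w in [set w | word (rtimes t n.+1) Xt w = a :: s])
        (cond_density Pr GM mF w)%:E.
    have -> := funext (fun k => esym (E k)); exact: lim.
  have lim2 : coupling piX piY piZ PX PY PZ f g k k (a, s) (b, v) @[k --> \oo] -->
      (jm (a, s) (b, v))%:E by exact: (coupling_cvg chainX chainY chainZ).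
  exact: (cvg_unique _ lim' lim2).
set T := fun c => (_ * _ / _)%:E.
have T0 c : 0 <= T c by rewrite lee_fin divr_ge0 ?mulr_ge0 ?fine_ge0.
transitivity (\esum_(u in [set: seq C]) \esum_(q in [set: seq C * seq C]) T (u, q)).
  by rewrite esum_pair//; apply: eq_esum => -[u q].
rewrite (@esum_single _ _ _ (map f (a :: s))); last 2 first.
- by apply: esum_ge0.
- move=> u nu; rewrite esum1// => q _; rewrite /T (_ : _ `&` _ = set0) ?measure0 ?mul0r//.
  apply/seteqP; split => // w [/= [E1 _] [E3 E4]]; move/eqP: nu; apply.
  by rewrite -E1 -E3 -E4 word_map.
rewrite /coupling; case: ifPn => [/andP[/= /eqP ab /eqP sv]|nm]; last first.
  rewrite esum1// => q _; rewrite /T.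
  rewrite (_ : frame _ _ _ _ @^-1` _ `&` [set w | word (rtimes t n.+1) Yt w = b :: v] = set0).
    by rewrite measure0 mulr0 mul0r.
  apply/seteqP; split => // w [/= [E1 E2 _] [E3 E4]]; move/negP: nm; apply.
  by rewrite /matching /= -E1 -E2 -E3 -E4 ZtE word_map !eqxx.
apply: eq_esum => -[l r] _ /=; rewrite /T /=.
have -> : frame Zt t n k @^-1` [set (f a :: map f s, (l, r))] =
    [set w | [/\ word (ltimes t k) (fun t w => id (Zt t w)) w = l,
      word (rtimes t (size (map f s)).+1) Zt w = f a :: map f s &
      word (rtimes (t + (size (map f s)).+1%:Z)%R k) (fun t w => id (Zt t w)) w = r]].
  rewrite size_map sn; apply/seteqP; split => w; rewrite /frame /preimage /mkset.
    by move=> [E1 E2 E3 E4]; split => //; rewrite /= E1 E2.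
  by move=> [<- -> <-].
rewrite (eq_law_window id lawZt chainZ suppZ).
congr ((_ * _ / _)%:E).
- rewrite -[LHS]/(fine (_ _)) -[RHS]/(fine (window_mass f piX PX k k l a s r)%:E).
  rewrite -(eq_law_window f lawXt chainX suppX t); congr (fine (Pr _)).
  rewrite size_map sn; apply/seteqP; split => w; first by move=> [[E1 E2 E3] E4]; split.
  move=> [E1 E2 E3]; split => //; split => //.
  by rewrite word_map E2.
- rewrite -[LHS]/(fine (_ _)) -[RHS]/(fine (window_mass g piY PY k k l b v r)%:E).
  rewrite -(eq_law_window g lawYt chainY suppY t); congr (fine (Pr _)).
  rewrite size_map sn vn -ZtE; apply/seteqP; split => w.
    by move=> [[E1 E2 E3] E4]; split.
  move=> [E1 E2 E3]; split => //; split => //.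
  by rewrite ZtE word_map E2 /= ab sv.
Qed.

Lemma joint_cond_independent : cond_independent Pr Xt Yt (fun t w => f (Xt t w)).
Proof.
apply: (decoupled_cond_independent (GM := GM)).
- exact: process_measurable.
- exact: process_measurable.
- move=> E F mF sE sF; apply: (decoupled_windows pX pY) => //.
  exact: joint_windows.
Qed.

End Law.

End JointChain.

Local Close Scope ereal_scope.
Unset Implicit Arguments.

Theorem mainTheorem7 (R : realType) (A B C : countType)
  (dX dY dZ : measure_display)
  (OX : measurableType dX) (OY : measurableType dY) (OZ : measurableType dZ)
  (PrX : probability OX R) (PrY : probability OY R) (PrZ : probability OZ R)
  (X : int -> OX -> A) (Y : int -> OY -> B) (Z : int -> OZ -> C)
  (piX : A -> R) (piY : B -> R) (piZ : C -> R)
  (PX : A -> A -> R) (PY : B -> B -> R) (PZ : C -> C -> R)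
  (chainX : stationary_markov_chain PrX X piX PX)
  (chainY : stationary_markov_chain PrY Y piY PY)
  (chainZ : stationary_markov_chain PrZ Z piZ PZ)
  (suppX : forall a, 0 < piX a)
  (suppY : forall b, 0 < piY b)
  (suppZ : forall c, 0 < piZ c)
  (f : A -> C) (g : B -> C)
  (lawX : eq_law PrX (fun t w => f (X t w)) PrZ Z)
  (lawY : eq_law PrY (fun t w => g (Y t w)) PrZ Z) :
  let M := fiber_mx f g PX PY PZ in
  let Mrev := fiber_mx f g (rev_mx piX PX) (rev_mx piY PY) (rev_mx piZ PZ) in
  exists phi phirev : Delta f g -> R,
    [/\ (forall x, mapply (mpow M m) (fun=> 1) x @[m --> \oo] --> (phi x)%:E),
        (forall x, mapply (mpow Mrev m) (fun=> 1) x @[m --> \oo]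
                     --> (phirev x)%:E) &
        let piW := joint_distribution phi phirev piX piY piZ in
        let P := joint_transition phi phirev M in
        [/\ is_distribution piW,
            stochastic P,
            invariant_distribution piW P,
            (exists (d : measure_display) (Om : measurableType d)
               (Pr : probability Om R) (W : int -> Om -> Delta2 phi phirev),
               stationary_markov_chain Pr W piW P) &
            forall (d : measure_display) (Om : measurableType d)
              (Pr : probability Om R) (W : int -> Om -> Delta2 phi phirev),
              stationary_markov_chain Pr W piW P ->
              let Xt := fun t w => Delta2_fst (W t w) in
              let Yt := fun t w => Delta2_snd (W t w) in
              [/\ eq_law Pr Xt PrX X,
                  eq_law Pr Yt PrY Y,
                  (forall t w, f (Xt t w) = g (Yt t w)) &
                  cond_independent Pr Xt Yt (fun t w => f (Xt t w))]]].
Proof.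
move=> M Mrev.
have [_ _ _ stX _] := chainX; have [_ _ _ stY _] := chainY; have [_ _ _ stZ _] := chainZ.
have srX := rev_stochastic chainX suppX.
have srY := rev_stochastic chainY suppY.
have srZ := rev_stochastic chainZ suppZ.
have domX := label_prob_dominated chainX chainZ suppX suppZ lawX.
have domY := label_prob_dominated chainY chainZ suppY suppZ lawY.
(* the reversed chains are dominated in the same way, so that the same two lemmas
   produce [phirev] *)
have rdomX := rev_label_prob_dominated chainX chainZ suppX suppZ lawX.
have rdomY := rev_label_prob_dominated chainY chainZ suppY suppZ lawY.
have [phi [phi0 hphi]] := fiber_limit stX stY stZ suppX suppY suppZ domX domY.
have [phirev [phirev0 hphirev]] := fiber_limit srX srY srZ suppX suppY suppZ rdomX rdomY.
have harm := fiber_harmonic stX stY stZ suppX suppY suppZ domX domY phi0 hphi.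
have harm_rev := fiber_harmonic srX srY srZ suppX suppY suppZ rdomX rdomY phirev0 hphirev.
exists phi, phirev; split.
- move=> x; under eq_fun do rewrite (mapply_mpow stX stY stZ).
  exact: hphi.
- move=> x; under eq_fun do rewrite (mapply_mpow srX srY srZ).
  exact: hphirev.
move=> piW P.
have dW : is_distribution piW.
  exact: (joint_is_distribution chainX chainY chainZ suppX suppY suppZ lawX lawY).
have sW : stochastic P.
  exact: (joint_stochastic chainX chainY chainZ suppX suppY suppZ).
have iW : invariant_distribution piW P.
  exact: (joint_invariant chainX chainY chainZ suppX suppY suppZ).
split => //.
  apply: two_sided_chain_exists => // x; exact: piW_gt0.
move=> d Om Pr W chainW Xt Yt; split.
- exact: (joint_law_fst chainX chainY chainZ suppX suppY suppZ lawX lawY).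
- exact: (joint_law_snd chainX chainY chainZ suppX suppY suppZ lawX lawY).
- by move=> t w; rewrite /Xt /Yt /Delta2_fst /Delta2_snd fiber_labels.
- exact: (joint_cond_independent chainX chainY chainZ suppX suppY suppZ lawX lawY).
Qed.
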